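(* Let $\lambda>1$ be a fixed real number, let $z=\lambda a$, and let $N$ be a non-negative integer. Then, for $|\arg a|<\pi$, $$\Gamma(a,z)=z^a e^{-z}\left(\sum_{n=0}^{N-1}\frac{(-a)^n b_n(\lambda)}{(z-a)^{2n+1}}+R_N(a,\lambda)\right),$$ where, for every integer $n\ge 0$, $$b_n(\lambda)=(-1)^n(\lambda-1)^n\left[\frac{d^n}{dt^n}\left(\frac{(\lambda-1)t}{\lambda e^t-t-\lambda}\right)^{n+1}\right]_{t=0}=\frac{(\lambda-1)^{2n+1}}{\sqrt{2\pi}}\int_0^{+\infty}\frac{t^{n-\frac12}e^{-t(\lambda-\log\lambda-1)}}{\Gamma^\ast(t)}\,dt$$ and $$R_N(a,\lambda)=\frac{(-a)^N}{(z-a)^{2N+1}}\,\frac{(\lambda-1)^{2N+1}}{\sqrt{2\pi}}\int_0^{+\infty}\frac{t^{N-\frac12}e^{-t(\lambda-\log\lambda-1)}}{1+t/a}\,\frac{dt}{\Gamma^\ast(t)}.$$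
   Context: $\Gamma(a,z)$ is the (upper) incomplete gamma function, $\Gamma(a,z)=\int_z^{+\infty}t^{a-1}e^{-t}\,dt$ (principal branch for $|\arg z|<\pi$); here $\arg z=\arg a$ and $z^a=e^{a\log z}$ with $\log z=\log|z|+i\arg z$. The scaled gamma function is $\Gamma^\ast(w)=\dfrac{\Gamma(w)}{\sqrt{2\pi}\,w^{w-\frac12}e^{-w}}$ for $|\arg w|<\pi$. Empty sums are zero. The function $\frac{(\lambda-1)t}{\lambda e^t-t-\lambda}$ has a removable singularity at $t=0$, with value $1$ there. *)

(* Defs.v *)
From HB Require Import structures.
From mathcomp Require Import all_boot all_order all_algebra.
From mathcomp Require Import all_classical all_reals all_analysis.
From mathcomp Require Import complex.

Set Implicit Arguments.
Unset Strict Implicit.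
Unset Printing Implicit Defensive.

Import Order.TTheory GRing.Theory Num.Theory.
Import numFieldNormedType.Exports.

Local Open Scope classical_set_scope.
Local Open Scope ring_scope.
Local Open Scope complex_scope.

Definition cmod (R : realType) (z : R[i]) : R :=
  Num.sqrt (complex.Re z ^+ 2 + complex.Im z ^+ 2).

(* Principal argument, with values in ]-pi, pi]; meaningless at z = 0. *)
Definition carg (R : realType) (z : R[i]) : R :=
  let theta := acos (complex.Re z / cmod z) in
  if 0 <= complex.Im z then theta else - theta.

Definition clog (R : realType) (z : R[i]) : R[i] := ln (cmod z) +i* carg z.

Definition cexp (R : realType) (z : R[i]) : R[i] :=
  (expR (complex.Re z))%:C * (cos (complex.Im z) +i* sin (complex.Im z)).

(* Principal value; only meaningful for z != 0. *)
Definition cpow (R : realType) (z w : R[i]) : R[i] := cexp (w * clog z).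

(* z lies in the plane cut along ]-oo, 0], i.e. |arg z| < pi. *)
Definition cut_plane (R : realType) (z : R[i]) : Prop :=
  z != 0 /\ `|carg z| < pi.

Definition cintegrable (R : realType) (D : set R) (f : R -> R[i]) : Prop :=
  lebesgue_measure.-integrable D (fun t => (complex.Re (f t))%:E) /\
  lebesgue_measure.-integrable D (fun t => (complex.Im (f t))%:E).

Definition cintegral (R : realType) (D : set R) (f : R -> R[i]) : R[i] :=
  Rintegral lebesgue_measure D (fun t => complex.Re (f t))
  +i* Rintegral lebesgue_measure D (fun t => complex.Im (f t)).

(* Principal branch of the integral of t^(a-1) e^-t from z to +oo, for
   |arg z| < pi: the path is the horizontal half-line t = z + s, s > 0, which
   stays in the cut plane. *)
Definition incomplete_gamma (R : realType) (a z : R[i]) : R[i] :=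
  cintegral `]0, +oo[
    (fun s => cpow (z + s%:C) (a - 1) * cexp (- (z + s%:C))).

(* Euler's integral, for Re w > 0. *)
Definition euler_gamma (R : realType) (w : R[i]) : R[i] :=
  cintegral `]0, +oo[ (fun t => cpow t%:C (w - 1) * cexp (- t%:C)).

(* The least k with Re w + k > 0. *)
Definition gamma_shift (R : realType) (w : R[i]) : nat :=
  if 0 < complex.Re w then 0%N else (Num.truncn (- complex.Re w)).+1.

(* Continuation to C minus {0, -1, -2, ...} by
   Gamma(w) = Gamma(w + k) / (w (w + 1) ... (w + k - 1)). *)
Definition Gamma (R : realType) (w : R[i]) : R[i] :=
  euler_gamma (w + (gamma_shift w)%:R) / \prod_(j < gamma_shift w) (w + j%:R).

Definition scaled_gamma (R : realType) (w : R[i]) : R[i] :=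
  Gamma w / ((Num.sqrt (2 * pi))%:C * cpow w (w - 2^-1) * cexp (- w)).

(* (lambda - 1) t / (lambda e^t - t - lambda), with its removable singularity
   at t = 0 filled in. *)
Definition bgen (R : realType) (lambda t : R) : R :=
  if t == 0 then 1
  else (lambda - 1) * t / (lambda * expR t - t - lambda).

Definition bcoef (R : realType) (lambda : R) (n : nat) : R :=
  (-1) ^+ n * (lambda - 1) ^+ n
  * derive1n n (fun t : R => bgen lambda t ^+ n.+1) 0.

Definition bintegrand (R : realType) (lambda : R) (n : nat) (t : R) : R[i] :=
  (t `^ (n%:R - 2^-1) * expR (- t * (lambda - ln lambda - 1)))%:C
  / scaled_gamma t%:C.

Definition Rintegrand (R : realType) (lambda : R) (a : R[i]) (n : nat) (t : R)
    : R[i] :=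
  (t `^ (n%:R - 2^-1) * expR (- t * (lambda - ln lambda - 1)))%:C
  / (1 + t%:C / a) / scaled_gamma t%:C.

Definition remainder (R : realType) (N : nat) (a : R[i]) (lambda : R) : R[i] :=
  let z := lambda%:C * a in
  (- a) ^+ N / (z - a) ^+ (2 * N + 1)
  * ((lambda - 1) ^+ (2 * N + 1) / Num.sqrt (2 * pi))%:C
  * cintegral `]0, +oo[ (Rintegrand lambda a N).

(* Main.v *)
Require Import Defs.
From mathcomp Require Import all_boot all_order all_algebra.
From mathcomp Require Import all_classical all_reals all_analysis.
From mathcomp Require Import complex.
From mathcomp Require Import measurable_realfun lebesgue_integral_under.
From mathcomp Require Import ring lra.

Set Implicit Arguments.
Unset Strict Implicit.
Unset Printing Implicit Defensive.

Import Order.TTheory GRing.Theory Num.Theory.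
Import numFieldNormedType.Exports.

Local Open Scope classical_set_scope.
Local Open Scope ring_scope.
Local Open Scope complex_scope.

(** Let [v(z) = z - log z] and [phi(t) = t^t / Gamma(t + 1)], for [t > 0].  By
    the definition of [Gamma^*], the two integrands of the theorem are
    [sqrt(2 pi) t^n exp(-t v(lambda)) phi(t)] and the same function divided by
    [1 + t / a] (lemmas [bintegrandE] and [RintegrandE]).  The theorem is thus a
    statement about the density [phi], and it follows from

    - [Gamma(a, z) = z^a exp(-z) * int exp(-t v(lambda)) phi(t) / (a + t) dt] for
      [z = lambda a], which is [incomplete_gamma_stieltjes], and

    - [b_n = (lambda - 1)^(2n+1) * int t^n exp(-t v(lambda)) phi(t) dt], which is
      [bcoefE]:

    expanding [1 / (a + t)] in powers of [t / a] in the first formula, with an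
    exact remainder, gives the moments of the second one ([moment_expansion]).

    Both formulas rest on one Laplace transform, [laplace_phiE]:
    [int exp(-t v(w)) phi(t) dt = 1 / (w - 1)], also for complex [w].  To obtain
    it, write [phi] by inversion of Euler's integral as
    [phi(t) = 1 / (2 pi) * int exp(t s) s^(-t-1) dth] on the line
    [s = 1 + i th].  The integral converges only conditionally, so that it is
    read as a limit of Abel means, which are integrals against Poisson kernels
    ([abel_meanE], [abel_mean_cvg]).  Exchanging the integrals gives
    [1 / (2 pi) * int dth / (s (v(w) - v(s)))] ([laplace_phi]).  On the right of
    the line the integrand has a single pole, at [s = w], by the lower bound
    [vmap_lower]; its residue is extracted by comparing vertical lines on both
    sides of the pole.  Moving such a line towards the pole or away from it does
    not change the integral, as differentiation under the integral sign shows
    ([cderiv_contour_int]); moved to infinity the right one gives [0], and near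
    the pole the difference of the two integrands is almost a multiple of a
    Poisson kernel again ([line_integral]).

    For the first formula, let a complex variable [w] take the place of [lambda].
    Both sides, divided by [a^a], have the derivative [- exp(-a v(w)) / w] in
    [w], because differentiation in [v] cancels the denominator [a + t] and
    leaves the Laplace transform of [phi].  Their difference [defect] is
    therefore constant along paths, and it tends to [0] along a ray in a
    direction [om] for which both [om] and [om a] have a positive real part.
    This covers the whole cut plane of [a] at once.

    For the second formula, replace [lambda] by [lambda exp u] and put
    [W(u) = lambda exp u - u - lambda].  The Laplace transform becomes [1 / W'],
    and the moments are its iterated derivatives with respect to [W], up to sign.
    Lagrange's inversion formula ([derive1n_lagrange]) expresses them as the
    derivatives at [0] of the powers of [u / W(u)], which up to a factor is the
    generating function of the [b_n]. *)

(** * The modulus, the exponential and the logarithm in the cut plane *)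

Section cmod_theory.
Variable R : realType.
Implicit Types z w : R[i].

Lemma ReD z w : complex.Re (z + w) = complex.Re z + complex.Re w.
Proof. by case: z w => [? ?] [? ?]. Qed.
Lemma ImD z w : complex.Im (z + w) = complex.Im z + complex.Im w.
Proof. by case: z w => [? ?] [? ?]. Qed.
Lemma ReN z : complex.Re (- z) = - complex.Re z. Proof. by case: z. Qed.
Lemma ImN z : complex.Im (- z) = - complex.Im z. Proof. by case: z. Qed.
Lemma ReM z w : complex.Re (z * w) =
  complex.Re z * complex.Re w - complex.Im z * complex.Im w.
Proof. by case: z w => [? ?] [? ?]. Qed.
Lemma ImM z w : complex.Im (z * w) =
  complex.Re z * complex.Im w + complex.Im z * complex.Re w.
Proof. by case: z w => [? ?] [? ?]. Qed.

Definition ReIm := (ReD, ImD, ReN, ImN, ReM, ImM).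

Lemma complexP z w :
  complex.Re z = complex.Re w -> complex.Im z = complex.Im w -> z = w.
Proof. by case: z w => [? ?] [? ?] /= -> ->. Qed.

Lemma cmodE z : cmod z = ComplexField.Normc.normc z.
Proof. by case: z. Qed.

Lemma cmod_ge0 z : 0 <= cmod z. Proof. exact: sqrtr_ge0. Qed.

Lemma cmod_sqr z : cmod z ^+ 2 = complex.Re z ^+ 2 + complex.Im z ^+ 2.
Proof. by rewrite sqr_sqrtr// addr_ge0// sqr_ge0. Qed.

Lemma cmod0 : cmod (0 : R[i]) = 0.
Proof. by rewrite cmodE ComplexField.Normc.normc0. Qed.

Lemma cmodM z w : cmod (z * w) = cmod z * cmod w.
Proof. by rewrite !cmodE ComplexField.Normc.normcM. Qed.

Lemma cmodV z : cmod z^-1 = (cmod z)^-1.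
Proof. by rewrite !cmodE ComplexField.Normc.normcV. Qed.

Lemma cmodN z : cmod (- z) = cmod z.
Proof. by rewrite /cmod !ReIm !sqrrN. Qed.

Lemma cmodB z w : cmod (z - w) = cmod (w - z).
Proof. by rewrite -cmodN opprB. Qed.

Lemma cmod_real (x : R) : cmod x%:C = `|x|.
Proof. by rewrite /cmod /= expr0n addr0 sqrtr_sqr. Qed.

Lemma cmod1 : cmod (1 : R[i]) = 1.
Proof. by rewrite -[1]/(1%:C) cmod_real normr1. Qed.

Lemma le_cmodD z w : cmod (z + w) <= cmod z + cmod w.
Proof. by rewrite !cmodE le_normcD. Qed.

Lemma Re_le_cmod z : `|complex.Re z| <= cmod z.
Proof.
by rewrite -sqrtr_sqr ler_wsqrtr// lerDl sqr_ge0.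
Qed.

Lemma Im_le_cmod z : `|complex.Im z| <= cmod z.
Proof.
by rewrite -sqrtr_sqr ler_wsqrtr// lerDr sqr_ge0.
Qed.

Lemma cmod_le z : cmod z <= `|complex.Re z| + `|complex.Im z|.
Proof.
rewrite -(ler_pXn2r (_ : 0 < 2)%N) ?nnegrE ?cmod_ge0 ?addr_ge0//.
rewrite cmod_sqr sqrrD !real_normK ?num_real//.
by rewrite addrAC lerDl mulrn_wge0// mulr_ge0.
Qed.

Lemma cmod_eq0 z : (cmod z == 0) = (z == 0).
Proof.
apply/eqP/eqP => [|->]; last exact: cmod0.
by rewrite cmodE => /ComplexField.Normc.eq0_normc.
Qed.

Lemma cmod_gt0 z : (0 < cmod z) = (z != 0).
Proof. by rewrite lt_def cmod_ge0 andbT cmod_eq0. Qed.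

Lemma real_complexD (x y : R) : (x + y)%:C = x%:C + y%:C.
Proof. exact: rmorphD. Qed.
Lemma real_complexM (x y : R) : (x * y)%:C = x%:C * y%:C.
Proof. exact: rmorphM. Qed.
Lemma real_complexV (x : R) : (x^-1)%:C = x%:C^-1.
Proof. exact: fmorphV. Qed.
Lemma real_complex_eq0 (x : R) : (x%:C == 0) = (x == 0).
Proof. by rewrite eq_complex /= eqxx andbT. Qed.

Lemma Re_inv z : complex.Re z^-1 = complex.Re z / cmod z ^+ 2.
Proof. by rewrite cmod_sqr; case: z. Qed.
Lemma Im_inv z : complex.Im z^-1 = - complex.Im z / cmod z ^+ 2.
Proof. by rewrite cmod_sqr; case: z => a b; rewrite /= -mulNr. Qed.

End cmod_theory.

Section cexp_theory.
Variable R : realType.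
Implicit Types z w : R[i].

Lemma Re_cexp z : complex.Re (cexp z) =
  expR (complex.Re z) * cos (complex.Im z).
Proof. by rewrite /cexp ReM /= mul0r subr0. Qed.
Lemma Im_cexp z : complex.Im (cexp z) =
  expR (complex.Re z) * sin (complex.Im z).
Proof. by rewrite /cexp ImM /= mul0r addr0. Qed.

Lemma cexpD z w : cexp (z + w) = cexp z * cexp w.
Proof.
by apply: complexP; rewrite ?(ReM, ImM, Re_cexp, Im_cexp, ReD, ImD) expRD ?cosD ?sinD;
  ring.
Qed.

Lemma cmod_cexp z : cmod (cexp z) = expR (complex.Re z).
Proof.
rewrite /cmod Re_cexp Im_cexp !exprMn -mulrDr cos2Dsin2 mulr1 sqrtr_sqr.
by rewrite ger0_norm ?expR_ge0.
Qed.

Lemma cexp_neq0 z : cexp z != 0.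
Proof. by rewrite -cmod_gt0 cmod_cexp expR_gt0. Qed.

Lemma cexp_real (x : R) : cexp x%:C = (expR x)%:C.
Proof. by apply: complexP; rewrite ?(Re_cexp, Im_cexp) /= ?cos0 ?sin0 ?mulr1 ?mulr0. Qed.

Lemma cexp0 : cexp 0 = 1 :> R[i].
Proof. by rewrite -[0]/(0%:C) cexp_real expR0. Qed.

Lemma cexpN z : cexp (- z) = (cexp z)^-1.
Proof.
by apply: (mulIf (cexp_neq0 z)); rewrite -cexpD addNr cexp0 mulVf ?cexp_neq0.
Qed.

End cexp_theory.

Section clog_theory.
Variable R : realType.
Implicit Types z w : R[i].

(** The cut plane as an open condition on the signs of the real and imaginary
    parts, which is what differentiating along a path requires. *)
Definition slit z := (complex.Im z != 0) || (0 < complex.Re z).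

Lemma slit_neq0 z : slit z -> z != 0.
Proof.
by apply: contraTneq => ->; rewrite /slit/= eqxx ltxx.
Qed.

Lemma slit_Re z : 0 < complex.Re z -> slit z.
Proof. by rewrite /slit => ->; rewrite orbT. Qed.

Lemma slit_cmodDRe z : slit z -> 0 < cmod z + complex.Re z.
Proof.
move=> sz; have := Re_le_cmod z; rewrite ler_norml => /andP[h1 h2].
rewrite -ltrBlDr sub0r lt_neqAle; apply/andP; split; last by rewrite lerNl.
apply/eqP => h; have := cmod_sqr z; rewrite -h sqrrN => /eqP.
rewrite -subr_eq0 opprD addNKr oppr_eq0 sqrf_eq0 => y0.
move: sz; rewrite /slit y0/= => x0.
by have := cmod_ge0 z; rewrite -h oppr_ge0 leNgt x0.
Qed.

Lemma half_angle (x y m : R) : m ^+ 2 = x ^+ 2 + y ^+ 2 -> 0 < m ->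
  0 < m + x -> 1 + (y / (m + x)) ^+ 2 = 2 * m / (m + x).
Proof.
move=> e m0 mx0.
have -> : (y / (m + x)) ^+ 2 = (m ^+ 2 - x ^+ 2) / (m + x) ^+ 2.
  by rewrite e expr_div_n; congr (_ / _); ring.
by field; rewrite gt_eqF.
Qed.

(** The formula [arg z = 2 atan (y / (|z| + x))] is differentiable on the whole
    cut plane, whereas the definition through [acos] changes its expression on
    the real axis. *)
Lemma slit_atan z : slit z ->
  let t := 2 * atan (complex.Im z / (cmod z + complex.Re z)) in
  [/\ carg z = t, cos t = complex.Re z / cmod z & sin t = complex.Im z / cmod z].
Proof.
move=> sz; have m0 : 0 < cmod z by rewrite cmod_gt0 slit_neq0.
have mx := slit_cmodDRe sz.
set q := complex.Im z / _ => t.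
have hq : 1 + q ^+ 2 = 2 * cmod z / (cmod z + complex.Re z).
  exact: half_angle (cmod_sqr z) m0 mx.
have q0 : 0 < 1 + q ^+ 2 by rewrite ltr_pwDl// sqr_ge0.
have c2 : cos (atan q) ^+ 2 = (1 + q ^+ 2)^-1.
  by rewrite cos_atan exprVn sqr_sqrtr// ltW.
have ca0 : cos (atan q) != 0.
  by rewrite cos_atan invr_eq0 sqrtr_eq0 -ltNge.
have cost : cos t = complex.Re z / cmod z.
  rewrite /t mulr_natl cos_mulr2n c2 hq -mulr_natr.
  by field; rewrite !gt_eqF.
have sint : sin t = complex.Im z / cmod z.
  have sa : sin (atan q) = q * cos (atan q).
    by rewrite -{2}(atanK q) /tan divfK.
  rewrite /t mulr_natl sin_mulr2n sa.
  have -> : (cos (atan q) * (q * cos (atan q))) *+ 2 = 2 * q * cos (atan q) ^+ 2.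
    by rewrite -mulr_natr; ring.
  by rewrite c2 hq /q; field; rewrite !gt_eqF.
split=> //; rewrite /carg -cost.
have pq1 := atan_gtNpi2 q; have pq2 := atan_ltpi2 q.
case: ifPn => [y0|]; last rewrite -ltNge => y0.
- rewrite cosK// in_itv/=; apply/andP; split; last first.
    by rewrite /t; lra.
  rewrite mulr_ge0// -atan0 le_atan//.
  by rewrite divr_ge0// ltW.
- rewrite cosKN ?opprK//; apply/andP; split.
    by rewrite /t; lra.
  rewrite pmulr_rle0// -atan0 le_atan//.
  by rewrite ltW// pmulr_llt0// invr_gt0.
Qed.

Lemma cexp_clog z : slit z -> cexp (clog z) = z.
Proof.
move=> sz; have m0 : 0 < cmod z by rewrite cmod_gt0 slit_neq0.
have [ca co si] := slit_atan sz.
apply: complexP; rewrite ?(Re_cexp, Im_cexp) /= lnK ?posrE// ca ?co ?si mulrC;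
  by rewrite divfK// gt_eqF.
Qed.

Lemma carg_bound z : slit z -> `|carg z| < pi.
Proof.
move=> /slit_atan[-> _ _]; set q := _ / _.
have pq1 := atan_gtNpi2 q; have pq2 := atan_ltpi2 q.
by rewrite ltr_norml; apply/andP; split; lra.
Qed.

Lemma slit_cut_plane z : cut_plane z -> slit z.
Proof.
move=> [z0 hz]; rewrite /slit; case: eqVneq => //= y0.
rewrite ltNge; apply/negP => x0; move: hz; rewrite /carg y0 lexx.
have -> : complex.Re z / cmod z = -1.
  rewrite /cmod y0 expr0n/= addr0 sqrtr_sqr ler0_norm//.
  rewrite invrN mulrN divff//.
  by apply: contra_neq z0 => x1; apply: complexP.
by rewrite acosN1 ger0_norm ?pi_ge0// ltxx.
Qed.

Lemma carg_real (x : R) : 0 < x -> carg x%:C = 0.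
Proof.
by move=> x0; rewrite /carg cmod_real gtr0_norm//= lexx divff ?gt_eqF// acos1.
Qed.

Lemma clog_real (x : R) : 0 < x -> clog x%:C = (ln x)%:C.
Proof. by move=> x0; rewrite /clog carg_real// cmod_real gtr0_norm. Qed.

Lemma slitM_real (x : R) z : 0 < x -> slit z -> slit (x%:C * z).
Proof.
move=> x0; rewrite /slit ReM ImM /= !mul0r subr0 addr0.
by rewrite mulf_eq0 (gt_eqF x0) /= (pmulr_rgt0 _ x0).
Qed.

Lemma clogM_real (x : R) z : 0 < x -> slit z ->
  clog (x%:C * z) = (ln x)%:C + clog z.
Proof.
move=> x0 sz.
have m0 : 0 < cmod z by rewrite cmod_gt0 slit_neq0.
rewrite /clog cmodM cmod_real gtr0_norm// lnM ?posrE//.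
apply: complexP => //=; rewrite add0r /carg ReM ImM /= !mul0r subr0 addr0.
rewrite cmodM cmod_real gtr0_norm// pmulr_rge0//.
by rewrite -mulf_div divff ?mul1r// gt_eqF.
Qed.

End clog_theory.

Section cderiv.
Variable R : realType.
Implicit Types (f g : R -> R[i]) (x : R) (d e : R[i]).

(** All complex analysis below takes place along paths with a real parameter,
    so that derivatives can be taken componentwise. *)
Definition cderiv f x d :=
  is_derive x 1 (fun r => complex.Re (f r)) (complex.Re d) /\
  is_derive x 1 (fun r => complex.Im (f r)) (complex.Im d).

Lemma cderiv_eq f x d e : cderiv f x d -> d = e -> cderiv f x e.
Proof. by move=> ? <-. Qed.

Lemma cderiv_cst (c : R[i]) x : cderiv (fun=> c) x 0.
Proof. by split; exact: is_derive_cst. Qed.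

Lemma cderiv_real (f : R -> R) x (d : R) : is_derive x 1 f d ->
  cderiv (fun r => (f r)%:C) x d%:C.
Proof. by move=> fd; split => //=; exact: is_derive_cst. Qed.

Lemma cderiv_id x : cderiv (fun r => r%:C) x 1.
Proof. exact: (@cderiv_real id). Qed.

Lemma cderivD f g x d e : cderiv f x d -> cderiv g x e ->
  cderiv (fun r => f r + g r) x (d + e).
Proof.
move=> [f1 f2] [g1 g2]; split; rewrite ?(ReD, ImD).
- by under eq_fun do rewrite ReD; exact: is_deriveD.
- by under eq_fun do rewrite ImD; exact: is_deriveD.
Qed.

Lemma cderivN f x d : cderiv f x d -> cderiv (fun r => - f r) x (- d).
Proof.
move=> [f1 f2]; split; rewrite ?(ReN, ImN).
- by under eq_fun do rewrite ReN; exact: is_deriveN.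
- by under eq_fun do rewrite ImN; exact: is_deriveN.
Qed.

Lemma cderivB f g x d e : cderiv f x d -> cderiv g x e ->
  cderiv (fun r => f r - g r) x (d - e).
Proof. by move=> ? ?; apply: cderivD => //; exact: cderivN. Qed.

Lemma cderivM f g x d e : cderiv f x d -> cderiv g x e ->
  cderiv (fun r => f r * g r) x (d * g x + f x * e).
Proof.
move=> [f1 f2] [g1 g2]; split; rewrite ?(ReD, ImD, ReM, ImM).
- under eq_fun do rewrite ReM.
  have h1 := is_deriveM f1 g1; have h2 := is_deriveM f2 g2.
  have := is_deriveB h1 h2 => hh; apply: (is_derive_eq hh).
  by rewrite /GRing.scale/=; ring.
- under eq_fun do rewrite ImM.
  have h1 := is_deriveM f1 g2; have h2 := is_deriveM f2 g1.
  have := is_deriveD h1 h2 => hh; apply: (is_derive_eq hh).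
  by rewrite /GRing.scale/=; ring.
Qed.

Lemma cderivZ (c : R[i]) f x d : cderiv f x d ->
  cderiv (fun r => c * f r) x (c * d).
Proof.
move=> fd; apply: cderiv_eq (cderivM (cderiv_cst c x) fd) _.
by rewrite mul0r add0r.
Qed.

Lemma cderiv_cexp f x d : cderiv f x d ->
  cderiv (fun r => cexp (f r)) x (d * cexp (f x)).
Proof.
move=> [f1 f2]; split; rewrite ?(ReM, ImM, Re_cexp, Im_cexp).
- under eq_fun do rewrite Re_cexp.
  have h1 := is_derive1_comp (is_derive_expR _) f1.
  have h2 := is_derive1_comp (is_derive_cos _) f2.
  have := is_deriveM h1 h2 => hh; apply: (is_derive_eq hh).
  by rewrite /GRing.scale/=; ring.
- under eq_fun do rewrite Im_cexp.
  have h1 := is_derive1_comp (is_derive_expR _) f1.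
  have h2 := is_derive1_comp (is_derive_sin _) f2.
  have := is_deriveM h1 h2 => hh; apply: (is_derive_eq hh).
  by rewrite /GRing.scale/=; ring.
Qed.

Lemma is_derive_cmod f x d : cderiv f x d -> f x != 0 ->
  is_derive x 1 (fun r => cmod (f r))
   ((complex.Re (f x) * complex.Re d + complex.Im (f x) * complex.Im d)
     / cmod (f x)).
Proof.
move=> [f1 f2] fx0.
have h := is_deriveD (is_deriveX 2 f1) (is_deriveX 2 f2).
have c0 : 0 < complex.Re (f x) ^+ 2 + complex.Im (f x) ^+ 2.
  by rewrite -cmod_sqr exprn_gt0// cmod_gt0.
have hh := @is_derive1_comp _ Num.sqrt
  (fun r => complex.Re (f r) ^+ 2 + complex.Im (f r) ^+ 2) _ _ _
  (is_derive1_sqrt c0) h.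
apply: (is_derive_eq hh); rewrite -/(cmod (f x)) /GRing.scale/=.
have : cmod (f x) != 0 by rewrite cmod_eq0.
by move=> ?; field.
Qed.

Lemma near_cderiv f g x d : (\forall y \near x, f y = g y) ->
  cderiv f x d -> cderiv g x d.
Proof.
move=> fg [f1 f2]; split.
- apply: near_eq_is_derive f1.
  by near=> y; congr (complex.Re _); near: y.

- apply: near_eq_is_derive f2.
  by near=> y; congr (complex.Im _); near: y.
Unshelve. all: by end_near. Qed.

Lemma is_derive_div (u v : R -> R) x (du dv : R) : v x != 0 ->
  is_derive x 1 u du -> is_derive x 1 v dv ->
  is_derive x 1 (fun r => u r / v r) ((du * v x - u x * dv) / v x ^+ 2).
Proof.
move=> v0 hu hv; have hi := is_deriveV v0 hv.
apply: (is_derive_eq (is_deriveM hu hi)).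
by rewrite /GRing.scale/=; field.
Qed.

Lemma cderivV f x d : cderiv f x d -> f x != 0 ->
  cderiv (fun r => (f r)^-1) x (- d / f x ^+ 2).
Proof.
move=> [f1 f2] fx0.
have c0 : complex.Re (f x) ^+ 2 + complex.Im (f x) ^+ 2 != 0.
  by rewrite -cmod_sqr expf_neq0// cmod_eq0.
have h := is_deriveD (is_deriveX 2 f1) (is_deriveX 2 f2).
have E (z w : R[i]) : z / w ^+ 2 = z * (w^-1 * w^-1).
  by rewrite expr2 invfM.
rewrite E; split.
- under eq_fun do rewrite Re_inv cmod_sqr.
  have hh := @is_derive_div (fun r => complex.Re (f r))
    (fun r => complex.Re (f r) ^+ 2 + complex.Im (f r) ^+ 2) _ _ _ c0 f1 h.
  apply: (is_derive_eq hh).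
  rewrite !(ReM, ImM, ReN, ImN, Re_inv, Im_inv) !cmod_sqr /GRing.scale/=.
  by field.
- under eq_fun do rewrite Im_inv cmod_sqr.
  have hh := @is_derive_div (fun r => - complex.Im (f r))
    (fun r => complex.Re (f r) ^+ 2 + complex.Im (f r) ^+ 2) _ _ _ c0
    (is_deriveN f2) h.
  apply: (is_derive_eq hh).
  rewrite !(ReM, ImM, ReN, ImN, Re_inv, Im_inv) !cmod_sqr /GRing.scale/=.
  by field.
Qed.

Lemma cderiv_continuous f x d : cderiv f x d ->
  {for x, continuous (fun r => complex.Re (f r))} /\
  {for x, continuous (fun r => complex.Im (f r))}.
Proof.
move=> [[f1 _] [f2 _]].
by split; apply/differentiable_continuous/derivable1_diffP.
Qed.

Lemma near_slit f x d : cderiv f x d -> slit (f x) ->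
  \forall y \near x, slit (f y).
Proof.
move=> /cderiv_continuous[c1 c2] /orP[y0|x0].
- near=> y; rewrite /slit; apply/orP; left; near: y.
  exact: (cvgr_neq0 _ c2 y0).
- near=> y; rewrite /slit; apply/orP; right; near: y.
  exact: (cvgr_gt _ c1 _ x0).
Unshelve. all: by end_near. Qed.

Lemma cderiv_clog f x d : cderiv f x d -> slit (f x) ->
  cderiv (fun r => clog (f r)) x (d / f x).
Proof.
move=> fd sf; have f0 := slit_neq0 sf.
have m0 : cmod (f x) != 0 by rewrite cmod_eq0.
have mgt0 : 0 < cmod (f x) by rewrite cmod_gt0.
have mx : 0 < cmod (f x) + complex.Re (f x) by exact: slit_cmodDRe.
have mx0 : cmod (f x) + complex.Re (f x) != 0 by rewrite gt_eqF.
have sq := cmod_sqr (f x).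
apply: (@near_cderiv (fun r => ln (cmod (f r)) +i*
   (2 * atan (complex.Im (f r) / (cmod (f r) + complex.Re (f r)))))).
  near=> y; rewrite /clog; congr (_ +i* _); symmetry.
  have : slit (f y) by near: y; exact: near_slit fd sf.
  by move=> /slit_atan[].
have hm := is_derive_cmod fd f0.
case: (fd) => f1 f2; split => /=.
- have hh := @is_derive1_comp _ (@ln R) (fun r => cmod (f r)) _ _ _
     (is_derive1_ln mgt0) hm.
  apply: (is_derive_eq hh).
  rewrite !(ReM, ImM, Re_inv, Im_inv) /GRing.scale/=.
  by field.
- have hq := @is_derive_div (fun r => complex.Im (f r))
    (fun r => cmod (f r) + complex.Re (f r)) _ _ _ mx0 f2 (is_deriveD hm f1).
  have hh := @is_derive1_comp _ (@atan R) _ _ _ _ (is_derive1_atan _) hq.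
  have := is_deriveZ 2 hh => {}hh.
  apply: (is_derive_eq hh).
  rewrite (half_angle sq mgt0 mx).
  rewrite !(ReM, ImM, Re_inv, Im_inv) /GRing.scale/=.
  move: sq m0 mx0; set m := cmod _; set a := complex.Re (f x).
  set b := complex.Im (f x) => sq m0 mx0.
  have b2 : b ^+ 2 = m ^+ 2 - a ^+ 2 by rewrite sq; ring.
  field: b2; do ?[apply/andP; split]; rewrite //.
Unshelve. all: by end_near. Qed.

End cderiv.

(** * Lebesgue integrals on the half-line *)

Notation lmeas R := (@lebesgue_measure R).

Section real_integrals.
Variable R : realType.
Notation mu := (lmeas R).
Notation pos := (`]0%R, +oo[%classic : set R).
Implicit Types (F f g : R -> R) (D : set R).

Lemma Rintegrable_le D f g : measurable D -> measurable_fun D f ->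
  mu.-integrable D (EFin \o g) -> (forall x, D x -> `|f x| <= g x) ->
  mu.-integrable D (EFin \o f).
Proof.
move=> mD mf ig fg; apply: le_integrable ig => //; first exact/measurable_EFinP.
by move=> x Dx /=; rewrite lee_fin (le_trans (fg _ Dx))// ler_norm.
Qed.

Lemma RintegrableZl D k g : measurable D -> mu.-integrable D (EFin \o g) ->
  mu.-integrable D (EFin \o (fun x => k * g x)).
Proof. by move=> mD ig; exact: (@integrableZl _ _ _ mu D mD k _ ig). Qed.

Lemma RintegrableD D f g : measurable D -> mu.-integrable D (EFin \o f) ->
  mu.-integrable D (EFin \o g) ->
  mu.-integrable D (EFin \o (fun x => f x + g x)).
Proof. by move=> mD i1 i2; exact: (@integrableD _ _ _ mu D mD _ _ i1 i2). Qed.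

Lemma eq_Rintegrable D f g : measurable D -> (forall x, D x -> f x = g x) ->
  mu.-integrable D (EFin \o f) -> mu.-integrable D (EFin \o g).
Proof.
move=> mD fg; apply: eq_integrable => // x; rewrite inE => /fg /= ->.
by [].
Qed.

Lemma measurable_pos f : (forall x, 0 < x -> {for x, continuous f}) ->
  measurable_fun pos f.
Proof.
move=> cf; apply: open_continuous_measurable_fun => //.
by move=> x; rewrite inE/= in_itv/= andbT => /cf.
Qed.

Lemma Rdominated_cvg D (f_ : nat -> R -> R) f g : measurable D ->
  (forall n, measurable_fun D (f_ n)) ->
  (forall x, D x -> (f_ n x) @[n --> \oo] --> f x) ->
  mu.-integrable D (EFin \o g) ->
  (forall n x, D x -> `|f_ n x| <= g x) ->
  mu.-integrable D (EFin \o f) /\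
  (\int[mu]_(x in D) f_ n x) @[n --> \oo] --> \int[mu]_(x in D) f x.
Proof.
move=> mD mf cf ig fg.
have cE x : D x -> (f_ n x)%:E @[n --> \oo] --> (f x)%:E.
  by move=> Dx; apply: cvg_EFin; [exact: nearW|exact: cf].
have fgE x n : D x -> (`|(f_ n x)%:E| <= (g x)%:E)%E.
  by move=> Dx; rewrite lee_fin; exact: fg.
have mfl : measurable_fun D (EFin \o f).
  apply: (@emeasurable_fun_cvg _ _ _ D (fun n => EFin \o f_ n)) => [m|x Dx].
    exact/measurable_EFinP.
  exact: cE.
have aeE : {ae mu, forall x, D x ->
    (fun n => EFin \o f_ n) ^~ x @ \oo --> (EFin \o f) x}.
  by apply: aeW => x; exact: cE.
have aefg : {ae mu, forall x n, D x ->
    (`|(EFin \o f_ n) x| <= (EFin \o g) x)%E}.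
  by apply: aeW => x; exact: fgE.
have [i1 i2 i3] := @dominated_convergence _ _ _ mu _ mD (fun n => EFin \o f_ n)
  (EFin \o f) (EFin \o g) (fun n => (measurable_EFinP _ _).2 (mf n)) mfl
  aeE ig aefg.
split=> //; apply: fine_cvg; rewrite fineK; first exact: i3.
exact: integrable_fin_num.
Qed.

Section FTC.
Variables (F f : R -> R).
Hypothesis dF : forall x : R, 0 < x -> is_derive x 1 F (f x).
Hypothesis cf : forall x : R, 0 < x -> {for x, continuous f}.

Lemma FTC_segment a b : 0 < a -> a < b ->
  (\int[mu]_(x in `[a, b]) (f x)%:E = (F b)%:E - (F a)%:E)%E.
Proof.
move=> a0 ab.
have cF x : 0 < x -> {for x, continuous F}.
  by move=> x0; apply/differentiable_continuous/derivable1_diffP; have [] := dF x0.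
apply: continuous_FTC2 => //.
- apply: continuous_in_subspaceT => x.
  by rewrite inE/= in_itv/= => /andP[ax _]; apply: cf; exact: lt_le_trans ax.
- split.
  + move=> x; rewrite in_itv/= => /andP[ax _].
    by have [] := dF (lt_trans a0 ax).
  + by apply: cvg_at_right_filter; apply: cF.
  + by apply: cvg_at_left_filter; apply: cF; exact: lt_trans ab.
- move=> x; rewrite in_itv/= => /andP[ax _]; rewrite derive1E.
  by have [] := dF (lt_trans a0 ax).
Qed.

Let a_ (n : nat) : R := (n.+2%:R)^-1.
Let b_ (n : nat) : R := n.+2%:R.
Let f_ n := f \_ `[a_ n, b_ n].

Let a_gt0 n : 0 < a_ n. Proof. by rewrite invr_gt0. Qed.
Let ab_ n : a_ n < b_ n.
Proof.
by rewrite (@lt_trans _ _ 1)// ?invf_lt1 ?ltr1n.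
Qed.

Let b_cvg : b_ n @[n --> \oo] --> +oo.
Proof.
apply/cvgryPge => M; near=> n; apply: (@le_trans _ _ n%:R).
  by near: n; exact: nbhs_infty_ger.
by rewrite ler_nat -addn2 leq_addr.
Unshelve. all: by end_near. Qed.

Let a_cvg : a_ n @[n --> \oo] --> 0.
Proof.
apply/(@gtr0_cvgV0 _ _ _ _ b_); last exact: b_cvg.
by apply: nearW => n; rewrite ltr0n.
Qed.

Let sub_ n : `[a_ n, b_ n] `<=` pos.
Proof.
by move=> x /=; rewrite !in_itv/= andbT => /andP[+ _]; exact: lt_le_trans.
Qed.

Let integral_f_ n :
  (\int[mu]_(x in pos) (f_ n x)%:E = (F (b_ n))%:E - (F (a_ n))%:E)%E.
Proof.
rewrite -FTC_segment// -[in RHS](setIidr (@sub_ n)) integral_mkcondr.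
by rewrite restrict_EFin.
Qed.

Let f_cvg x : pos x -> f_ n x @[n --> \oo] --> f x.
Proof.
move=> /=; rewrite in_itv/= andbT => x0.
apply: cvg_near_cst; near=> n; rewrite /f_ patchE ifT// inE/= in_itv/=.
apply/andP; split; last by near: n; exact: (cvgryPge _).1 b_cvg x.
by near: n; apply: (cvgr_le _ a_cvg).
Unshelve. all: by end_near. Qed.

Let measurable_f_ n : measurable_fun pos (f_ n).
Proof.
apply/(measurable_restrict _ _ _) => //.
by apply: measurable_funS (measurable_pos cf).
Qed.

(** Dominated convergence on the intervals [[1 / (n + 2), n + 2]]. *)
Lemma FTC_pos (A B : R) : mu.-integrable pos (EFin \o f) ->
  F x @[x --> 0^'+] --> A -> F x @[x --> +oo] --> B ->
  \int[mu]_(x in pos) f x = B - A.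
Proof.
move=> intf FA FB.
have fb n x : pos x -> `|f_ n x| <= `|f x|.
  by move=> _; rewrite /f_ patchE; case: ifPn => // _; rewrite normr0.
have [_ h] := @Rdominated_cvg pos f_ f (fun x => `|f x|) (measurable_itv _)
  measurable_f_ f_cvg (integrable_norm intf) fb.
apply: (cvg_unique _ h) => //.
have E n : \int[mu]_(x in pos) f_ n x = F (b_ n) - F (a_ n).
  by rewrite /Rintegral integral_f_.
rewrite (funext E).
apply: cvgB.
- exact: (cvg_pinftyP F B).1 FB _ b_cvg.
- by apply: ((cvg_at_rightP F 0 A).1 FA); split.
Qed.

(** The integrals over [[1 / (n + 2), n + 2]] are increments of the bounded
    function [F]; monotone convergence concludes. *)
Lemma integrable_ge0_derive M : (forall x, 0 < x -> 0 <= f x) ->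
  (forall x, 0 < x -> `|F x| <= M) -> mu.-integrable pos (EFin \o f).
Proof.
move=> f0 FM; have mf := measurable_pos cf.
apply/integrableP; split; first exact/measurable_EFinP.
have -> : (\int[mu]_(x in pos) `|(EFin \o f) x| =
    \int[mu]_(x in pos) (f x)%:E)%E.
  by apply: eq_integral => x; rewrite inE/= in_itv/= andbT => x0; rewrite ger0_norm ?f0.
have f_ge0 n x : pos x -> (0 <= (f_ n x)%:E)%E.
  rewrite /= in_itv/= andbT => x0; rewrite lee_fin /f_ patchE.
  by case: ifPn => // _; exact: f0.
have f_nd x : pos x -> {homo (fun n => (f_ n x)%:E) : m n / (m <= n)%N >-> (m <= n)%E}.
  rewrite /= in_itv/= andbT => x0 m n mn; rewrite lee_fin /f_ !patchE.
  case: ifPn => [|_]; last by case: ifPn => // _; exact: f0.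
  rewrite inE/= in_itv/= => /andP[h1 h2]; rewrite ifT// inE/= in_itv/=.
  rewrite (le_trans _ h1)/= ?(le_trans h2)//.
    by rewrite ler_nat ltnS.
  by rewrite lef_pV2 ?posrE// ler_nat ltnS.
have mf_ n : measurable_fun pos (fun x => (f_ n x)%:E).
  by apply/measurable_EFinP; exact: measurable_f_.
have -> : (\int[mu]_(x in pos) (f x)%:E =
    limn (fun n => \int[mu]_(x in pos) (f_ n x)%:E))%E.
  rewrite -monotone_convergence//.
  apply: eq_integral => x; rewrite inE => px; apply/esym/cvg_lim => //.
  by apply: cvg_EFin; [exact: nearW|exact: f_cvg].
apply: (@le_lt_trans _ _ (M + M)%:E); last exact: ltry.
apply: lime_le.
  apply: ereal_nondecreasing_is_cvgn => m n mn; apply: ge0_le_integral => //.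
  - by move=> x px; exact: f_ge0.
  - exact: mf_.
  - exact: mf_.
  - by move=> x px; exact: (f_nd x px _ _ mn).
apply: nearW => n; rewrite integral_f_ -EFinB lee_fin.
have b0 : 0 < b_ n by exact: lt_trans (ab_ n).
have := FM _ (a_gt0 n); have := FM _ b0; rewrite !ler_norml.
by move=> /andP[h1 h2] /andP[h3 h4]; lra.
Qed.

End FTC.

Lemma is_derive_Rintegral D (f f' : R -> R -> R) (x0 e : R) (G : R -> R) :
  measurable D -> 0 < e ->
  (forall x t, `|x - x0| < e -> D t -> is_derive x 1 (f ^~ t) (f' x t)) ->
  (forall x, `|x - x0| < e -> mu.-integrable D (EFin \o f x)) ->
  mu.-integrable D (EFin \o G) ->
  (forall x t, `|x - x0| < e -> D t -> `|f' x t| <= G t) ->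
  is_derive x0 1 (fun x => \int[mu]_(t in D) f x t)
    (\int[mu]_(t in D) f' x0 t).
Proof.
move=> mD e0 df fi iG fG.
have Ix x : `](x0 - e), (x0 + e)[%classic x -> `|x - x0| < e.
  by rewrite /= in_itv/= ltr_distl.
have Ix0 : `](x0 - e), (x0 + e)[%classic x0.
  by rewrite /= in_itv/= ltrDl e0 ltrBlDr ltrDl e0.
have d1 x t : `](x0 - e), (x0 + e)[%classic x -> D t -> derivable (f ^~ t) x 1.
  by move=> /Ix xe Dt; have [] := df _ _ xe Dt.
have d1E x t : `](x0 - e), (x0 + e)[%classic x -> D t ->
    partial1of2 f x t = f' x t.
  by move=> /Ix xe Dt; rewrite partial1of2E; have [] := df _ _ xe Dt.
have fiI x : `](x0 - e), (x0 + e)[%classic x -> mu.-integrable D (EFin \o f x).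
  by move=> /Ix; exact: fi.
have iG' : mu.-integrable D (EFin \o (fun t => `|G t|)) by exact: integrable_norm.
have fG' x t : `](x0 - e), (x0 + e)[%classic x -> D t ->
    `|partial1of2 f x t| <= `|G t|.
  move=> xe Dt; rewrite d1E// (le_trans (fG _ _ (Ix _ xe) Dt))//.
  exact: ler_norm.
have G0 t : 0 <= `|G t| by [].
split.
  exact: (@derivable_under_integral _ _ _ mu f D mD _ _ _ Ix0 fiI d1 _ G0 iG' fG').
rewrite -derive1E (@differentiation_under_integral _ _ _ mu f D mD _ _ _ Ix0 fiI d1 _ G0 iG' fG').
by apply: eq_Rintegral => t; rewrite inE => Dt; exact: d1E.
Qed.

Lemma RFubini D1 D2 (f : R -> R -> R) (g1 g2 : R -> R) :
  measurable D1 -> measurable D2 ->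
  measurable_fun [set: R * R] (fun z => f z.1 z.2) ->
  mu.-integrable D1 (EFin \o g1) -> mu.-integrable D2 (EFin \o g2) ->
  (forall x y, D1 x -> D2 y -> `|f x y| <= g1 x * g2 y) ->
  measurable_fun D1 (fun x => \int[mu]_(y in D2) f x y) /\
  \int[mu]_(x in D1) \int[mu]_(y in D2) f x y =
  \int[mu]_(y in D2) \int[mu]_(x in D1) f x y.
Proof.
move=> mD1 mD2 mf i1 i2 fg.
pose h (z : R * R) : R := \1_D1 z.1 * \1_D2 z.2 * f z.1 z.2.
have mh : measurable_fun setT h.
  apply: measurable_funM => //; apply: measurable_funM.
    by apply: measurableT_comp => //; exact: measurable_indic.
  by apply: measurableT_comp => //; exact: measurable_indic.
have mhE : measurable_fun setT (EFin \o h) by exact/measurable_EFinP.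
pose G1 := fun x => `|(\1_D1 x * g1 x)|.
pose G2 := fun x => `|(\1_D2 x * g2 x)|.
have indE (D : set R) (g : R -> R) : measurable D ->
    mu.-integrable D (EFin \o g) ->
    mu.-integrable setT (EFin \o (fun x => `|\1_D x * g x|)).
  move=> mD ig; apply: integrable_norm.
  rewrite (_ : _ \o _ = (EFin \o g) \_ D); last first.
    apply/funext => x /=; rewrite patchE indicE.
    by case: ifPn => _; rewrite ?mul1r ?mul0r.
  by apply/integrable_restrict => //; rewrite setTI.
have iG1 : mu.-integrable setT (EFin \o G1) by exact: indE.
have iG2 : mu.-integrable setT (EFin \o G2) by exact: indE.
have hG z : `|h z| <= G1 z.1 * G2 z.2.
  rewrite /h /G1 /G2 !indicE; case: (boolP (z.1 \in D1)) => [|_]; last first.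
    by rewrite !mul0r normr0 mul0r.
  rewrite inE => z1; case: (boolP (z.2 \in D2)) => [|_]; last first.
    by rewrite mulr0 !mul0r normr0 mulr0.
  rewrite inE => z2; rewrite !mul1r (le_trans (fg _ _ z1 z2))//.
  by rewrite -normrM ler_norm.
have ih : (mu \x mu)%E.-integrable setT (EFin \o h).
  apply/integrable12ltyP => //.
  apply: (@le_lt_trans _ _ (\int[mu]_x ((G1 x)%:E * \int[mu]_y (G2 y)%:E))%E).
    apply: ge0_le_integral => //.
    - by move=> x _; apply: integral_ge0 => y _; rewrite abse_ge0.
    - have mhT : measurable_fun setT (abse \o (EFin \o h)).
        exact: measurableT_comp.
      have h0 z : (0 <= (abse \o (EFin \o h)) z)%E by exact: abse_ge0.
      exact: (@measurable_fun_fubini_tonelli_F _ _ _ _ R mu _ mhT h0).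
    - apply: emeasurable_funM => //.
      by have /integrableP[] := iG1.
    - move=> x _; rewrite -ge0_integralZl//; last 3 first.
      + by have /integrableP[] := iG2.
      + by move=> y _; rewrite lee_fin normr_ge0.
      + by rewrite lee_fin normr_ge0.
      apply: ge0_le_integral => //.
      + apply: measurableT_comp => //; apply/measurable_EFinP.
        exact: (measurable_fun_pair2 x mh).
      + apply: emeasurable_funM => //.
        by have /integrableP[] := iG2.
      + by move=> y _; rewrite -EFinM lee_fin; exact: (hG (x, y)).
  rewrite ge0_integralZr//.
  - rewrite lte_mul_pinfty//.
    + by apply: integral_ge0 => y _; rewrite lee_fin normr_ge0.
    + exact: integrable_fin_num.
    + by have := integrable_lty measurableT iG2.
  - by have /integrableP[] := iG1.
  - by move=> y _; rewrite lee_fin normr_ge0.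
  - by apply: integral_ge0 => y _; rewrite lee_fin normr_ge0.
have inner1 x : D1 x ->
    (\int[mu]_y (EFin \o h) (x, y) = \int[mu]_(y in D2) (f x y)%:E)%E.
  move=> Dx; rewrite [RHS]integral_mkcond; apply: eq_integral => y _ /=.
  rewrite /h patchE !indicE mem_set//= mul1r.
  by case: ifPn => _; rewrite ?mul1r ?mul0r.
have inner1' x : ~ D1 x -> (\int[mu]_y (EFin \o h) (x, y) = 0)%E.
  move=> Dx; apply: integral0_eq => y _ /=.
  by rewrite /h indicE memNset//= !mul0r.
have inner2 y : D2 y ->
    (\int[mu]_x (EFin \o h) (x, y) = \int[mu]_(x in D1) (f x y)%:E)%E.
  move=> Dy; rewrite [RHS]integral_mkcond; apply: eq_integral => x _ /=.
  rewrite /h patchE !indicE [in X in _ * X * _](mem_set Dy)/= mulr1.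
  by case: ifPn => _; rewrite ?mul1r ?mul0r.
have inner2' y : ~ D2 y -> (\int[mu]_x (EFin \o h) (x, y) = 0)%E.
  move=> Dy; apply: integral0_eq => x _ /=.
  by rewrite /h !indicE (memNset Dy) mulr0 mul0r.
have iF := integrable_fubini_F ih.
split.
  have m1 : measurable_fun D1 (fun x => fine (\int[mu]_y (EFin \o h) (x, y))%E).
    apply: measurable_funTS; apply: measurableT_comp => //.
    by have /integrableP[] := iF.
  apply: eq_measurable_fun m1 => x; rewrite inE => Dx.
  by rewrite /Rintegral -inner1.
have E := Fubini ih.
have fin1 x : D1 x -> (\int[mu]_(y in D2) (f x y)%:E)%E \is a fin_num.
  move=> Dx; apply: integrable_fin_num; first exact: mD2.
  apply: (@Rintegrable_le D2 (f x) (fun y => g1 x * g2 y) mD2).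
  - by apply: measurable_funTS; exact: (measurable_fun_pair2 x mf).
  - exact: (RintegrableZl (g1 x) mD2 i2).
  - by move=> y Dy; exact: (fg x y Dx Dy).
have fin2 y : D2 y -> (\int[mu]_(x in D1) (f x y)%:E)%E \is a fin_num.
  move=> Dy; apply: integrable_fin_num; first exact: mD1.
  apply: (@Rintegrable_le D1 (f ^~ y) (fun x => g1 x * g2 y) mD1).
  - by apply: measurable_funTS; exact: (measurable_fun_pair1 y mf).
  - apply: (eq_Rintegrable (f := fun x => g2 y * g1 x) mD1).
      by move=> x _; rewrite mulrC.
    exact: (RintegrableZl (g2 y) mD1 i1).
  - by move=> x Dx; exact: (fg x y Dx Dy).
rewrite /Rintegral; congr fine.
transitivity (\int[mu]_x \int[mu]_y (EFin \o h) (x, y))%E.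
  rewrite [LHS]integral_mkcond; apply: eq_integral => x _.
  rewrite patchE; case: ifPn => [|/negP]; rewrite inE => Dx.
    by rewrite (inner1 _ Dx) (fineK (fin1 _ Dx)).
  by rewrite inner1'.
rewrite E.
rewrite [RHS]integral_mkcond; apply: eq_integral => y _.
rewrite patchE; case: ifPn => [|/negP]; rewrite inE => Dy.
  by rewrite (inner2 _ Dy) (fineK (fin2 _ Dy)).
by rewrite inner2'.
Qed.

End real_integrals.

(** * Integrals of complex-valued functions *)

Section cmeasurable.
Variables (d : measure_display) (T : measurableType d) (R : realType).
Implicit Types (D : set T) (f g : T -> R[i]).

Definition cmeasurable D f :=
  measurable_fun D (fun x => complex.Re (f x)) /\
  measurable_fun D (fun x => complex.Im (f x)).

Lemma cmeasurable_cst D (c : R[i]) : cmeasurable D (fun=> c).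
Proof. by split; exact: measurable_cst. Qed.

Lemma cmeasurable_real D (f : T -> R) :
  measurable_fun D f -> cmeasurable D (fun x => (f x)%:C).
Proof. by move=> mf; split => //=; exact: measurable_cst. Qed.

Lemma cmeasurableD D f g : cmeasurable D f -> cmeasurable D g ->
  cmeasurable D (fun x => f x + g x).
Proof.
move=> [f1 f2] [g1 g2]; split.
- by under eq_fun do rewrite ReD; exact: measurable_funD.
- by under eq_fun do rewrite ImD; exact: measurable_funD.
Qed.

Lemma cmeasurableN D f : cmeasurable D f -> cmeasurable D (fun x => - f x).
Proof.
move=> [f1 f2]; split.
- by under eq_fun do rewrite ReN; exact: measurable_funN.
- by under eq_fun do rewrite ImN; exact: measurable_funN.
Qed.

Lemma cmeasurableB D f g : cmeasurable D f -> cmeasurable D g ->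
  cmeasurable D (fun x => f x - g x).
Proof. by move=> mf mg; apply: cmeasurableD => //; exact: cmeasurableN. Qed.

Lemma cmeasurableM D f g : cmeasurable D f -> cmeasurable D g ->
  cmeasurable D (fun x => f x * g x).
Proof.
move=> [f1 f2] [g1 g2]; split.
- under eq_fun do rewrite ReM.
  by apply: measurable_funB; exact: measurable_funM.
- under eq_fun do rewrite ImM.
  by apply: measurable_funD; exact: measurable_funM.
Qed.

Lemma measurable_sin : measurable_fun [set: R] (@sin R).
Proof. by apply: continuous_measurable_fun; exact: continuous_sin. Qed.

Lemma measurable_cos : measurable_fun [set: R] (@cos R).
Proof. by apply: continuous_measurable_fun; exact: continuous_cos. Qed.

Lemma cmeasurable_cexp D f : cmeasurable D f ->
  cmeasurable D (fun x => cexp (f x)).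
Proof.
move=> [f1 f2]; split.
- under eq_fun do rewrite Re_cexp.
  apply: measurable_funM; apply: measurableT_comp => //.
  exact: measurable_cos.
- under eq_fun do rewrite Im_cexp.
  apply: measurable_funM; apply: measurableT_comp => //.
  exact: measurable_sin.
Qed.

End cmeasurable.

Section ccvg.
Variables (R : realType) (T : Type) (F : set_system T).
Context {FF : ProperFilter F}.
Implicit Types (u v : T -> R[i]) (l m : R[i]).

Definition ccvg u l :=
  (complex.Re (u x) @[x --> F] --> complex.Re l) /\
  (complex.Im (u x) @[x --> F] --> complex.Im l).

Lemma ccvg_unique u l m : ccvg u l -> ccvg u m -> l = m.
Proof.
by move=> [u1 u2] [v1 v2]; apply: complexP;
  [exact: cvg_unique u1 v1|exact: cvg_unique u2 v2].
Qed.

Lemma ccvg_cst l : ccvg (fun=> l) l.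
Proof. by split; exact: cvg_cst. Qed.

Lemma ccvg_real (u : T -> R) (l : R) : u x @[x --> F] --> l ->
  ccvg (fun x => (u x)%:C) l%:C.
Proof. by move=> ul; split => //=; exact: cvg_cst. Qed.

Lemma ccvgD u v l m : ccvg u l -> ccvg v m -> ccvg (fun x => u x + v x) (l + m).
Proof.
move=> [u1 u2] [v1 v2]; split.
- by rewrite ReD; under eq_fun do rewrite ReD; exact: cvgD.
- by rewrite ImD; under eq_fun do rewrite ImD; exact: cvgD.
Qed.

Lemma ccvgN u l : ccvg u l -> ccvg (fun x => - u x) (- l).
Proof.
move=> [u1 u2]; split.
- by rewrite ReN; under eq_fun do rewrite ReN; exact: cvgN.
- by rewrite ImN; under eq_fun do rewrite ImN; exact: cvgN.
Qed.

Lemma ccvgB u v l m : ccvg u l -> ccvg v m -> ccvg (fun x => u x - v x) (l - m).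
Proof. by move=> ul vm; apply: ccvgD => //; exact: ccvgN. Qed.

Lemma ccvgM u v l m : ccvg u l -> ccvg v m -> ccvg (fun x => u x * v x) (l * m).
Proof.
move=> [u1 u2] [v1 v2]; split.
- by rewrite ReM; under eq_fun do rewrite ReM; apply: cvgB; exact: cvgM.
- by rewrite ImM; under eq_fun do rewrite ImM; apply: cvgD; exact: cvgM.
Qed.

Lemma ccvgV u l : ccvg u l -> l != 0 -> ccvg (fun x => (u x)^-1) l^-1.
Proof.
move=> [u1 u2] l0.
have c0 : complex.Re l ^+ 2 + complex.Im l ^+ 2 != 0.
  by rewrite -cmod_sqr expf_neq0// cmod_eq0.
have c1 : (complex.Re (u x) ^+ 2 + complex.Im (u x) ^+ 2)^-1 @[x --> F] -->
    (complex.Re l ^+ 2 + complex.Im l ^+ 2)^-1.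
  by apply: cvgV => //; apply: cvgD; rewrite expr2;
    under eq_fun do rewrite expr2; exact: cvgM.
split.
- rewrite Re_inv cmod_sqr; under eq_fun do rewrite Re_inv cmod_sqr.
  exact: cvgM.
- rewrite Im_inv cmod_sqr; under eq_fun do rewrite Im_inv cmod_sqr.
  by apply: cvgM => //; exact: cvgN.
Qed.

Lemma ccvg0_le u (e : T -> R) : (\forall x \near F, cmod (u x) <= e x) ->
  e x @[x --> F] --> 0 -> ccvg u 0.
Proof.
move=> ue e0.
have ne0 : - e x @[x --> F] --> 0 by rewrite -oppr0; exact: cvgN.
split; apply: (squeeze_cvgr _ ne0 e0); near=> x;
  have h : cmod (u x) <= e x by [near: x];
  by rewrite -ler_norml (le_trans _ h)// ?Re_le_cmod ?Im_le_cmod.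
Unshelve. all: by end_near. Qed.

End ccvg.

Section cintegral.
Variable R : realType.
Notation mu := (lmeas R).
Notation pos := (`]0%R, +oo[%classic : set R).
Implicit Types (f g : R -> R[i]) (D : set R).

Lemma cmeasurable_cderiv f : (forall x, 0 < x -> exists d, cderiv f x d) ->
  cmeasurable pos f.
Proof.
by move=> df; split; apply: measurable_pos => x /df[d /cderiv_continuous[]].
Qed.

Lemma cintegrable_le D f (g : R -> R) : measurable D -> cmeasurable D f ->
  mu.-integrable D (EFin \o g) -> (forall x, D x -> cmod (f x) <= g x) ->
  cintegrable D f.
Proof.
move=> mD [f1 f2] ig fg.
by split; apply: (@Rintegrable_le _ D _ g) => // x /fg; apply: le_trans;
  [exact: Re_le_cmod|exact: Im_le_cmod].
Qed.

Lemma cintegrable_measurable D f : cintegrable D f -> cmeasurable D f.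
Proof.
by move=> [/integrableP[/measurable_EFinP ? _] /integrableP[/measurable_EFinP ? _]].
Qed.

Lemma cintegrable_real D (f : R -> R) : measurable D ->
  mu.-integrable D (EFin \o f) -> cintegrable D (fun x => (f x)%:C).
Proof. by move=> mD mf; split => //=; exact: (@integrable0 _ _ _ mu D). Qed.

Lemma cintegral_real D (f : R -> R) :
  cintegral D (fun x => (f x)%:C) = (\int[mu]_(x in D) f x)%:C.
Proof.
by rewrite /cintegral /=; congr (_ +i* _); rewrite /Rintegral integral0.
Qed.

Lemma cintegrableD D f g : measurable D -> cintegrable D f -> cintegrable D g ->
  cintegrable D (fun x => f x + g x).
Proof.
move=> mD [f1 f2] [g1 g2]; split.
- apply: (eq_Rintegrable mD _ (RintegrableD mD f1 g1)) => x _.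
  by rewrite ReD.
- apply: (eq_Rintegrable mD _ (RintegrableD mD f2 g2)) => x _.
  by rewrite ImD.
Qed.

Lemma cintegrableZ D f (c : R[i]) : measurable D -> cintegrable D f ->
  cintegrable D (fun x => c * f x).
Proof.
move=> mD [f1 f2]; split.
- apply: (eq_Rintegrable mD _ (RintegrableD mD (RintegrableZl (complex.Re c) mD f1)
    (RintegrableZl (- complex.Im c) mD f2))) => x _.
  by rewrite ReM mulNr.
- apply: (eq_Rintegrable mD _ (RintegrableD mD (RintegrableZl (complex.Re c) mD f2)
    (RintegrableZl (complex.Im c) mD f1))) => x _.
  by rewrite ImM.
Qed.

Lemma cintegralD D f g : measurable D -> cintegrable D f -> cintegrable D g ->
  cintegral D (fun x => f x + g x) = cintegral D f + cintegral D g.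
Proof.
move=> mD [f1 f2] [g1 g2]; apply: complexP; rewrite ?(ReD, ImD) /=.
- by under eq_Rintegral do rewrite ReD; rewrite RintegralD.
- by under eq_Rintegral do rewrite ImD; rewrite RintegralD.
Qed.

Lemma cintegralZ D f (c : R[i]) : measurable D -> cintegrable D f ->
  cintegral D (fun x => c * f x) = c * cintegral D f.
Proof.
move=> mD [f1 f2]; apply: complexP; rewrite ?(ReM, ImM) /=.
- under eq_Rintegral do rewrite ReM.
  by rewrite RintegralB ?RintegralZl//; exact: RintegrableZl.
- under eq_Rintegral do rewrite ImM.
  by rewrite RintegralD ?RintegralZl//; exact: RintegrableZl.
Qed.

Lemma cintegrableN D f : measurable D -> cintegrable D f ->
  cintegrable D (fun x => - f x).
Proof.
move=> mD /(cintegrableZ (-1) mD); congr (cintegrable _ _).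
by apply/funext => x; rewrite mulN1r.
Qed.

Lemma cintegralN D f : measurable D -> cintegrable D f ->
  cintegral D (fun x => - f x) = - cintegral D f.
Proof.
move=> mD fi; rewrite -mulN1r -cintegralZ//; congr cintegral.
by apply/funext => x; rewrite mulN1r.
Qed.

Lemma cintegrableB D f g : measurable D -> cintegrable D f -> cintegrable D g ->
  cintegrable D (fun x => f x - g x).
Proof. by move=> mD fi gi; apply: cintegrableD => //; exact: cintegrableN. Qed.

Lemma cintegralB D f g : measurable D -> cintegrable D f -> cintegrable D g ->
  cintegral D (fun x => f x - g x) = cintegral D f - cintegral D g.
Proof.
move=> mD fi gi; rewrite cintegralD ?cintegralN//; exact: cintegrableN.
Qed.

Lemma eq_cintegral D f g : (forall x, D x -> f x = g x) ->
  cintegral D f = cintegral D g.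
Proof.
by move=> fg; apply: complexP; apply: eq_Rintegral => x; rewrite inE => /fg ->.
Qed.

Lemma eq_cintegrable D f g : measurable D -> (forall x, D x -> f x = g x) ->
  cintegrable D f -> cintegrable D g.
Proof.
by move=> mD fg [f1 f2]; split;
 [apply: (eq_Rintegrable mD _ f1)|apply: (eq_Rintegrable mD _ f2)] => x /fg ->.
Qed.

Lemma Rintegral_norm_le D (f : R -> R) (g : R -> R) : measurable D ->
  mu.-integrable D (EFin \o f) ->
  mu.-integrable D (EFin \o g) -> (forall x, D x -> `|f x| <= g x) ->
  `|\int[mu]_(x in D) f x| <= \int[mu]_(x in D) g x.
Proof.
move=> mD fi gi fg; rewrite (le_trans (le_normr_Rintegral _ _))//.
by apply: le_Rintegral => //; exact: integrable_norm.
Qed.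

(** The factor [2] comes from estimating the real and the imaginary part
    separately; the lemma serves to show that integrals tend to [0]. *)
Lemma cmod_cintegral_le D f (g : R -> R) : measurable D -> cintegrable D f ->
  mu.-integrable D (EFin \o g) -> (forall x, D x -> cmod (f x) <= g x) ->
  cmod (cintegral D f) <= 2 * \int[mu]_(x in D) g x.
Proof.
move=> mD [f1 f2] gi fg; rewrite (le_trans (cmod_le _))//= mulr_natl mulr2n.
by apply: lerD; apply: Rintegral_norm_le => // x /fg; apply: le_trans;
  [exact: Re_le_cmod|exact: Im_le_cmod].
Qed.

Lemma cdominated_cvg D (f_ : nat -> R -> R[i]) f (g : R -> R) : measurable D ->
  (forall n, cmeasurable D (f_ n)) ->
  (forall x, D x -> ccvg \oo (f_ ^~ x) (f x)) ->
  mu.-integrable D (EFin \o g) ->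
  (forall n x, D x -> cmod (f_ n x) <= g x) ->
  cintegrable D f /\ ccvg \oo (fun n => cintegral D (f_ n)) (cintegral D f).
Proof.
move=> mD mf cf gi fg.
have [i1 c1] := Rdominated_cvg mD (fun n => (mf n).1) (fun x Dx => (cf x Dx).1) gi
  (fun n x Dx => le_trans (Re_le_cmod _) (fg n x Dx)).
have [i2 c2] := Rdominated_cvg mD (fun n => (mf n).2) (fun x Dx => (cf x Dx).2) gi
  (fun n x Dx => le_trans (Im_le_cmod _) (fg n x Dx)).
by [].
Qed.

Lemma cderiv_cintegral D (f f' : R -> R -> R[i]) (x0 e : R) (G : R -> R) :
  measurable D -> 0 < e ->
  (forall x t, `|x - x0| < e -> D t -> cderiv (f ^~ t) x (f' x t)) ->
  (forall x, `|x - x0| < e -> cintegrable D (f x)) ->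
  mu.-integrable D (EFin \o G) ->
  (forall x t, `|x - x0| < e -> D t -> cmod (f' x t) <= G t) ->
  cderiv (fun x => cintegral D (f x)) x0 (cintegral D (f' x0)).
Proof.
move=> mD e0 df fi gi fG; split.
- apply: (@is_derive_Rintegral R D (fun x t => complex.Re (f x t))
    (fun x t => complex.Re (f' x t)) x0 e G mD e0 _ _ gi) => [x t xe Dt|x xe|x t xe Dt].
  + by have [] := df _ _ xe Dt.
  + by have [] := fi _ xe.
  + by rewrite (le_trans (Re_le_cmod _))// fG.
- apply: (@is_derive_Rintegral R D (fun x t => complex.Im (f x t))
    (fun x t => complex.Im (f' x t)) x0 e G mD e0 _ _ gi) => [x t xe Dt|x xe|x t xe Dt].
  + by have [] := df _ _ xe Dt.
  + by have [] := fi _ xe.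
  + by rewrite (le_trans (Im_le_cmod _))// fG.
Qed.

Lemma cFubini D1 D2 (f : R -> R -> R[i]) (g1 g2 : R -> R) :
  measurable D1 -> measurable D2 ->
  cmeasurable [set: R * R] (fun z => f z.1 z.2) ->
  mu.-integrable D1 (EFin \o g1) -> mu.-integrable D2 (EFin \o g2) ->
  (forall x y, D1 x -> D2 y -> cmod (f x y) <= g1 x * g2 y) ->
  cmeasurable D1 (fun x => cintegral D2 (f x)) /\
  cintegral D1 (fun x => cintegral D2 (f x)) =
  cintegral D2 (fun y => cintegral D1 (f ^~ y)).
Proof.
move=> mD1 mD2 [mf1 mf2] i1 i2 fg.
have [a1 a2] := RFubini mD1 mD2 mf1 i1 i2 (fun x y Dx Dy =>
  le_trans (Re_le_cmod _) (fg x y Dx Dy)).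
have [b1 b2] := RFubini mD1 mD2 mf2 i1 i2 (fun x y Dx Dy =>
  le_trans (Im_le_cmod _) (fg x y Dx Dy)).
by split; [split|apply: complexP; [exact: a2|exact: b2]].
Qed.

Lemma cFTC_pos (F f : R -> R[i]) (A B : R[i]) :
  (forall x : R, 0 < x -> cderiv F x (f x)) ->
  (forall x : R, 0 < x -> exists d, cderiv f x d) ->
  cintegrable pos f -> ccvg 0^'+ F A -> ccvg +oo F B ->
  cintegral pos f = B - A.
Proof.
move=> dF df [i1 i2] [A1 A2] [B1 B2].
apply: complexP; rewrite ?(ReD, ImD, ReN, ImN) /=.
- apply: (@FTC_pos R (fun x => complex.Re (F x)) (fun x => complex.Re (f x))
    _ _ _ _ i1 A1 B1) => x x0.
  + by have [] := dF x x0.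
  + by have [d /cderiv_continuous[]] := df x x0.
- apply: (@FTC_pos R (fun x => complex.Im (F x)) (fun x => complex.Im (f x))
    _ _ _ _ i2 A2 B2) => x x0.
  + by have [] := dF x x0.
  + by have [d /cderiv_continuous[]] := df x x0.
Qed.

Lemma cderiv_ccvg_right f x d : cderiv f x d -> ccvg x^'+ f (f x).
Proof.
by move=> /cderiv_continuous[c1 c2]; split; exact: cvg_at_right_filter.
Qed.

Lemma Rmvt (f f' : R -> R) (a b : R) : a <= b ->
  (forall x, a <= x <= b -> is_derive x 1 f (f' x)) ->
  exists2 c, a <= c <= b & f b - f a = f' c * (b - a).
Proof.
move=> ab df.
have [x||c] := @MVT_segment R f f' a b ab.
- rewrite in_itv/= => /andP[ax xb]; apply: df; by rewrite !ltW.
- apply: derivable_within_continuous => x; rewrite in_itv/= => axb.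
  by have [] := df x axb.
- by rewrite in_itv/= => cab ->; exists c.
Qed.

Lemma cderiv0_eq f (a b : R) : a <= b ->
  (forall x, a <= x <= b -> cderiv f x 0) -> f b = f a.
Proof.
move=> ab df; apply: complexP; apply/eqP; rewrite -subr_eq0.
- have [|c _ ->] := @Rmvt (fun r => complex.Re (f r)) (cst 0) a b ab.
    by move=> x /df[].
  by rewrite mul0r.
- have [|c _ ->] := @Rmvt (fun r => complex.Im (f r)) (cst 0) a b ab.
    by move=> x /df[].
  by rewrite mul0r.
Qed.

(** Testing the increment against its own conjugate reduces the complex mean
    value inequality to the real mean value theorem. *)
Lemma cmvt_le f f' (a b K : R) : a <= b ->
  (forall x, a <= x <= b -> cderiv f x (f' x)) ->
  (forall x, a <= x <= b -> cmod (f' x) <= K) ->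
  cmod (f b - f a) <= K * (b - a).
Proof.
move=> ab df fK; set w := f b - f a.
have [|c cab] := @Rmvt (fun r => complex.Re (f r * conjc w))
  (fun r => complex.Re (f' r * conjc w)) a b ab.
  move=> x xab; have := cderivM (df x xab) (cderiv_cst (conjc w) x).
  by rewrite mulr0 addr0 => -[].
rewrite -ReN -ReD -mulNr -mulrDl -/w => h.
have ww : complex.Re (w * conjc w) = cmod w ^+ 2.
  by rewrite cmod_sqr ReM; case: (w) => u v /=; ring.
have cw : cmod (conjc w) = cmod w.
  by rewrite /cmod; case: (w) => u v /=; rewrite sqrrN.
have [w0|w0] := eqVneq (cmod w) 0.
  rewrite w0 mulr_ge0 ?subr_ge0//.
  by rewrite (le_trans _ (fK a _))// ?cmod_ge0// lexx ab.
have wp : 0 < cmod w by rewrite lt_def w0 cmod_ge0.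
rewrite -(ler_pM2r wp) -expr2 -ww h mulrAC ler_wpM2r// ?subr_ge0//.
apply: (le_trans (ler_norm _)); apply: (le_trans (Re_le_cmod _)).
by rewrite cmodM cw ler_wpM2r// ?cmod_ge0// fK.
Qed.

End cintegral.

(** * Euler's integral *)

Section gamma.
Variable R : realType.
Notation mu := (lmeas R).
Notation pos := (`]0%R, +oo[%classic : set R).
Implicit Types (t x k : R).

Lemma mpos : measurable pos. Proof. exact: measurable_itv. Qed.

Lemma posP x : pos x <-> 0 < x.
Proof. by rewrite /= in_itv/= andbT. Qed.

Lemma le_ln_sub1 x : 0 < x -> ln x <= x - 1.
Proof.
move=> x0; have := @le_ln1Dx R (x - 1); have -> : 1 + (x - 1) = x by ring.
by apply; lra.
Qed.

Lemma ln_le_lin k : 0 < k -> exists C, forall x, 0 < x -> ln x <= k * x + C.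
Proof.
move=> k0; exists (- 1 - ln k) => x x0.
have := le_ln_sub1 (mulr_gt0 k0 x0); rewrite lnM ?posrE//; lra.
Qed.

Lemma is_derive_expRM k x : is_derive x 1 (fun x => expR (k * x)) (k * expR (k * x)).
Proof.
have h := @is_derive1_comp _ (@expR R) (fun x => k * x) x _ _
  (is_derive_expR _) (is_deriveZ k (is_derive_id x 1)).
by apply: (is_derive_eq h); rewrite /GRing.scale/=; ring.
Qed.

Lemma is_derive_continuous (f : R -> R) x (d : R) : is_derive x 1 f d ->
  {for x, continuous f}.
Proof.
move=> [df _]; apply: differentiable_continuous.
exact/derivable1_diffP.
Qed.

Lemma cvg_expRN k : 0 < k -> expR (- k * x) @[x --> +oo] --> 0.
Proof.
move=> k0.
have h : k * x @[x --> +oo] --> +oo by apply: gt0_cvgMry => //; exact: cvg_id.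
rewrite (_ : (fun x => _) = (fun x => expR (- x)) \o ( *%R k)); last first.
  by apply/funext => x /=; rewrite mulNr.
exact: (cvg_comp _ _ h (@cvgr_expR R)).
Qed.

Lemma integrable_expRN k : 0 < k ->
  mu.-integrable pos (EFin \o (fun x => expR (- k * x))).
Proof.
move=> k0.
apply: (@integrable_ge0_derive _ (fun x => (- k^-1) * expR (- k * x)) _ _ _ k^-1).
- move=> x _; have := is_deriveZ (- k^-1) (is_derive_expRM (- k) x) => h.
  apply: (is_derive_eq h); rewrite /GRing.scale/= mulrA mulrNN mulVf ?mul1r//.
  by rewrite gt_eqF.
- by move=> x _; exact: is_derive_continuous (is_derive_expRM _ _).
- by move=> x _; exact: expR_ge0.
- move=> x x0; have ki : 0 <= k^-1 by rewrite invr_ge0 ltW.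
  rewrite mulNr normrN ger0_norm ?mulr_ge0 ?expR_ge0// ler_piMr//.
  by rewrite -expR0 ler_expR mulNr oppr_le0 mulr_ge0// ltW.
Qed.

Lemma Rintegral_expRN k : 0 < k ->
  \int[mu]_(x in pos) expR (- k * x) = k^-1.
Proof.
move=> k0.
have k1 : k != 0 by rewrite gt_eqF.
rewrite (@FTC_pos _ (fun x => (- k^-1) * expR (- k * x)) _ _ _ (- k^-1) 0).
- by rewrite sub0r opprK.
- move=> x _; have := is_deriveZ (- k^-1) (is_derive_expRM (- k) x) => h.
  by apply: (is_derive_eq h); rewrite /GRing.scale/= mulrA mulrNN mulVf ?mul1r.
- by move=> x _; exact: is_derive_continuous (is_derive_expRM _ _).
- exact: integrable_expRN.
- apply: cvg_at_right_filter.
  have E : - k^-1 = - k^-1 * expR (- k * 0) by rewrite mulr0 expR0 mulr1.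
  rewrite [X in _ --> X]E.
  exact: (is_derive_continuous (is_deriveZ (- k^-1) (is_derive_expRM (- k) 0))).
- rewrite -[X in _ --> X](mulr0 (- k^-1)); apply: cvgM; first exact: cvg_cst.
  exact: cvg_expRN.
Qed.

(** Integrand of Euler's integral for Gamma(t + 1), as an exponential. *)
Definition gker t x : R := expR (t * ln x - x).

Lemma is_derive_gker t x : 0 < x ->
  is_derive x 1 (gker t) ((t / x - 1) * gker t x).
Proof.
move=> x0; have h := @is_derive1_comp _ (@expR R) (fun x => t * ln x - x) x _ _
  (is_derive_expR _) (is_deriveB (is_deriveZ t (is_derive1_ln x0)) (is_derive_id x 1)).
by apply: (is_derive_eq h); rewrite /GRing.scale/= /gker; ring.
Qed.

Lemma gkerS t x : 0 < x -> gker (t + 1) x = x * gker t x.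
Proof.
move=> x0; have {2}-> : x = expR (ln x) by rewrite lnK// posrE.
by rewrite /gker -expRD; congr expR; ring.
Qed.

Lemma gker_continuous t x : 0 < x -> {for x, continuous (gker t)}.
Proof. by move=> x0; exact: is_derive_continuous (is_derive_gker t x0). Qed.

Lemma gker_ge0 t x : 0 <= gker t x. Proof. exact: expR_ge0. Qed.

(** Comparison with the derivative of the bounded function
    [(x / (1 + x))^(t+1)] settles both ends of the half-line at once. *)
Lemma integrable_gker t : -1 < t -> mu.-integrable pos (EFin \o gker t).
Proof.
move=> t1; pose F x : R := expR ((t + 1) * (ln x - ln (1 + x))).
pose f x : R := (t + 1) * (x^-1 - (1 + x)^-1) * F x.
have t10 : 0 < t + 1 by rewrite -ltrBlDr sub0r.
have dF x : 0 < x -> is_derive x 1 F (f x).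
  move=> x0; have x1 : 0 < 1 + x by rewrite addr_gt0.
  have h1 : is_derive x 1 (fun x : R => 1 + x) 1.
    by under eq_fun do rewrite addrC; exact: is_derive_shift.
  have hl := @is_derive1_comp _ (@ln R) (fun x => 1 + x) x _ _ (is_derive1_ln x1) h1.
  have h := @is_derive1_comp _ (@expR R) (fun x => (t + 1) * (ln x - ln (1 + x))) x
    _ _ (is_derive_expR _) (is_deriveZ (t + 1) (is_deriveB (is_derive1_ln x0) hl)).
  by apply: (is_derive_eq h); rewrite /GRing.scale/= /f /F; ring.
have cf x : 0 < x -> {for x, continuous f}.
  move=> x0; have x1 : 0 < 1 + x by rewrite addr_gt0.
  apply: cvgM; last exact: is_derive_continuous (dF x x0).
  apply: cvgM; first exact: cvg_cst.
  apply: cvgB; first by apply: cvgV; rewrite ?gt_eqF//; exact: cvg_id.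
  apply: cvgV; first by rewrite gt_eqF.
  by apply: cvgD; [exact: cvg_cst|exact: cvg_id].
have Fle x : 0 < x -> `|F x| <= 1.
  move=> x0; rewrite ger0_norm ?expR_ge0// -expR0 ler_expR.
  rewrite pmulr_rle0// subr_le0 ler_ln ?posrE ?addr_gt0//.
  by rewrite lerDr.
have dif x : 0 < x -> x^-1 - (1 + x)^-1 = expR (- ln x - ln (1 + x)).
  move=> x0; have x1 : 0 < 1 + x by rewrite addr_gt0.
  rewrite expRD !expRN !lnK ?posrE//.
  by field; rewrite !gt_eqF.
have f0 x : 0 < x -> 0 <= f x.
  move=> x0; rewrite /f dif//.
  by rewrite !mulr_ge0 ?expR_ge0// ltW.
have intf := integrable_ge0_derive dF cf f0 Fle.
(* This slope bounds [(t + 2) ln (1 + x)] by [x] plus a constant. *)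
have [C hC] := @ln_le_lin (`|t + 2| + 1)^-1 ltac:(by rewrite invr_gt0 ltr_wpDl).
apply: (@Rintegrable_le _ _ _ (fun x => expR (`|t + 2| * `|C| + 1) / (t + 1) * f x) mpos).
- exact: measurable_pos (@gker_continuous t).
- exact: RintegrableZl.
move=> x /posP x0; rewrite ger0_norm ?gker_ge0//.
have x1 : 0 < 1 + x by rewrite addr_gt0.
have t1n0 : t + 1 != 0 by rewrite gt_eqF.
rewrite /f dif// !mulrA divfK// -mulrA -2!expRD /gker ler_expR.
have e : (t + 2) * ln (1 + x) <= `|t + 2| * `|C| + 1 + x.
  rewrite (@le_trans _ _ (`|t + 2| * ln (1 + x)))//.
    by rewrite ler_wpM2r ?ler_norm// ln_ge0// lerDl ltW.
  have := hC _ x1; have := ler_norm C; set c := `|C|; set q := `|t + 2|.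
  have q0 : 0 <= q by exact: normr_ge0.
  move=> h1 h2; have q1 : 0 < q + 1 by rewrite ltr_wpDl.
  rewrite (@le_trans _ _ (q * ((q + 1)^-1 * (1 + x) + c)))//.
    by rewrite ler_wpM2l// (le_trans h2)// lerD2l.
  rewrite mulrDr addrC -addrA lerD2l mulrA ger_pMl//.
  by rewrite ler_pdivrMr// mul1r lerDl.
by lra.
Qed.

End gamma.

Section gamma1.
Variable R : realType.
Notation mu := (lmeas R).
Notation pos := (`]0%R, +oo[%classic : set R).
Implicit Types (t x k : R).

(** Gamma(t + 1). *)
Definition gamma1 t : R := \int[mu]_(x in pos) gker t x.

Lemma gker_cvg0 t : 0 < t -> gker t x @[x --> 0^'+] --> 0.
Proof.
move=> t0; have h := @powR_cvg0 R t t0.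
apply: (squeeze_cvgr _ (cvg_cst (0 : R)) h); near=> x.
have x0 : 0 < x by near: x; exact: nbhs_right_gt.
by rewrite gker_ge0/= /gker /powR gt_eqF// ler_expR gerBl ltW.
Unshelve. all: by end_near. Qed.

Lemma gker_cvgy t : 0 <= t -> gker t x @[x --> +oo] --> 0.
Proof.
move=> t0.
have q0 : 0 < (2 * (t + 1))^-1 by rewrite invr_gt0; lra.
have [C hC] := ln_le_lin q0.
have h : expR (t * C) * expR (- 2^-1 * x) @[x --> +oo] --> 0.
  rewrite -[X in _ --> X](mulr0 (expR (t * C))).
  by apply: cvgM; [exact: cvg_cst|apply: cvg_expRN].
apply: (squeeze_cvgr _ (cvg_cst (0 : R)) h); near=> x.
have x0 : 0 < x by near: x; apply: nbhs_pinfty_gt; rewrite num_real.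
rewrite gker_ge0/= /gker -expRD ler_expR.
have := ler_wpM2l t0 (hC x x0); rewrite mulrDr.
have : t * ((2 * (t + 1))^-1 * x) <= 2^-1 * x.
  rewrite mulrA; apply: ler_wpM2r; first exact: ltW.
  by rewrite ler_pdivrMr; lra.
lra.
Unshelve. all: by end_near. Qed.

Lemma gamma1S t : 0 < t -> gamma1 t = t * gamma1 (t - 1).
Proof.
move=> t0.
have i1 : mu.-integrable pos (EFin \o gker t) by apply: integrable_gker; lra.
have i2 : mu.-integrable pos (EFin \o gker (t - 1)).
  by apply: integrable_gker; lra.
pose f x := t * gker (t - 1) x + (-1) * gker t x.
have if_ : mu.-integrable pos (EFin \o f).
  exact: (RintegrableD (@mpos R) (RintegrableZl t (@mpos R) i2)
    (RintegrableZl (-1) (@mpos R) i1)).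
have fE x : 0 < x -> (t / x - 1) * gker t x = f x.
  move=> x0; have := @gkerS _ (t - 1) x x0; rewrite subrK => e.
  by rewrite /f mulrBl {1}e; field; rewrite gt_eqF.
have : \int[mu]_(x in pos) f x = 0 - 0.
  apply: (@FTC_pos R (gker t) f _ _ 0 0).
  - by move=> x x0; apply: is_derive_eq (is_derive_gker t x0) (fE x x0).
  - move=> x x0; apply: cvgD; apply: cvgM; try exact: cvg_cst;
    exact: gker_continuous.
  - exact: if_.
  - exact: gker_cvg0.
  - by apply: gker_cvgy; exact: ltW.
rewrite RintegralD; [|exact: mpos|exact: RintegrableZl|exact: RintegrableZl].
rewrite RintegralZl; [|exact: mpos|exact: i2].
rewrite RintegralZl; [|exact: mpos|exact: i1].
rewrite -/(gamma1 t) -/(gamma1 (t - 1)) mulN1r subr0 => /eqP.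
by rewrite subr_eq0 => /eqP.
Qed.

(** On [[t, +oo[] the factor [x^t] is at least [t^t]. *)
Lemma gamma1_ge t : 0 < t -> expR (t * ln t - t) <= gamma1 t.
Proof.
move=> t0.
have i1 : mu.-integrable pos (EFin \o gker t) by apply: integrable_gker; lra.
have cE x : {for x, continuous (fun x => expR (-1 * x))}.
  exact: is_derive_continuous (is_derive_expRM (-1) x).
have h : (\int[mu]_(x in `[t, +oo[) (expR (- 1 * x))%:E = (expR (- t))%:E)%E.
  rewrite (@ge0_continuous_FTC2y _ _ (fun x => - expR (- 1 * x)) t 0).
  - by rewrite -EFinB sub0r opprK mulN1r.
  - by move=> x _; exact: expR_ge0.
  - by apply: continuous_subspaceT => x; exact: cE.
  - by rewrite -oppr0; apply: cvgN; exact: cvg_expRN.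
  - move=> x _; apply: derivableN.
    by have [] := is_derive_expRM (-1) x.
  - by apply: cvg_at_right_filter; apply: cvgN; exact: cE.
  - move=> x _; rewrite derive1E deriveN; last first.
      by have [] := is_derive_expRM (-1) x.
    by have [_ ->] := is_derive_expRM (-1) x; rewrite -mulNr opprK mul1r.
rewrite -lee_fin /gamma1 /Rintegral fineK; last first.
  exact: integrable_fin_num.
have sub : `[t, +oo[ `<=` pos.
  by move=> x /=; rewrite !in_itv/= !andbT; exact: lt_le_trans.
apply: (@le_trans _ _ (\int[mu]_(x in `[t, +oo[) (gker t x)%:E)%E); last first.
  apply: ge0_subset_integral => //.
  - by have /integrableP[] := i1.
  - by move=> x _; rewrite lee_fin gker_ge0.
rewrite (_ : (expR _)%:E =
  (\int[mu]_(x in `[t, +oo[) ((expR (t * ln t))%:E * (expR (- 1 * x))%:E))%E).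
  apply: ge0_le_integral => //.
  - apply: emeasurable_funM => //; apply/measurable_EFinP.
    by apply: measurable_funTS; apply: continuous_measurable_fun => x; exact: cE.
  - have m1 : measurable_fun pos (EFin \o gker t) by have /integrableP[] := i1.
    exact: (measurable_funS _ sub m1).
  - move=> x /=; rewrite in_itv/= andbT => tx; rewrite -EFinM lee_fin -expRD.
    rewrite /gker ler_expR mulN1r lerD2r; apply: ler_wpM2l; first exact: ltW.
    by rewrite ler_ln ?posrE//; exact: lt_le_trans tx.
rewrite ge0_integralZl//.
- by rewrite h -EFinM -expRD.
- apply/measurable_EFinP.
  by apply: measurable_funTS; apply: continuous_measurable_fun => x; exact: cE.
Qed.

Lemma gamma1_gt0 t : 0 < t -> 0 < gamma1 t.
Proof. by move=> t0; exact: lt_le_trans (expR_gt0 _) (gamma1_ge t0). Qed.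

Lemma measurable_gamma1 : measurable_fun pos gamma1.
Proof.
pose h (z : R * R) : R := \1_pos z.2 * gker z.1 z.2.
have mh : measurable_fun setT h.
  have m1 : measurable_fun setT (\1_pos : R -> R) by exact: measurable_indic.
  apply: measurable_funM; first exact: (measurableT_comp m1 measurable_snd).
  apply: (measurableT_comp (@measurable_expR R)).
  apply: measurable_funB => //.
  apply: measurable_funM => //.
  exact: (measurableT_comp (@measurable_ln R) measurable_snd).
have mhE : measurable_fun setT (EFin \o h) by exact/measurable_EFinP.
have h0 z : (0 <= (EFin \o h) z)%E.
  by rewrite lee_fin /h mulr_ge0 ?gker_ge0// indicE.
have m := @measurable_fun_fubini_tonelli_F _ _ _ _ R mu _ mhE h0.
have m1 : measurable_fun pos (fun t => fine (\int[mu]_y (EFin \o h) (t, y))%E).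
  by apply: measurable_funTS; apply: measurableT_comp.
apply: eq_measurable_fun m1 => t _.
rewrite /gamma1 /Rintegral [in RHS]integral_mkcond; congr fine.
apply: eq_integral => x _ /=; rewrite /h patchE indicE /=.
by case: ifPn => _; rewrite ?mul1r ?mul0r.
Qed.

(** The density whose Laplace transform at [z - log z] is [1 / (z - 1)].  It is
    [exp t / (sqrt(2 pi t) Gamma^*(t))], so that it carries the factor
    [1 / Gamma^*(t)] of the integrands of the theorem. *)
Definition phi t : R := expR (t * ln t) / gamma1 t.

Lemma phi_gt0 t : 0 < t -> 0 < phi t.
Proof. by move=> t0; rewrite divr_gt0 ?expR_gt0// gamma1_gt0. Qed.

(** This bound makes the Laplace transform of [phi] converge for [Re v > 1]. *)
Lemma phi_le t : 0 < t -> phi t <= expR t.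
Proof.
move=> t0; rewrite /phi ler_pdivrMr ?gamma1_gt0//.
rewrite -ler_pdivrMl ?expR_gt0// -expRN -expRD addrC.
exact: gamma1_ge.
Qed.

Lemma measurable_phi : measurable_fun pos phi.
Proof.
apply: measurable_funM.
  apply: measurable_funTS; apply: measurableT_comp => //.
  by apply: measurable_funM => //; exact: measurable_ln.
have c1 : {in pos, continuous (fun x : R => x^-1)}.
  move=> x; rewrite inE => /posP x0; apply: cvgV; last exact: cvg_id.
  by rewrite gt_eqF.
have mi : measurable_fun pos (fun x : R => x^-1).
  by apply: open_continuous_measurable_fun.
apply: (@measurable_comp _ _ _ _ _ _ pos (fun x : R => x^-1) _ gamma1) => //.
- by move=> _ /= [t /posP t0 <-]; apply/posP; exact: gamma1_gt0.
- exact: measurable_gamma1.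
Qed.

End gamma1.

(** * Euler's integral at the points of the line Re s = 1 *)

Section complex_gamma.
Variable R : realType.
Notation mu := (lmeas R).
Notation pos := (`]0%R, +oo[%classic : set R).
Implicit Types (t x th k : R).

Definition line1 th : R[i] := 1 +i* th.

Lemma slit_line1 th : slit (line1 th).
Proof. by apply: slit_Re; rewrite /= ltr01. Qed.

Lemma cderiv_line1 th : cderiv line1 th (0 +i* 1).
Proof. by split; [exact: is_derive_cst|exact: is_derive_id]. Qed.

Definition cgker t (s : R[i]) x : R[i] := cexp ((t * ln x)%:C - s * x%:C).

Lemma cgkerS t s x : 0 < x -> cgker (t + 1) s x = x%:C * cgker t s x.
Proof.
move=> x0; have {2}-> : x = expR (ln x) by rewrite lnK// posrE.
rewrite -cexp_real -cexpD /cgker; congr cexp.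
by rewrite mulrDl mul1r real_complexD; ring.
Qed.

Lemma cmod_cgker t th x : cmod (cgker t (line1 th) x) = gker t x.
Proof.
by rewrite cmod_cexp /gker !ReIm /= mul1r mulr0 subr0.
Qed.

Lemma cderiv_ln_real t x : 0 < x -> cderiv (fun x => (t * ln x)%:C) x (t / x)%:C.
Proof.
by move=> x0; apply: cderiv_real; exact: is_deriveZ (is_derive1_ln x0).
Qed.

Lemma cderiv_cgker t s x : 0 < x ->
  cderiv (cgker t s) x (((t / x)%:C - s) * cgker t s x).
Proof.
move=> x0; apply: cderiv_cexp; apply: cderivB; first exact: cderiv_ln_real.
by apply: cderiv_eq (cderivZ s (cderiv_id x)) _; rewrite mulr1.
Qed.

Lemma cmeasurable_cgker t s : cmeasurable pos (cgker t s).
Proof.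
by apply: cmeasurable_cderiv => x x0; eexists; exact: cderiv_cgker.
Qed.

Lemma cintegrable_cgker t th : -1 < t -> cintegrable pos (cgker t (line1 th)).
Proof.
move=> t1; apply: (@cintegrable_le _ _ _ (gker t)) => //.
- exact: cmeasurable_cgker.
- exact: integrable_gker.
- by move=> x _; rewrite cmod_cgker.
Qed.

Definition cgamma t th : R[i] := cintegral pos (cgker t (line1 th)).

Lemma cgammaS t th : 0 <= t ->
  (t + 1)%:C * cgamma t th = line1 th * cgamma (t + 1) th.
Proof.
move=> t0; set s := line1 th.
have i1 : cintegrable pos (cgker t s) by apply: cintegrable_cgker; lra.
have i2 : cintegrable pos (cgker (t + 1) s) by apply: cintegrable_cgker; lra.
pose f x := (t + 1)%:C * cgker t s x - s * cgker (t + 1) s x.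
have if_ : cintegrable pos f.
  by apply: cintegrableB => //; exact: cintegrableZ.
have h : cintegral pos f = 0 - 0.
  apply: (@cFTC_pos _ (cgker (t + 1) s)).
  - move=> x x0; apply: cderiv_eq (cderiv_cgker _ _ x0) _.
    rewrite mulrBl; congr (_ - _); rewrite cgkerS// mulrA -real_complexM.
    by rewrite divfK// gt_eqF.
  - move=> x x0; eexists; apply: cderivB; apply: cderivZ; exact: cderiv_cgker.
  - exact: if_.
  - apply: (@ccvg0_le _ _ _ _ _ (gker (t + 1))).
      by apply: nearW => x; rewrite cmod_cgker.
    by apply: gker_cvg0; lra.
  - apply: (@ccvg0_le _ _ _ _ _ (gker (t + 1))).
      by apply: nearW => x; rewrite cmod_cgker.
    by apply: gker_cvgy; lra.
apply/eqP; rewrite -subr_eq0 -!cintegralZ// -cintegralB//.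
- by rewrite h subrr.
- exact: cintegrableZ.
- exact: cintegrableZ.
Qed.

Lemma cderiv_cgamma t th : 0 <= t -> cderiv (cgamma t) th (- (0 +i* 1) * cgamma (t + 1) th).
Proof.
move=> t0.
have i2 : cintegrable pos (cgker (t + 1) (line1 th)).
  by apply: cintegrable_cgker; lra.
have := @cderiv_cintegral R pos (fun th => cgker t (line1 th))
  (fun th x => - (0 +i* 1) * x%:C * cgker t (line1 th) x) th 1 (gker (t + 1)).
rewrite (@eq_cintegral _ _ _ (fun x => - (0 +i* 1) * cgker (t + 1) (line1 th) x)); last first.
  move=> x /posP x0; rewrite cgkerS//.
  by ring.
rewrite cintegralZ//; apply => //.
- move=> y x _ /posP x0; apply: cderiv_cexp.
  apply: cderiv_eq (cderivB (cderiv_cst _ _)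
    (cderivM (cderiv_line1 y) (cderiv_cst _ _))) _.
  by rewrite mulr0 addr0 sub0r mulNr.
- by move=> y _; apply: cintegrable_cgker; lra.
- by apply: integrable_gker; lra.
- move=> y x _ /posP x0; rewrite (cmodM (- (0 +i* 1) * _)) (cmodM (- (0 +i* 1))) cmodN cmod_cgker cmod_real gtr0_norm//.
  rewrite (_ : cmod (0 +i* 1) = 1) ?mul1r ?gkerS//.
  by rewrite /cmod /= expr0n add0r expr1n sqrtr1.
Qed.

(** With [s = 1 + i th], the product [cgamma t th * s^(t+1)] has derivative [0]
    in [th] and the value [Gamma(t + 1)] at [th = 0]. *)
Lemma cgammaE t th : 0 <= t ->
  cgamma t th = (gamma1 t)%:C * cexp (- (t + 1)%:C * clog (line1 th)).
Proof.
move=> t0.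
pose G y := cgamma t y * cexp ((t + 1)%:C * clog (line1 y)).
have dG y : cderiv G y 0.
  have h := cderivM (cderiv_cgamma y t0)
    (cderiv_cexp (cderivZ (t + 1)%:C (cderiv_clog (cderiv_line1 y) (slit_line1 y)))).
  apply: cderiv_eq h _.
  have s0 : line1 y != 0 by exact: slit_neq0 (slit_line1 y).
  have e : cgamma (t + 1) y = (t + 1)%:C * cgamma t y / line1 y.
    by rewrite cgammaS// mulrAC divff// mul1r.
  by rewrite e; field.
have G0 : G th = G 0.
  have [th0|th0] := leP 0 th.
    by apply: cderiv0_eq => // y _.
  by apply/esym; apply: cderiv0_eq; rewrite ?(ltW th0).
have l0 : clog (line1 0) = 0 by rewrite -[line1 0]/(1%:C) clog_real// ln1.
have g0 : cgamma t 0 = (gamma1 t)%:C.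
  rewrite /cgamma /gamma1 -cintegral_real; apply: eq_cintegral => x _.
  rewrite /cgker -[line1 0]/(1%:C) mul1r.
  by rewrite -[RHS]cexp_real; congr cexp; rewrite rmorphB.
move: G0; rewrite /G l0 mulr0 cexp0 mulr1 g0 => <-.
rewrite -mulrA -cexpD (_ : _ + _ = 0) ?cexp0 ?mulr1//.
by ring.
Qed.

End complex_gamma.

(** * Inversion of the Laplace transform by Abel means *)

Section cexp_integral.
Variable R : realType.
Notation mu := (lmeas R).
Notation pos := (`]0%R, +oo[%classic : set R).
Implicit Types (t x th k : R) (c : R[i]).

Lemma cderiv_cexpM c x : cderiv (fun x => cexp (- (c * x%:C))) x
  (- c * cexp (- (c * x%:C))).
Proof.
apply: cderiv_eq (cderiv_cexp (cderivN (cderivZ c (cderiv_id x)))) _.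
by rewrite mulr1.
Qed.

Lemma Re_Mreal c x : complex.Re (c * x%:C) = complex.Re c * x.
Proof. by rewrite ReM /= mulr0 subr0. Qed.
Lemma Re_cintegral (D : set R) (f : R -> R[i]) :
  complex.Re (cintegral D f) = \int[mu]_(x in D) complex.Re (f x).
Proof. by []. Qed.

Lemma Re_realM x c : complex.Re (x%:C * c) = x * complex.Re c.
Proof. by rewrite ReM /= mul0r subr0. Qed.
Lemma cintegrable_cexpM c : 0 < complex.Re c ->
  cintegrable pos (fun x => cexp (- (c * x%:C))).
Proof.
move=> c0; apply: (@cintegrable_le _ _ _ (fun x => expR (- complex.Re c * x))).
- exact: mpos.
- by apply: cmeasurable_cderiv => x _; eexists; exact: cderiv_cexpM.
- exact: integrable_expRN.
- by move=> x _; rewrite cmod_cexp ReN Re_Mreal mulNr.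
Qed.

Lemma cintegral_cexpM c : 0 < complex.Re c ->
  cintegral pos (fun x => cexp (- (c * x%:C))) = c^-1.
Proof.
move=> c0; have cn0 : c != 0.
  by apply: contraTneq c0 => ->; rewrite ltxx.
rewrite (@cFTC_pos _ (fun x => - c^-1 * cexp (- (c * x%:C))) _ (- c^-1) 0).
- by rewrite sub0r opprK.
- move=> x _; apply: cderiv_eq (cderivZ (- c^-1) (cderiv_cexpM c x)) _.
  by field.
- by move=> x _; eexists; exact: cderiv_cexpM.
- exact: cintegrable_cexpM.
- have := cderiv_ccvg_right (cderivZ (- c^-1) (cderiv_cexpM c 0)).
  by rewrite mulr0 oppr0 cexp0 mulr1.
- apply: (@ccvg0_le _ _ _ _ _
     (fun x => cmod (- c^-1) * expR (- complex.Re c * x))).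
    apply: nearW => x; rewrite (cmodM (- c^-1)) cmod_cexp ReN Re_Mreal mulNr.
    exact: lexx.
  rewrite -[X in _ --> X](mulr0 (cmod (- c^-1))); apply: cvgM.
    exact: cvg_cst.
  exact: cvg_expRN.
Qed.

Lemma integral_expR_cos k u : 0 < k ->
  \int[mu]_(th in pos) (expR (- k * th) * cos (th * u)) = k / (k ^+ 2 + u ^+ 2).
Proof.
move=> k0; have := @cintegral_cexpM (k +i* u) k0.
move=> /(congr1 (@complex.Re R)); rewrite Re_inv cmod_sqr /= => <-.
apply: eq_Rintegral => x _.
by rewrite !mulr0 !mul0r !subr0 add0r cosN mulNr (mulrC u).
Qed.

End cexp_integral.

Section inversion.
Variable R : realType.
Notation mu := (lmeas R).
Notation pos := (`]0%R, +oo[%classic : set R).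
Implicit Types (t x th k e : R) (c : R[i]).

Definition poisson e x : R := e / (e ^+ 2 + x ^+ 2).

Lemma is_derive_poisson e t x : 0 < e ->
  is_derive x 1 (fun x => atan ((x - t) / e)) (poisson e (x - t)).
Proof.
move=> e0; have h1 : is_derive x 1 (fun x => (x - t) / e) e^-1.
  have := is_deriveM (is_derive_shift x 1 (- t)) (is_derive_cst e^-1 x 1) => h.
  by apply: (is_derive_eq h); rewrite /GRing.scale/= mulr0 add0r mulr1.
have h := @is_derive1_comp _ (@atan R) (fun x => (x - t) / e) x _ _
  (is_derive1_atan _) h1.
apply: (is_derive_eq h); rewrite /poisson.
have d0 : e ^+ 2 + (x - t) ^+ 2 != 0.
  by rewrite gt_eqF// ltr_pwDl ?sqr_ge0// exprn_gt0.
have en0 : e != 0 by rewrite gt_eqF.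
rewrite /GRing.scale/=; field.
by rewrite d0 en0.
Qed.

Lemma poisson_continuous e t x : 0 < e ->
  {for x, continuous (fun x => poisson e (x - t))}.
Proof.
move=> e0.
have d0 : e ^+ 2 + (x - t) ^+ 2 != 0.
  by rewrite gt_eqF// ltr_pwDl ?sqr_ge0// exprn_gt0.
apply: cvgM; first exact: cvg_cst.
apply: cvgV => //; apply: cvgD; first exact: cvg_cst.
rewrite expr2; under eq_fun do rewrite expr2.
by apply: cvgM; apply: cvgB; (exact: cvg_id || exact: cvg_cst).
Qed.

Lemma poisson_ge0 e x : 0 < e -> 0 <= poisson e x.
Proof. by move=> e0; rewrite divr_ge0 ?addr_ge0 ?sqr_ge0// ltW. Qed.

Lemma integrable_poisson e t : 0 < e ->
  mu.-integrable pos (EFin \o (fun x => poisson e (x - t))).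
Proof.
move=> e0; apply: (@integrable_ge0_derive _ (fun x => atan ((x - t) / e)) _ _ _ pi).
- by move=> x _; exact: is_derive_poisson.
- by move=> x _; exact: poisson_continuous.
- by move=> x _; exact: poisson_ge0.
- move=> x _; have := atan_gtNpi2 ((x - t) / e); have := atan_ltpi2 ((x - t) / e).
  by have := @pi_gt0 R; rewrite ler_norml => h1 h2 h3; apply/andP; split; lra.
Qed.

Lemma Rintegral_poisson e t : 0 < e ->
  \int[mu]_(x in pos) poisson e (x - t) = pi / 2 + atan (t / e).
Proof.
move=> e0.
rewrite (@FTC_pos _ (fun x => atan ((x - t) / e)) _ _ _ (atan (- t / e)) (pi / 2)).
- by rewrite mulNr atanN opprK.
- by move=> x _; exact: is_derive_poisson.
- by move=> x _; exact: poisson_continuous.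
- exact: integrable_poisson.
- apply: cvg_at_right_filter; rewrite -[X in atan (X / e)]add0r.
  exact: is_derive_continuous (is_derive_poisson t 0 e0).
- have h1 : (x - t) / e @[x --> +oo] --> +oo.
    by apply: gt0_cvgMly; rewrite ?invr_gt0//; apply: cvg_addrr.
  exact: (cvg_comp _ _ h1 (@cvgy_atan R)).
Qed.

(** Abel mean of the inverse Laplace integral of s^(-t-1) on Re s = 1. *)
Definition abel_mean e t : R :=
  \int[mu]_(th in pos) (expR (- e * th) *
    complex.Re (cexp (t%:C * line1 th - (t + 1)%:C * clog (line1 th)))).

Definition hker t x : R := expR t * gker t x.

Lemma hker_ge0 t x : 0 <= hker t x.
Proof. by rewrite mulr_ge0 ?expR_ge0// gker_ge0. Qed.

Lemma hker_diag t : hker t t = expR (t * ln t).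
Proof. by rewrite /hker /gker -expRD; congr expR; ring. Qed.

(** The maximum of [x^t exp(t - x)] is attained at [x = t], where the Poisson
    kernel of [abel_meanE] concentrates. *)
Lemma hker_le t x : 0 < t -> 0 < x -> hker t x <= hker t t.
Proof.
move=> t0 x0; rewrite ler_wpM2l ?expR_ge0// ler_expR.
have := le_ln_sub1 (divr_gt0 x0 t0); rewrite ln_div ?posrE// => h.
have := ler_wpM2l (ltW t0) h.
rewrite !mulrBr mulrCA divff ?gt_eqF// mulr1 mulr1; lra.
Qed.

Lemma integrable_hker t : 0 < t -> mu.-integrable pos (EFin \o hker t).
Proof.
move=> t0; apply: RintegrableZl; first exact: mpos.
by apply: integrable_gker; lra.
Qed.

(** Fubini: inserting Euler's integral for [Gamma(t + 1) s^(-t-1)] and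
    integrating over [th] first turns the Abel factor into a Poisson kernel
    centred at [x = t]. *)
Lemma abel_meanE e t : 0 < e -> 0 < t ->
  gamma1 t * abel_mean e t = \int[mu]_(x in pos) (hker t x * poisson e (x - t)).
Proof.
move=> e0 t0.
pose f th x := expR (- e * th) * (hker t x * cos (th * (x - t))).
have Etop th : pos th -> \int[mu]_(x in pos) f th x =
    gamma1 t * (expR (- e * th) *
    complex.Re (cexp (t%:C * line1 th - (t + 1)%:C * clog (line1 th)))).
  move=> _; rewrite cexpD -mulNr.
  have -> : gamma1 t * (expR (- e * th) * complex.Re (cexp (t%:C * line1 th) *
      cexp (- (t + 1)%:C * clog (line1 th)))) =
      expR (- e * th) * complex.Re (cexp (t%:C * line1 th) * cgamma t th).
    rewrite cgammaE ?ltW// [in RHS]mulrCA Re_realM.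
    by rewrite mulrCA.
  have ic : cintegrable pos (cgker t (line1 th)) by apply: cintegrable_cgker; lra.
  rewrite -cintegralZ// Re_cintegral -RintegralZl//; last first.
    by have [] := cintegrableZ (cexp (t%:C * line1 th)) (@mpos R) ic.
  apply: eq_Rintegral => x _; rewrite /f; congr (_ * _).
  rewrite /cgker -cexpD Re_cexp !ReIm /= /hker /gker -expRD; congr (expR _ * _).
    by ring.
  by rewrite -cosN; congr cos; ring.
have Ebot x : pos x -> \int[mu]_(th in pos) f th x = hker t x * poisson e (x - t).
  move=> _; rewrite /poisson -(integral_expR_cos (x - t) e0) -RintegralZl//.
  - by apply: eq_Rintegral => th _; rewrite /f mulrCA.
  - apply: (@Rintegrable_le _ _ _ (fun th => expR (- e * th))).
    + exact: mpos.
    + apply: measurable_pos => th _; apply: cvgM.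
        exact: is_derive_continuous (is_derive_expRM _ _).
      apply: continuous_comp; last exact: continuous_cos.
      by apply: cvgM; [exact: cvg_id|exact: cvg_cst].
    + exact: integrable_expRN.
    + move=> th _; rewrite normrM (ger0_norm (expR_ge0 _)) ler_piMr ?expR_ge0//.
      by rewrite ler_norml cos_geN1 cos_le1.
have ig : mu.-integrable pos (EFin \o (fun th => expR (- e * th) *
    complex.Re (cexp (t%:C * line1 th - (t + 1)%:C * clog (line1 th))))).
  apply: (@Rintegrable_le _ _ _ (fun th => expR t * expR (- e * th))).
  - exact: mpos.
  - apply: measurable_pos => th _; apply: cvgM.
      exact: is_derive_continuous (is_derive_expRM _ _).
    have h := cderiv_cexp (cderivB (cderivZ t%:C (cderiv_line1 th))
      (cderivZ (t + 1)%:C (cderiv_clog (cderiv_line1 th) (slit_line1 th)))).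
    by have [] := cderiv_continuous h.
  - by apply: RintegrableZl; [exact: mpos|exact: integrable_expRN].
  move=> th _; rewrite normrM (ger0_norm (expR_ge0 _)) mulrC ler_wpM2r ?expR_ge0//.
  rewrite (le_trans (Re_le_cmod _))// cmod_cexp ler_expR !ReIm /=.
  rewrite !mul0r !subr0 mulr1 gerBl mulr_ge0//; first by rewrite addr_ge0 ?(ltW t0).
  by rewrite ln_ge0// (le_trans _ (Re_le_cmod _))//= normr1.
have fle th x : pos th -> pos x -> `|f th x| <= expR (- e * th) * hker t x.
  move=> _ _; rewrite /f normrM (normrM (hker _ _)) (ger0_norm (expR_ge0 _)) (ger0_norm (hker_ge0 _ _)).
  rewrite ler_wpM2l ?expR_ge0// ler_piMr ?hker_ge0//.
  by rewrite ler_norml cos_geN1 cos_le1.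
have mf : measurable_fun [set: R * R] (fun z => f z.1 z.2).
  apply: measurable_funM.
    apply: (measurableT_comp (@measurable_expR R)).
    exact: measurable_funM.
  apply: measurable_funM.
    apply: measurable_funM => //.
    apply: (measurableT_comp (@measurable_expR R)).
    apply: measurable_funB => //; apply: measurable_funM => //.
    exact: (measurableT_comp (@measurable_ln R) measurable_snd).
  apply: (measurableT_comp (@measurable_cos R)).
  by apply: measurable_funM => //; exact: measurable_funB.
have [_ FE] := RFubini (@mpos R) (@mpos R) mf (integrable_expRN e0)
  (integrable_hker t0) fle.
rewrite /abel_mean -RintegralZl; [|exact: mpos|exact: ig].
transitivity (\int[mu]_(th in pos) \int[mu]_(x in pos) f th x).
  by apply: eq_Rintegral => th; rewrite inE => /Etop ->.
by rewrite FE; apply: eq_Rintegral => x; rewrite inE; exact: Ebot.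
Qed.

End inversion.

Section abel_limit.
Variable R : realType.
Notation mu := (lmeas R).
Notation pos := (`]0%R, +oo[%classic : set R).
Implicit Types (t x th k e : R) (c : R[i]).

Lemma integrable_hker_poisson e t : 0 < e -> 0 < t ->
  mu.-integrable pos (EFin \o (fun x => hker t x * poisson e (x - t))).
Proof.
move=> e0 t0.
apply: (@Rintegrable_le _ _ _ (fun x => hker t t * poisson e (x - t))).
- exact: mpos.
- apply: measurable_pos => x x0; apply: cvgM; last exact: poisson_continuous.
  by apply: cvgM; [exact: cvg_cst|exact: gker_continuous].
- by apply: RintegrableZl; [exact: mpos|exact: integrable_poisson].
- move=> x /posP x0; rewrite (ger0_norm (mulr_ge0 (hker_ge0 _ _) (poisson_ge0 _ e0))).
  by rewrite ler_wpM2r ?poisson_ge0// hker_le.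
Qed.

Lemma abel_mean_ge0 e t : 0 < e -> 0 < t -> 0 <= abel_mean e t.
Proof.
move=> e0 t0; rewrite -(pmulr_rge0 _ (gamma1_gt0 t0)) abel_meanE//.
by apply: Rintegral_ge0 => x _; rewrite mulr_ge0 ?hker_ge0 ?poisson_ge0.
Qed.

Lemma abel_mean_le e t : 0 < e -> 0 < t -> abel_mean e t <= pi * phi t.
Proof.
move=> e0 t0; rewrite /phi mulrA ler_pdivlMr ?gamma1_gt0// mulrC abel_meanE//.
apply: (@le_trans _ _ (\int[mu]_(x in pos) (hker t t * poisson e (x - t)))).
  apply: le_Rintegral.
  - exact: mpos.
  - exact: integrable_hker_poisson.
  - by apply: RintegrableZl; [exact: mpos|exact: integrable_poisson].
  - by move=> x /posP x0; rewrite ler_wpM2r ?poisson_ge0// hker_le.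
rewrite RintegralZl//; last exact: integrable_poisson.
rewrite Rintegral_poisson// hker_diag mulrC ler_wpM2r ?expR_ge0//.
by have := atan_ltpi2 (t / e); lra.
Qed.

(** On [[t / 2, +oo[] the derivative is bounded; to the left of it the distance
    [|x - t|] exceeds [t / 2], and boundedness of [hker] suffices. *)
Lemma hker_lipschitz t : 0 < t ->
  exists2 C, 0 <= C & forall x, 0 < x -> `|hker t x - hker t t| <= C * `|x - t|.
Proof.
move=> t0; set H := hker t t.
have H0 : 0 <= H by exact: hker_ge0.
have dH x : 0 < x -> is_derive x 1 (hker t) ((t / x - 1) * hker t x).
  move=> x0; have h := is_deriveZ (expR t) (is_derive_gker t x0).
  by apply: (is_derive_eq h); rewrite /GRing.scale/= /hker; ring.
have dH3 x : t / 2 <= x -> `|(t / x - 1) * hker t x| <= 3 * H.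
  move=> tx; have x0 : 0 < x by lra.
  rewrite normrM (ger0_norm (hker_ge0 _ _)); apply: ler_pM => //.
  - exact: hker_ge0.
  - have h : t / x <= 2 by rewrite ler_pdivrMr//; lra.
    have h' : 0 <= t / x by rewrite divr_ge0// ltW.
    by rewrite ler_norml; apply/andP; split; lra.
  - exact: hker_le.
exists (3 * H + H * (2 / t)).
  by rewrite addr_ge0// mulr_ge0// divr_ge0// ltW.
move=> x x0; have [tx|xt] := leP (t / 2) x.
  apply: (@le_trans _ _ (3 * H * `|x - t|)); last first.
    by rewrite ler_wpM2r// lerDl mulr_ge0// divr_ge0// ltW.
  have lip a b : t / 2 <= a -> a <= b ->
      `|hker t b - hker t a| <= 3 * H * `|b - a|.
    move=> ta ab.
    have [|c /andP[c1 c2] ->] := @Rmvt R (hker t)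
      (fun y => (t / y - 1) * hker t y) a b ab.
      by move=> y /andP[ay yb]; apply: dH; lra.
    by rewrite normrM; apply: ler_wpM2r => //; apply: dH3; exact: le_trans c1.
  have [xt|tx'] := leP x t.
    by rewrite distrC (distrC x); exact: lip.
  by apply: lip; [lra|exact: ltW].
apply: (@le_trans _ _ (H * (2 / t) * `|x - t|)); last first.
  by rewrite ler_wpM2r// lerDr mulr_ge0.
apply: (@le_trans _ _ H).
  have := hker_le t0 x0; have := hker_ge0 t x; rewrite -/H => h1 h2.
  by rewrite ler_norml; apply/andP; split; lra.
rewrite -mulrA ler_peMr// mulrAC ler_pdivlMr// mul1r ltr0_norm; lra.
Qed.

(** The Poisson kernels form an approximate identity of mass [pi], and
    [hker t t / Gamma(t + 1)] is [phi t]: this is the inversion formula that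
    recovers [phi] from [s^(-t-1)] on the line [Re s = 1]. *)
Lemma abel_mean_cvg t : 0 < t ->
  abel_mean (n.+1%:R^-1) t @[n --> \oo] --> pi * phi t.
Proof.
move=> t0; set e := fun n : nat => n.+1%:R^-1 : R.
have e0 n : 0 < e n by rewrite invr_gt0.
have e1 n : e n <= 1 by rewrite invf_le1 ?ler1n.
have ecvg : e n @[n --> \oo] --> 0 by exact: cvg_harmonic.
have [C C0 hC] := hker_lipschitz t0.
set H := hker t t in hC; have H0 : 0 <= H by exact: hker_ge0.
pose D n x := (hker t x - H) * poisson (e n) (x - t).
(* A bound that is uniform in [n]: for [|x - t| <= 1] by the Lipschitz estimate
   and [2 |x - t| e <= e^2 + (x - t)^2], elsewhere because [hker] is bounded. *)
pose G x := (C + 2 * H) * poisson 1 (x - t).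
have iG : mu.-integrable pos (EFin \o G).
  by apply: RintegrableZl; [exact: mpos|exact: integrable_poisson].
have DG n x : pos x -> `|D n x| <= G x.
  move=> /posP x0; rewrite normrM (ger0_norm (poisson_ge0 _ (e0 n))).
  rewrite /G /poisson expr1n; set y := x - t.
  have y2 : 0 < 1 + y ^+ 2 by rewrite ltr_pwDl ?sqr_ge0.
  have d2 : 0 < e n ^+ 2 + y ^+ 2 by rewrite ltr_pwDl ?sqr_ge0// exprn_gt0.
  have := hC x x0; rewrite -/y => h.
  have hH : `|hker t x - H| <= H.
    have := hker_le t0 x0; have := hker_ge0 t x; rewrite -/H => h1 h2.
    by rewrite ler_norml; apply/andP; split; lra.
  rewrite mulrA ler_pdivrMr// mulrAC mulrA ler_pdivlMr// mulr1.
  have [y1|y1] := leP `|y| 1.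
  - have : `|hker t x - H| * e n <= C * (`|y| * e n).
      by rewrite mulrA ler_wpM2r// ltW.
    have : `|y| * e n * 2 <= e n ^+ 2 + y ^+ 2.
      have := sqr_ge0 (`|y| - e n); rewrite sqrrB real_normK ?num_real//; lra.
    have : 1 + y ^+ 2 <= 2.
      have : `|y| ^+ 2 <= 1 by rewrite expr_le1.
      by rewrite real_normK ?num_real//; lra.
    move: (`|hker t x - H| * e n) (`|y| * e n) (mulr_ge0 (normr_ge0 (hker t x - H)) (ltW (e0 n))) => a b a0 h1 h2 h3.
    have h4 : a * (1 + y ^+ 2) <= a * 2 by rewrite ler_wpM2l.
    have h5 : C * (b * 2) <= C * (e n ^+ 2 + y ^+ 2) by rewrite ler_wpM2l.
    have h6 : 0 <= H * (e n ^+ 2 + y ^+ 2) by rewrite mulr_ge0// ltW.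
    lra.
  - have h1 : `|hker t x - H| * e n <= H.
      by rewrite -[leRHS]mulr1; apply: ler_pM => //; exact: ltW.
    have h2 : 1 <= y ^+ 2.
      by rewrite -real_normK ?num_real// -(expr1n R 2) lerXn2r ?nnegrE// ltW.
    have h3 : (`|hker t x - H| * e n) * (1 + y ^+ 2) <= H * (1 + y ^+ 2).
      by rewrite ler_wpM2r// ltW.
    have h4 : H * (1 + y ^+ 2) <= H * (2 * (e n ^+ 2 + y ^+ 2)).
      by rewrite ler_wpM2l//; have := sqr_ge0 (e n); lra.
    have h6 : 0 <= C * (e n ^+ 2 + y ^+ 2) by rewrite mulr_ge0// ltW.
    lra.
have cD x : pos x -> D n x @[n --> \oo] --> 0.
  move=> /posP x0; have [->|xt] := eqVneq x t.
    by rewrite /D subrr; under eq_fun do rewrite mul0r; exact: cvg_cst.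
  rewrite -(mulr0 (hker t x - H)); apply: cvgM; first exact: cvg_cst.
  rewrite -(mul0r (0 ^+ 2 + (x - t) ^+ 2)^-1); apply: cvgM => //.
  apply: cvgV; first by rewrite expr0n add0r expf_neq0// subr_eq0.
  by apply: cvgD; [rewrite expr2; under eq_fun do rewrite expr2; exact: cvgM
                  |exact: cvg_cst].
have mD n : measurable_fun pos (D n).
  apply: measurable_pos => x x0; apply: cvgM; last exact: poisson_continuous.
  apply: cvgB; last exact: cvg_cst.
  by apply: cvgM; [exact: cvg_cst|exact: gker_continuous].
have [_ cI] := Rdominated_cvg (@mpos R) mD cD iG DG.
have I0 : \int[mu]_(x in pos) 0 = 0 :> R by rewrite /Rintegral integral0.
have DE n : \int[mu]_(x in pos) D n x =
    gamma1 t * abel_mean (e n) t - H * (pi / 2 + atan (t / e n)).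
  rewrite abel_meanE// -(Rintegral_poisson t (e0 n)) -RintegralZl//; last first.
    exact: integrable_poisson.
  rewrite -RintegralB//.
  - by apply: eq_Rintegral => x _; rewrite -mulrBl.
  - exact: integrable_hker_poisson.
  - by apply: RintegrableZl => //; exact: integrable_poisson.
have at1 : atan (t / e n) @[n --> \oo] --> pi / 2.
  have te : t * n.+1%:R @[n --> \oo] --> +oo.
    apply/cvgryPge => M; near=> n.
    rewrite mulrC -ler_pdivrMr//; apply: (@le_trans _ _ n%:R).
      by near: n; exact: nbhs_infty_ger.
    by rewrite ler_nat.
  have := (cvg_pinftyP _ _).1 (@cvgy_atan R) _ te.
  by under eq_fun do rewrite -[X in t * X]invrK.
have gE n : abel_mean (e n) t =
    (\int[mu]_(x in pos) D n x + H * (pi / 2 + atan (t / e n))) / gamma1 t.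
  by rewrite DE subrK mulrC mulKf// gt_eqF// gamma1_gt0.
rewrite (funext gE).
have -> : pi * phi t = (0 + H * (pi / 2 + pi / 2)) / gamma1 t.
  by rewrite add0r -splitr /H hker_diag /phi mulrA; congr (_ / _); rewrite mulrC.
apply: cvgM; last exact: cvg_cst.
rewrite I0 in cI; apply: cvgD; first exact: cI.
apply: cvgM; first exact: cvg_cst.
by apply: cvgD; [exact: cvg_cst|].
Unshelve. all: by end_near. Qed.

End abel_limit.

(** * The Laplace transform of phi as a line integral *)

Section vmap.
Variable R : realType.
Implicit Types (s w z : R[i]) (p x y : R).

(** The exponent of the Laplace transform: the integral of
    [exp(-t v(z)) phi(t)] is [1 / (z - 1)] when [v(z) = z - log z]. *)
Definition vmap s : R[i] := s - clog s.

Lemma Re_vmap s : complex.Re (vmap s) = complex.Re s - ln (cmod s).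
Proof. by rewrite /vmap !ReIm. Qed.

Lemma cderiv_vmap (f : R -> R[i]) x d : cderiv f x d -> slit (f x) ->
  cderiv (fun r => vmap (f r)) x (d - d / f x).
Proof. by move=> df sf; apply: cderivB => //; exact: cderiv_clog. Qed.

Lemma cderiv_segment s w x : cderiv (fun r => s + w * r%:C) x w.
Proof.
apply: cderiv_eq (cderivD (cderiv_cst s x) (cderivZ w (cderiv_id x))) _.
by rewrite add0r mulr1.
Qed.

Lemma segment0 s w : s + w * 0%:C = s.
Proof. by rewrite mulr0 addr0. Qed.

Lemma segment1 s z : s + (z - s) * 1%:C = z.
Proof. by rewrite mulr1; ring. Qed.

Lemma Re_segment s z p x : p <= complex.Re s -> p <= complex.Re z -> 0 <= x <= 1 ->
  p <= complex.Re (s + (z - s) * x%:C).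
Proof.
move=> ps pz /andP[x0 x1]; rewrite !ReIm /= mulr0 subr0.
have := ler_wpM2l x0 pz; have : (1 - x) * p <= (1 - x) * complex.Re s.
  by apply: ler_wpM2l => //; lra.
lra.
Qed.

Lemma clog_lipschitz p s z : 0 < p -> p <= complex.Re s -> p <= complex.Re z ->
  cmod (clog z - clog s) <= p^-1 * cmod (z - s).
Proof.
move=> p0 ps pz.
have := @cmvt_le R (fun r => clog (s + (z - s) * r%:C))
  (fun r => (z - s) / (s + (z - s) * r%:C)) 0 1 (p^-1 * cmod (z - s)) ler01.
rewrite segment1 segment0 subr0 mulr1; apply => x x01.
  apply: cderiv_clog; first exact: cderiv_segment.
  by apply: slit_Re; exact: lt_le_trans (Re_segment ps pz x01).
have := Re_segment ps pz x01; set xi := _ + _ => pxi.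
rewrite cmodM cmodV mulrC ler_wpM2r ?cmod_ge0// lef_pV2 ?posrE//.
  by rewrite (le_trans pxi)// (le_trans (ler_norm _))// Re_le_cmod.
by rewrite cmod_gt0 slit_neq0// slit_Re//; exact: lt_le_trans pxi.
Qed.

(** Convexity of the inverse. *)
Lemma inv_chord p (q : R) x : 0 < p -> 0 < q -> 0 <= x <= 1 ->
  ((1 - x) * p + x * q)^-1 <= (1 - x) * p^-1 + x * q^-1.
Proof.
move=> p0 q0 /andP[x0 x1].
have d0 : 0 < (1 - x) * p + x * q.
  have [->|x1'] := eqVneq x 1; first by rewrite subrr mul0r add0r mul1r.
  by rewrite ltr_pwDl ?mulr_ge0 ?mulr_gt0// ?subr_gt0 ?lt_neqAle ?x1'// ltW.
rewrite -subr_ge0.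
have -> : (1 - x) * p^-1 + x * q^-1 - ((1 - x) * p + x * q)^-1 =
  x * (1 - x) * (q - p) ^+ 2 * (p * q * ((1 - x) * p + x * q))^-1.
  by field; rewrite !gt_eqF.
rewrite mulr_ge0 ?invr_ge0//; last by rewrite ltW// !mulr_gt0.
by rewrite mulr_ge0 ?sqr_ge0// mulr_ge0// subr_ge0.
Qed.

(** Along the segment from [s] to [z] the derivative [1 - 1 / xi] of [vmap] has
    a real part that is bounded below by a chord with positive mean; some
    points to the left of [Re s = 1] are still allowed. *)
Lemma vmap_lower z : 1 < complex.Re z -> exists p c : R, [/\ 0 < p, p < 1, 0 < c &
  forall s, p <= complex.Re s -> c * cmod (z - s) <= cmod (vmap z - vmap s)].
Proof.
set q := complex.Re z => q1; pose k := 1 - q^-1.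
have q0 : 0 < q by exact: lt_trans q1.
have k0 : 0 < k by rewrite subr_gt0 invf_lt1.
(* The chord from [1 - p^-1 = - k / 2] to [1 - q^-1 = k] has mean [k / 4]. *)
pose p := (1 + k / 2)^-1.
have pV : p^-1 = 1 + k / 2 by rewrite invrK.
have p0 : 0 < p by rewrite invr_gt0; lra.
exists p, (k / 4); split => //.
- by rewrite invf_lt1; lra.
- by rewrite divr_gt0.
move=> s ps; set w := z - s; set M := cmod w.
pose xi r := s + w * r%:C.
pose h r := complex.Re (vmap (xi r) * conjc w)
  - M ^+ 2 * ((1 - p^-1) * (r - r ^+ 2 / 2) + k * (r ^+ 2 / 2)).
pose h' r := complex.Re ((w - w / xi r) * conjc w)
  - M ^+ 2 * ((1 - p^-1) * (1 - r) + k * r).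
have ww : w * conjc w = (M ^+ 2)%:C.
  by rewrite /M cmod_sqr; case: (w) => a b; apply: complexP => /=; ring.
have sx (r : R) : 0 <= r <= 1 -> slit (xi r).
  move=> r01; apply: slit_Re; apply: (lt_le_trans p0).
  by apply: Re_segment r01 => //; rewrite -/q; apply: ltW; rewrite (lt_trans _ q1)// invf_lt1; lra.
have dh (r : R) : 0 <= r <= 1 -> is_derive r 1 h (h' r).
  move=> r01.
  have [d1 _] := cderivM (cderiv_vmap (cderiv_segment s w r) (sx r r01))
    (cderiv_cst (conjc w) r).
  rewrite mulr0 addr0 in d1.
  have dp : is_derive r 1 (fun r => (1 - p^-1) * (r - r ^+ 2 / 2) + k * (r ^+ 2 / 2))
      ((1 - p^-1) * (1 - r) + k * r).
    have dX := is_deriveX 2 (is_derive_id r (1 : R)).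
    have d2 : is_derive r 1 (fun r : R => r ^+ 2 / 2) r.
      apply: (is_derive_eq (is_deriveM dX (is_derive_cst (2^-1 : R^o) r 1))).
      by rewrite /GRing.scale/=; field.
    have := is_deriveD (is_deriveZ (1 - p^-1) (is_deriveB (is_derive_id r (1 : R)) d2))
      (is_deriveZ k d2) => hh.
    by apply: (is_derive_eq hh).
  exact: is_deriveB d1 (is_deriveZ (M ^+ 2) dp).
have h'0 (r : R) : 0 <= r <= 1 -> 0 <= h' r.
  move=> r01; have r0 : xi r != 0 by exact: slit_neq0 (sx r r01).
  rewrite /h'; have -> : (w - w / xi r) * conjc w = (1 - (xi r)^-1) * (w * conjc w).
    by ring.
  rewrite ww mulrC Re_realM -mulrBr mulr_ge0 ?sqr_ge0//.
  rewrite subr_ge0 ReD ReN Re_inv /=.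
  have Rx : (1 - r) * p + r * q <= complex.Re (xi r).
    rewrite /xi /w !ReIm /= mulr0 subr0 -/q.
    case/andP: r01 => r1 r2.
    have : (1 - r) * p <= (1 - r) * complex.Re s by apply: ler_wpM2l => //; lra.
    lra.
  have pq : p <= q.
    by apply: ltW; rewrite (lt_trans _ q1)// invf_lt1; lra.
  have d0 : 0 < (1 - r) * p + r * q.
    case/andP: r01 => r1 r2.
    by have := ler_wpM2l r1 pq; lra.
  have x0 : 0 < complex.Re (xi r) by exact: lt_le_trans Rx.
  have : complex.Re (xi r) / cmod (xi r) ^+ 2 <= ((1 - r) * p + r * q)^-1.
    rewrite (@le_trans _ _ (complex.Re (xi r))^-1)//; last first.
      by rewrite lef_pV2 ?posrE.
    rewrite ler_pdivrMr ?exprn_gt0 ?cmod_gt0// mulrC ler_pdivlMr//.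
    by rewrite -expr2 cmod_sqr lerDl sqr_ge0.
  have := inv_chord p0 q0 r01; rewrite /k; lra.
have [e e01 he] := @Rmvt R h h' 0 1 ler01 dh.
have := h'0 e e01; rewrite -[h' e]mulr1 -[X in _ * X](subr0 1) -he subr_ge0.
rewrite /h /xi segment0 /w segment1 -/w.
rewrite !expr0n /= !mul0r subr0 !mulr0 addr0 mulr0 subr0 expr1n pV => hh.
have {}hh : k / 4 * M ^+ 2 <= complex.Re ((vmap z - vmap s) * conjc w).
  by rewrite (mulrBl (conjc w)) ReD ReN; lra.
have [M0|M0] := eqVneq M 0; first by rewrite M0 mulr0 cmod_ge0.
have Mp : 0 < M by rewrite lt_def M0 cmod_ge0.
have cw : cmod (conjc w) = M.
  by rewrite /M /cmod; case: (w) => a b /=; rewrite sqrrN.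
rewrite -(ler_pM2r Mp) -mulrA -expr2 (le_trans hh)// -cw -cmodM.
by rewrite (le_trans (ler_norm _))// Re_le_cmod.
Qed.

End vmap.

Section laplace_phi.
Variable R : realType.
Notation mu := (lmeas R).
Notation pos := (`]0%R, +oo[%classic : set R).
Implicit Types (t th e : R) (v : R[i]).

Lemma clog_conj (z : R[i]) : slit z -> clog (conjc z) = conjc (clog z).
Proof.
move=> sz; have sz' : slit (conjc z).
  by move: sz; rewrite /slit; case: (z) => a b /=; rewrite oppr_eq0.
have cz : cmod (conjc z) = cmod z.
  by rewrite /cmod; case: (z) => a b /=; rewrite sqrrN.
have [c1 _ _] := slit_atan sz; have [c2 _ _] := slit_atan sz'.
rewrite /clog c1 c2 cz; case: (z) => a b /=; congr (_ +i* _).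
by rewrite mulNr atanN mulrN.
Qed.

Lemma cexp_conj (z : R[i]) : cexp (conjc z) = conjc (cexp z).
Proof.
apply: complexP; case: z => a b; rewrite /cexp /=; rewrite ?cosN ?sinN; ring.
Qed.

(** The integrand [exp(t s) s^(-t-1)] of the inverse Laplace integral. *)
Definition wker t th : R[i] :=
  cexp (t%:C * line1 th - (t + 1)%:C * clog (line1 th)).

Lemma wker_conj t th : wker t (- th) = conjc (wker t th).
Proof.
rewrite /wker -cexp_conj; congr cexp.
have -> : line1 (- th) = conjc (line1 th) by [].
by rewrite clog_conj ?slit_line1// rmorphB !rmorphM /= !oppr0.
Qed.

Lemma Re_wker t th : (complex.Re (wker t th))%:C = 2^-1 * (wker t th + wker t (- th)).
Proof. by rewrite wker_conj ReJ_add mulrC. Qed.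

Lemma cmod_wker_le t th : 0 < t -> cmod (wker t th) <= expR t.
Proof.
move=> t0; rewrite cmod_cexp ler_expR !ReIm /=.
rewrite !mul0r !subr0 mulr1 gerBl mulr_ge0//; first by lra.
by rewrite ln_ge0// (le_trans _ (Re_le_cmod _))//= normr1.
Qed.

Lemma Re_vmap_line1 th : complex.Re (vmap (line1 th)) <= 1.
Proof.
rewrite Re_vmap /= gerBl ln_ge0// (le_trans _ (Re_le_cmod _))//=.
by rewrite normr1.
Qed.

Definition qker v th : R[i] := (line1 th * (v - vmap (line1 th)))^-1.

Lemma wker_factor v t th : cexp (- (v * t%:C)) * wker t th =
  (line1 th)^-1 * cexp (- ((v - vmap (line1 th)) * t%:C)).
Proof.
rewrite /wker -cexpD -[in RHS](cexp_clog (slit_line1 th)) -cexpN -cexpD.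
rewrite !cexp_clog ?slit_line1// /vmap; congr cexp.
by rewrite real_complexD; ring.
Qed.

Lemma laplace_wker v th : 1 < complex.Re v ->
  cintegrable pos (fun t => cexp (- (v * t%:C)) * wker t th) /\
  cintegral pos (fun t => cexp (- (v * t%:C)) * wker t th) = qker v th.
Proof.
move=> v1.
have c0 : 0 < complex.Re (v - vmap (line1 th)).
  by rewrite ReD ReN subr_gt0 (le_lt_trans (Re_vmap_line1 th)).
rewrite (funext (fun t => wker_factor v t th)); split.
  by apply: cintegrableZ; [exact: mpos|exact: cintegrable_cexpM].
rewrite cintegralZ//; last exact: cintegrable_cexpM.
by rewrite cintegral_cexpM// /qker invfM.
Qed.

Lemma cderiv_clog_line1 th : cderiv (fun th => clog (line1 th)) th
  ((0 +i* 1) / line1 th).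
Proof. exact: cderiv_clog (cderiv_line1 th) (slit_line1 th). Qed.

Lemma cmeasurable_cderivT (f : R -> R[i]) : (forall x, exists d, cderiv f x d) ->
  cmeasurable setT f.
Proof.
by move=> df; split; apply: continuous_measurable_fun => x;
  have [d /cderiv_continuous[]] := df x.
Qed.

Lemma cmeasurable_comp (d : measure_display) (T : measurableType d) (f : R -> R[i]) (g : T -> R) :
  cmeasurable setT f -> measurable_fun setT g -> cmeasurable setT (fun x => f (g x)).
Proof.
by move=> [f1 f2] mg; split; [exact: (measurableT_comp f1 mg)
                             |exact: (measurableT_comp f2 mg)].
Qed.

Lemma cmeasurable_wker : cmeasurable [set: R * R] (fun z => wker z.1 z.2).
Proof.
have m1 : cmeasurable [set: R * R] (fun z => line1 z.2).
  apply: (cmeasurable_comp (f := @line1 R)) => //.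
  by apply: cmeasurable_cderivT => x; exists (0 +i* 1); exact: cderiv_line1.
have m2 : cmeasurable [set: R * R] (fun z => clog (line1 z.2)).
  apply: (cmeasurable_comp (f := fun x => clog (line1 x))) => //.
  by apply: cmeasurable_cderivT => x; eexists; exact: (cderiv_clog_line1 x).
apply: cmeasurable_cexp; apply: cmeasurableB; apply: cmeasurableM => //;
  apply: cmeasurable_real => //.
exact: measurable_funD.
Qed.

Lemma cmeasurable_qker v : 1 < complex.Re v -> cmeasurable setT (qker v).
Proof.
move=> v1; apply: cmeasurable_cderivT => x; eexists; apply: cderivV.
  apply: cderivM; first exact: cderiv_line1.
  apply: cderivB; first exact: cderiv_cst.
  exact: cderiv_vmap (cderiv_line1 x) (slit_line1 x).
rewrite mulf_neq0//; first exact: slit_neq0 (slit_line1 x).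
have : 0 < complex.Re (v - vmap (line1 x)).
  by rewrite ReD ReN subr_gt0 (le_lt_trans (Re_vmap_line1 x)).
by apply: contraTneq => ->; rewrite ltxx.
Qed.

Lemma cintegrable_phi v : 1 < complex.Re v ->
  cintegrable pos (fun t => cexp (- (v * t%:C)) * (phi t)%:C).
Proof.
move=> v1; have v10 : 0 < complex.Re v - 1 by rewrite subr_gt0.
apply: (@cintegrable_le _ _ _ (fun t => expR (- (complex.Re v - 1) * t))).
- exact: mpos.
- apply: cmeasurableM.
    by apply: cmeasurable_cderiv => x _; eexists; exact: cderiv_cexpM.
  by apply: cmeasurable_real; exact: measurable_phi.
- exact: integrable_expRN.
- move=> t /posP t0; rewrite (cmodM (cexp _)) cmod_cexp ReN Re_Mreal cmod_real.
  rewrite ger0_norm; last by rewrite ltW// phi_gt0.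
  have -> : - (complex.Re v - 1) * t = - (complex.Re v * t) + t by ring.
  by rewrite expRD ler_wpM2l ?expR_ge0// phi_le.
Qed.

(** The double integral over [t] and [th] is not absolutely convergent: the
    exchange takes place under an Abel factor, which dominated convergence then
    removes on both sides. *)
Lemma laplace_phi v C : 1 < complex.Re v ->
  (forall th, cmod (qker v th) <= C * poisson 1 th) ->
  pi%:C * cintegral pos (fun t => cexp (- (v * t%:C)) * (phi t)%:C) =
  2^-1 * cintegral pos (fun th => qker v th + qker v (- th)).
Proof.
move=> v1 hC; pose e n : R := n.+1%:R^-1.
have e0 n : 0 < e n by rewrite invr_gt0.
have ecvg : e n @[n --> \oo] --> 0 by exact: cvg_harmonic.
have v10 : 0 < complex.Re v - 1 by rewrite subr_gt0.
pose F n t th := cexp (- (v * t%:C)) *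
  (expR (- e n * th) * complex.Re (wker t th))%:C.
have cexpv t : cmod (cexp (- (v * t%:C))) = expR (- complex.Re v * t).
  by rewrite cmod_cexp ReN Re_Mreal mulNr.
have Fle n t th : pos t -> pos th ->
    cmod (F n t th) <= expR (- (complex.Re v - 1) * t) * expR (- e n * th).
  move=> /posP t0 /posP th0; rewrite /F (cmodM (cexp _)) cexpv cmod_real normrM.
  rewrite (ger0_norm (expR_ge0 _)) mulrCA mulrC ler_wpM2r ?expR_ge0//.
  have -> : - (complex.Re v - 1) * t = - complex.Re v * t + t by ring.
  rewrite expRD ler_wpM2l ?expR_ge0//.
  by rewrite (le_trans (Re_le_cmod _))// cmod_wker_le.
have mF n : cmeasurable [set: R * R] (fun z => F n z.1 z.2).
  apply: cmeasurableM.
    apply: cmeasurable_cexp; apply: cmeasurableN; apply: cmeasurableM.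
      exact: cmeasurable_cst.
    exact: cmeasurable_real.
  apply: cmeasurable_real; apply: measurable_funM.
    apply: (measurableT_comp (@measurable_expR R)).
    exact: measurable_funM.
  by have [] := cmeasurable_wker.
have FB n := cFubini (@mpos R) (@mpos R) (mF n) (integrable_expRN v10)
  (integrable_expRN (e0 n)) (Fle n).
have in1 n t : pos t -> cintegral pos (F n t) =
    cexp (- (v * t%:C)) * (abel_mean (e n) t)%:C.
  move=> /posP t0; rewrite /abel_mean -cintegral_real -cintegralZ//.
  apply: cintegrable_real => //.
  apply: (@Rintegrable_le _ _ _ (fun th => expR t * expR (- e n * th))) => //.
  - apply: measurable_pos => th _; apply: cvgM.
      exact: is_derive_continuous (is_derive_expRM _ _).
    have h := cderiv_cexp (cderivB (cderivZ t%:C (cderiv_line1 th))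
      (cderivZ (t + 1)%:C (cderiv_clog_line1 th))).
    by have [] := cderiv_continuous h.
  - by apply: RintegrableZl => //; exact: integrable_expRN.
  - move=> th _; rewrite normrM (ger0_norm (expR_ge0 _)) mulrC.
    rewrite ler_wpM2r ?expR_ge0// (le_trans (Re_le_cmod _))//.
    exact: cmod_wker_le.
have in2 n th : pos th -> cintegral pos (F n ^~ th) =
    (expR (- e n * th))%:C * (2^-1 * (qker v th + qker v (- th))).
  move=> _; have [i1 <-] := laplace_wker th v1.
  have [i2 <-] := laplace_wker (- th) v1.
  have i12 := cintegrableD (@mpos R) i1 i2.
  have i3 := cintegrableZ 2^-1 (@mpos R) i12.
  rewrite -(cintegralD (@mpos R) i1 i2) -(cintegralZ _ (@mpos R) i12).
  rewrite -(cintegralZ _ (@mpos R) i3).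
  apply: eq_cintegral => t _; rewrite /F real_complexM Re_wker.
  by ring.
have lim1 : ccvg \oo (fun n => cintegral pos (fun t => cintegral pos (F n t)))
    (cintegral pos (fun t => cexp (- (v * t%:C)) * (pi * phi t)%:C)).
  apply: (cdominated_cvg (@mpos R) (fun n => (FB n).1) _
    (RintegrableZl pi (@mpos R) (integrable_expRN v10)) _).2.
  - move=> t pt; rewrite (funext (fun n => in1 n t pt)).
    apply: ccvgM; first exact: ccvg_cst.
    by apply: ccvg_real; apply: abel_mean_cvg; exact/posP.
  - move=> n t pt; have t0 := (posP _).1 pt.
    rewrite in1// (cmodM (cexp _)) cexpv cmod_real ger0_norm ?abel_mean_ge0//.
    have -> : - (complex.Re v - 1) * t = - complex.Re v * t + t by ring.
    rewrite expRD mulrCA ler_wpM2l ?expR_ge0//.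
    rewrite (le_trans (abel_mean_le _ _))// ler_wpM2l ?pi_ge0//.
    exact: phi_le.
have [iQ lim2] : cintegrable pos (fun th => 2^-1 * (qker v th + qker v (- th))) /\
  ccvg \oo (fun n => cintegral pos (fun th => cintegral pos (F n ^~ th)))
    (cintegral pos (fun th => 2^-1 * (qker v th + qker v (- th)))).
  have mQ := cmeasurable_qker v1.
  have mQ' : cmeasurable [set: R] (fun th => qker v (- th)).
    by apply: (cmeasurable_comp (f := qker v)) => //; exact: measurable_funN.
  have iG := RintegrableZl C (@mpos R) (@integrable_poisson R 1 0 ltr01).
  have mI n : cmeasurable pos (fun th => cintegral pos (F n ^~ th)).
    have [h1 h2] : cmeasurable [set: R] (fun th =>
        (expR (- e n * th))%:C * (2^-1 * (qker v th + qker v (- th)))).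
      apply: cmeasurableM.
        apply: cmeasurable_real; apply: (measurableT_comp (@measurable_expR R)).
        exact: measurable_funM.
      by apply: cmeasurableM; [exact: cmeasurable_cst|exact: cmeasurableD].
    split.
    - apply: eq_measurable_fun (measurable_funTS h1) => x.
      by rewrite inE => px; rewrite in2.
    - apply: eq_measurable_fun (measurable_funTS h2) => x.
      by rewrite inE => px; rewrite in2.
  apply: (cdominated_cvg (@mpos R) mI _ iG _).
  - move=> th pth; rewrite (funext (fun n => in2 n th pth)).
    rewrite -[X in ccvg _ _ X]mul1r; apply: ccvgM; last exact: ccvg_cst.
    apply: ccvg_real; rewrite -(expR0 R); apply: cvg_comp; last exact: continuous_expR.
    rewrite -(mul0r th) -oppr0; apply: cvgM; last exact: cvg_cst.
    exact: cvgN.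
  - move=> n th pth; have th0 := (posP _).1 pth.
    rewrite in2// (cmodM (_%:C)) (cmodM 2^-1) cmod_real.
    have -> : cmod (2^-1 : R[i]) = 2^-1.
      by rewrite -(rmorph_nat (real_complex R) 2) -real_complexV cmod_real ger0_norm.
    rewrite (ger0_norm (expR_ge0 _)) subr0.
    have h1 : expR (- e n * th) <= 1.
      by rewrite -(expR0 R) ler_expR mulNr oppr_le0 mulr_ge0// ltW.
    have h2 : cmod (qker v th + qker v (- th)) <= 2 * (C * poisson 1 th).
      rewrite (le_trans (le_cmodD _ _))// mulr_natl mulr2n lerD//.
      by rewrite -[X in poisson 1 X]opprK (le_trans (hC _))// /poisson !sqrrN.
    rewrite -[leRHS]mul1r; apply: ler_pM => //; last by rewrite ler_pdivrMl.
    by rewrite mulr_ge0// cmod_ge0.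
have E : (fun n => cintegral pos (fun t => cintegral pos (F n t))) =
    (fun n => cintegral pos (fun th => cintegral pos (F n ^~ th))).
  by apply/funext => n; exact: (FB n).2.
rewrite E in lim1; have L := ccvg_unique lim1 lim2.
have iQ2 : cintegrable pos (fun th => qker v th + qker v (- th)).
  have two0 : (2 : R[i]) != 0 by rewrite pnatr_eq0.
  have E2 th : qker v th + qker v (- th) = 2 * (2^-1 * (qker v th + qker v (- th))).
    by rewrite (mulVKf two0).
  rewrite (funext E2); exact: (cintegrableZ 2 (@mpos R) iQ).
rewrite -(cintegralZ _ (@mpos R) iQ2) -L.
rewrite -(cintegralZ _ (@mpos R) (cintegrable_phi v1)).
apply: eq_cintegral => t _.
by rewrite real_complexM mulrCA.
Qed.

End laplace_phi.

(** * Evaluation of the line integral by residues *)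

Lemma cderiv_quotient (R : realType) (f : R -> R[i]) (x : R) (d : R[i])
    (u : nat -> R) : cderiv f x d -> (forall n, u n != 0) ->
  u n @[n --> \oo] --> 0 ->
  ccvg \oo (fun n => (f (x + u n) - f x) * ((u n)^-1)%:C) d.
Proof.
move=> [d1 d2] u0 ucvg.
have H (g : R -> R) (e : R) : is_derive x 1 g e ->
    (g (x + u n) - g x) / u n @[n --> \oo] --> e.
  move=> [/cvg_ex[/= l hl] ge].
  have le : l = e by rewrite -ge; apply/esym/cvg_lim.
  rewrite le in hl; have h := (cvgr_dnbhsP _ _ _).1 hl u (conj u0 ucvg).
  rewrite (_ : (fun n => _) =
    (fun n => (u n)^-1 *: (g (u n *: (1 : R) + x) - g x))) //.
  by apply/funext => n; rewrite /GRing.scale/= mulr1 mulrC (addrC x).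
split.
- under eq_fun do rewrite mulrC Re_realM ReD ReN mulrC; exact: H.
- have Im_realM (y : R) (z : R[i]) : complex.Im (y%:C * z) = y * complex.Im z.
    by rewrite ImM /= mul0r addr0.
  under eq_fun do rewrite mulrC Im_realM ImD ImN mulrC; exact: H.
Qed.

Section residue.
Variable R : realType.
Notation mu := (lmeas R).
Notation pos := (`]0%R, +oo[%classic : set R).
Variables (lam : R[i]) (p c : R).
Hypothesis lam1 : 1 < complex.Re lam.
Hypothesis p0 : 0 < p.
Hypothesis p1 : p < 1.
Hypothesis c0 : 0 < c.
Hypothesis lower : forall s, p <= complex.Re s ->
  c * cmod (lam - s) <= cmod (vmap lam - vmap s).
Implicit Types (t th rho sg : R) (s : R[i]).

Let m := complex.Re lam - 1.
Let eta := complex.Im lam.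
Let m0 : 0 < m. Proof. by rewrite subr_gt0. Qed.

Let D s := vmap lam - vmap s.
(** The Cauchy kernel [1 / (s (vmap lam - vmap s))] with its pole [lam] removed. *)
Definition hquot s := (lam - s) / (s * D s).
Definition hquot' s :=
  (- (s * D s) - (lam - s) * (D s - s * (1 - s^-1))) / (s * D s) ^+ 2.

Let plam : p <= complex.Re lam.
Proof. by rewrite ltW// (lt_trans p1). Qed.

Let ps_cmod s : p <= complex.Re s -> p <= cmod s.
Proof. by move=> ps; rewrite (le_trans ps)// (le_trans (ler_norm _))// Re_le_cmod. Qed.

Let ps_slit s : p <= complex.Re s -> slit s.
Proof. by move=> ps; apply: slit_Re; exact: lt_le_trans ps. Qed.

Let ps_gt0 s : p <= complex.Re s -> 0 < cmod s.
Proof. by move=> /ps_cmod; exact: lt_le_trans. Qed.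

Let K := 1 + p^-1.
Let K0 : 0 < K. Proof. by rewrite addr_gt0// invr_gt0. Qed.

Let upper s : p <= complex.Re s -> cmod (D s) <= K * cmod (lam - s).
Proof.
move=> ps; rewrite /D /vmap.
have -> : lam - clog lam - (s - clog s) = (lam - s) + - (clog lam - clog s) by ring.
rewrite (le_trans (le_cmodD _ _))// cmodN mulrDl mul1r lerD2l.
exact: clog_lipschitz.
Qed.

Let D0 s : p <= complex.Re s -> s != lam -> 0 < cmod (D s).
Proof.
move=> ps sl; apply: lt_le_trans (lower ps); rewrite mulr_gt0// cmod_gt0.
by rewrite subr_eq0 eq_sym.
Qed.

Let L := 1 + cmod lam / p.
Let L0 : 0 < L. Proof. by rewrite ltr_pwDl// divr_ge0 ?cmod_ge0// ltW. Qed.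

Let dist_le s : p <= complex.Re s -> cmod (lam - s) <= L * cmod s.
Proof.
move=> ps; rewrite (le_trans (le_cmodD _ _))// cmodN /L mulrDl mul1r addrC lerD2l.
rewrite mulrAC -mulrA ler_peMr ?cmod_ge0// ler_pdivlMr// mul1r.
exact: ps_cmod.
Qed.

Lemma hquot_le s : p <= complex.Re s -> s != lam ->
  cmod (hquot s) <= (c * cmod s)^-1.
Proof.
move=> ps sl; have s0 := ps_gt0 ps; have d0 := D0 ps sl.
have l0 : 0 < cmod (lam - s) by rewrite cmod_gt0 subr_eq0 eq_sym.
rewrite /hquot cmodM cmodV cmodM invfM [leRHS]invfM mulrCA mulrC ler_wpM2r//.
  by rewrite invr_ge0 cmod_ge0.
by rewrite ler_pdivrMr// mulrC ler_pdivlMr// mulrC lower.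
Qed.

Let C1 := ((cmod lam * K + 1) / p + 1) / c ^+ 2.

(** A decay of order two along vertical lines, which permits differentiation
    under the integral sign. *)
Lemma hquot'_le s : p <= complex.Re s -> s != lam ->
  cmod (hquot' s) <= C1 / (cmod s * cmod (lam - s)).
Proof.
move=> ps sl; have s0 := ps_gt0 ps; have d0 := D0 ps sl.
have l0 : 0 < cmod (lam - s) by rewrite cmod_gt0 subr_eq0 eq_sym.
have sn0 : s != 0 by rewrite -cmod_gt0.
have -> : hquot' s = (- (lam * D s) + (lam - s) * (s - 1)) / (s * D s) ^+ 2.
  by rewrite /hquot'; congr (_ / _); field.
rewrite cmodM cmodV expr2 !cmodM.
set a := cmod s in s0 *; set b := cmod (lam - s) in l0 *.
set d := cmod (D s) in d0 *.
have n1 : cmod (- (lam * D s) + (lam - s) * (s - 1)) <=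
    (cmod lam * K + (a + 1)) * b.
  rewrite (le_trans (le_cmodD _ _))// cmodN !cmodM mulrDl; apply: lerD.
    by rewrite -mulrA ler_wpM2l ?cmod_ge0// upper.
  rewrite mulrC ler_wpM2r ?cmod_ge0// (le_trans (le_cmodD _ _))//.
  by rewrite cmodN cmod1.
have cb : c * b <= d by exact: lower.
have ap : p <= a by exact: ps_cmod.
have n2 : cmod lam * K + (a + 1) <= ((cmod lam * K + 1) / p + 1) * a.
  rewrite mulrDl mul1r addrA addrAC lerD2r mulrAC -mulrA ler_peMr//.
    by rewrite addr_ge0// mulr_ge0 ?cmod_ge0// ltW.
  by rewrite ler_pdivlMr// mul1r.
rewrite ler_pdivrMr ?mulr_gt0// (le_trans n1)//.
rewrite (le_trans (ler_wpM2r (ltW l0) n2))// /C1.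
set Q := (_ / p + 1).
have Q0 : 0 <= Q.
  by rewrite addr_ge0// divr_ge0 ?addr_ge0 ?mulr_ge0 ?cmod_ge0// ltW.
have -> : Q / c ^+ 2 / (a * b) * (a * d * (a * d)) = Q * a * (d ^+ 2 / (c ^+ 2 * b)).
  by field; rewrite !gt_eqF.
rewrite ler_wpM2l ?mulr_ge0//; first exact: ltW.
rewrite ler_pdivlMr ?mulr_gt0 ?exprn_gt0//.
have -> : b * (c ^+ 2 * b) = (c * b) ^+ 2 by ring.
by rewrite lerXn2r ?nnegrE// ltW// mulr_gt0.
Qed.

Lemma cderiv_hquot (f : R -> R[i]) x d : cderiv f x d ->
  p <= complex.Re (f x) -> f x != lam ->
  cderiv (fun r => hquot (f r)) x (hquot' (f x) * d).
Proof.
move=> df ps sl.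
have sn0 : f x != 0 by rewrite -cmod_gt0 ps_gt0.
have dn0 : D (f x) != 0 by rewrite -cmod_gt0 D0.
have dl := cderivB (cderiv_cst lam x) df.
have dD := cderivB (cderiv_cst (vmap lam) x) (cderiv_vmap df (ps_slit ps)).
have dsD := cderivM df dD.
have h := cderivM dl (cderivV dsD (mulf_neq0 sn0 dn0)).
apply: cderiv_eq h _; rewrite /hquot' /=.
move: dn0; rewrite /D; move: (vmap (f x)) => y dn0.
by field; rewrite sn0 dn0.
Qed.

Lemma cderiv_hquot' (f : R -> R[i]) x d : cderiv f x d ->
  p <= complex.Re (f x) -> f x != lam ->
  exists e, cderiv (fun r => hquot' (f r)) x e.
Proof.
move=> df ps sl.
have sn0 : f x != 0 by rewrite -cmod_gt0 ps_gt0.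
have dn0 : D (f x) != 0 by rewrite -cmod_gt0 D0.
have dl := cderivB (cderiv_cst lam x) df.
have dD := cderivB (cderiv_cst (vmap lam) x) (cderiv_vmap df (ps_slit ps)).
have dsD := cderivM df dD.
have dI := cderivB (cderiv_cst 1 x) (cderivV df sn0).
have dN := cderivB (cderivN dsD) (cderivM dl (cderivB dD (cderivM df dI))).
eexists; apply: cderivM; first exact: dN.
have -> : (fun r => ((f r * D (f r)) ^+ 2)^-1) =
    (fun r => ((f r * D (f r)) * (f r * D (f r)))^-1).
  by apply/funext => r; rewrite expr2.
apply: cderivV; first exact: (cderivM dsD dsD).
by rewrite !mulf_neq0.
Qed.

(** Points of the vertical line at signed distance [sg * rho * m] from [lam]. *)
Definition contour_dir sg th : R[i] := (sg * m) +i* (th - eta).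
Definition contour_pt sg rho th : R[i] := lam + rho%:C * contour_dir sg th.

Lemma Re_contour_pt sg rho th : complex.Re (contour_pt sg rho th) =
  complex.Re lam + rho * (sg * m).
Proof. by rewrite /contour_pt ReD Re_realM. Qed.

Lemma cmod_contour_dir sg th : sg ^+ 2 = 1 -> cmod (contour_dir sg th) ^+ 2 = m ^+ 2 + (th - eta) ^+ 2.
Proof. by move=> sg1; rewrite cmod_sqr /= exprMn sg1 mul1r. Qed.

Lemma contour_dir_neq0 sg th : sg ^+ 2 = 1 -> contour_dir sg th != 0.
Proof.
move=> sg1; rewrite -cmod_eq0 -sqrf_eq0 cmod_contour_dir// gt_eqF//.
by rewrite ltr_pwDl ?sqr_ge0// exprn_gt0.
Qed.

Lemma contour_dir_poisson sg th : sg ^+ 2 = 1 ->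
  (cmod (contour_dir sg th) ^+ 2)^-1 = m^-1 * poisson m (th - eta).
Proof.
by move=> sg1; rewrite cmod_contour_dir// /poisson mulrA mulVf ?mul1r// gt_eqF.
Qed.

Lemma contour_pt_neq sg rho th : sg ^+ 2 = 1 -> 0 < rho -> contour_pt sg rho th != lam.
Proof.
move=> sg1 r0; rewrite /contour_pt -subr_eq0 addrAC subrr add0r mulf_neq0//.
  by rewrite real_complex_eq0 gt_eqF.
exact: contour_dir_neq0.
Qed.

Lemma cmod_contour_pt sg rho th : 0 < rho ->
  cmod (lam - contour_pt sg rho th) = rho * cmod (contour_dir sg th).
Proof.
move=> r0; rewrite /contour_pt opprD addrA subrr add0r cmodN cmodM cmod_real.
by rewrite gtr0_norm.
Qed.

Let contour_pt_inv sg rho th : sg ^+ 2 = 1 -> 0 < rho ->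
  p <= complex.Re (contour_pt sg rho th) ->
  (cmod (contour_pt sg rho th))^-1 <= L / (rho * cmod (contour_dir sg th)).
Proof.
move=> sg1 r0 ps; have w0 : 0 < cmod (contour_dir sg th) by rewrite cmod_gt0 contour_dir_neq0.
rewrite ler_pdivlMr ?mulr_gt0// mulrC ler_pdivrMr ?ps_gt0//.
by rewrite -cmod_contour_pt// dist_le.
Qed.

Definition contour_ker sg rho th := hquot (contour_pt sg rho th) / contour_dir sg th.

Lemma contour_ker_le sg rho th : sg ^+ 2 = 1 -> 0 < rho ->
  p <= complex.Re (contour_pt sg rho th) ->
  cmod (contour_ker sg rho th) <= L / (c * m * rho) * poisson m (th - eta).
Proof.
move=> sg1 r0 ps; have w0 : 0 < cmod (contour_dir sg th) by rewrite cmod_gt0 contour_dir_neq0.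
rewrite cmodM cmodV.
have h1 := hquot_le ps (contour_pt_neq th sg1 r0).
have h2 := contour_pt_inv sg1 r0 ps.
have h3 : cmod (hquot (contour_pt sg rho th)) <= c^-1 * (L / (rho * cmod (contour_dir sg th))).
  by rewrite (le_trans h1)// invfM ler_wpM2l// invr_ge0 ltW.
rewrite (le_trans (ler_wpM2r (_ : 0 <= (cmod (contour_dir sg th))^-1) h3))//.
  by rewrite invr_ge0 ltW.
rewrite (_ : L / _ * _ = L / (c * rho) * (m^-1 * poisson m (th - eta))); last first.
  by field; rewrite !gt_eqF.
rewrite -(contour_dir_poisson th sg1) le_eqVlt; apply/orP; left; apply/eqP.
by field; rewrite !gt_eqF.
Qed.

Lemma hquot'_contour_le sg rho th : sg ^+ 2 = 1 -> 0 < rho ->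
  p <= complex.Re (contour_pt sg rho th) ->
  cmod (hquot' (contour_pt sg rho th)) <= C1 * L / (m * rho ^+ 2) * poisson m (th - eta).
Proof.
move=> sg1 r0 ps; have w0 : 0 < cmod (contour_dir sg th) by rewrite cmod_gt0 contour_dir_neq0.
have h1 := hquot'_le ps (contour_pt_neq th sg1 r0).
have h2 := contour_pt_inv sg1 r0 ps.
have C10 : 0 <= C1.
  rewrite /C1 divr_ge0 ?sqr_ge0// addr_ge0// divr_ge0//; last exact: ltW.
  by rewrite addr_ge0// mulr_ge0 ?cmod_ge0// ltW.
rewrite (le_trans h1)// cmod_contour_pt// invfM mulrA.
rewrite (le_trans (ler_wpM2r (_ : 0 <= (rho * cmod (contour_dir sg th))^-1)
  (ler_wpM2l C10 h2)))//.
  by rewrite invr_ge0 mulr_ge0// ltW.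
rewrite (_ : C1 * L / _ * _ = C1 * L / rho ^+ 2 * (m^-1 * poisson m (th - eta))); last first.
  by field; rewrite !gt_eqF.
rewrite -(contour_dir_poisson th sg1) le_eqVlt; apply/orP; left; apply/eqP.
by field; rewrite !gt_eqF.
Qed.

Lemma cderiv_contour_pt sg rho th : cderiv (contour_pt sg rho) th (rho%:C * (0 +i* 1)).
Proof.
have dw : cderiv (contour_dir sg) th (0 +i* 1).
  split; first exact: is_derive_cst.
  by have := is_derive_shift th (1 : R) (- eta).
apply: cderiv_eq (cderivD (cderiv_cst lam th) (cderivZ rho%:C dw)) _.
by rewrite add0r.
Qed.

Lemma cderiv_opp (f : R -> R[i]) x d : cderiv f (- x) d ->
  cderiv (fun r => f (- r)) x (- d).
Proof.
move=> [d1 d2]; split; rewrite ?(ReN, ImN).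
- have h := @is_derive1_comp _ (fun r => complex.Re (f r)) (-%R) x _ _ d1
    (is_deriveNid x 1).
  by apply: (is_derive_eq h); rewrite /GRing.scale/=; ring.
- have h := @is_derive1_comp _ (fun r => complex.Im (f r)) (-%R) x _ _ d2
    (is_deriveNid x 1).
  by apply: (is_derive_eq h); rewrite /GRing.scale/=; ring.
Qed.

Lemma cderiv_contour_ker sg rho th : sg ^+ 2 = 1 -> 0 < rho ->
  p <= complex.Re lam + rho * (sg * m) -> exists d, cderiv (contour_ker sg rho) th d.
Proof.
move=> sg1 r0 pr; have ps : p <= complex.Re (contour_pt sg rho th) by rewrite Re_contour_pt.
have dw : cderiv (contour_dir sg) th (0 +i* 1).
  split; first exact: is_derive_cst.
  by have := is_derive_shift th (1 : R) (- eta).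
eexists; apply: cderivM; last by apply: cderivV dw _; exact: contour_dir_neq0.
by apply: cderiv_hquot (cderiv_contour_pt _ _ _) ps _; exact: contour_pt_neq.
Qed.

Definition contour_sym sg rho th := contour_ker sg rho th + contour_ker sg rho (- th).
Definition contour_int sg rho := cintegral pos (contour_sym sg rho).

Definition poisson_sym th := poisson m (th - eta) + poisson m (th - - eta).

Lemma poisson_opp th : poisson m (- th - eta) = poisson m (th - - eta).
Proof. by rewrite /poisson -opprD sqrrN opprK. Qed.

Lemma integrable_poisson_sym : mu.-integrable pos (EFin \o poisson_sym).
Proof. by apply: RintegrableD; [exact: mpos|exact: integrable_poisson..]. Qed.

Lemma poisson_sym_le (f : R -> R[i]) B : (forall th, cmod (f th) <= B * poisson m (th - eta)) ->
  forall th, cmod (f th + f (- th)) <= B * poisson_sym th.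
Proof.
move=> fB th; rewrite (le_trans (le_cmodD _ _))// /poisson_sym mulrDr -poisson_opp.
by apply: lerD.
Qed.

Lemma cmeasurable_contour_sym sg rho : sg ^+ 2 = 1 -> 0 < rho ->
  p <= complex.Re lam + rho * (sg * m) -> cmeasurable pos (contour_sym sg rho).
Proof.
move=> sg1 r0 pr; apply: cmeasurable_cderiv => th _.
have [d1 h1] := cderiv_contour_ker th sg1 r0 pr.
have [d2 h2] := cderiv_contour_ker (- th) sg1 r0 pr.
by eexists; exact: cderivD h1 (cderiv_opp h2).
Qed.

Lemma contour_sym_le sg rho th : sg ^+ 2 = 1 -> 0 < rho ->
  p <= complex.Re lam + rho * (sg * m) ->
  cmod (contour_sym sg rho th) <= L / (c * m * rho) * poisson_sym th.
Proof.
move=> sg1 r0 pr; apply: (poisson_sym_le (f := contour_ker sg rho)) => y.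
by apply: contour_ker_le => //; rewrite Re_contour_pt.
Qed.

Lemma cintegrable_contour_sym sg rho : sg ^+ 2 = 1 -> 0 < rho ->
  p <= complex.Re lam + rho * (sg * m) -> cintegrable pos (contour_sym sg rho).
Proof.
move=> sg1 r0 pr; apply: (@cintegrable_le _ _ _ (fun th => L / (c * m * rho) * poisson_sym th)).
- exact: mpos.
- exact: cmeasurable_contour_sym.
- by apply: RintegrableZl; [exact: mpos|exact: integrable_poisson_sym].
- by move=> th _; exact: contour_sym_le.
Qed.

Lemma cvg_inv_contour_dir sg : sg ^+ 2 = 1 ->
  (cmod (contour_dir sg th))^-1 @[th --> +oo] --> 0.
Proof.
move=> sg1; apply/cvgrPdist_le => /= e e0; near=> th.
have h : eta + e^-1 <= th by near: th; apply: nbhs_pinfty_ge; rewrite num_real.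
rewrite sub0r normrN ger0_norm ?invr_ge0 ?cmod_ge0//.
rewrite -[leRHS]invrK lef_pV2 ?posrE ?invr_gt0// ?cmod_gt0 ?contour_dir_neq0//.
by rewrite (le_trans _ (Im_le_cmod _))//= (le_trans _ (ler_norm _))//; lra.
Unshelve. all: by end_near. Qed.

Lemma cvg_inv_contour_dirN sg : sg ^+ 2 = 1 ->
  (cmod (contour_dir sg (- th)))^-1 @[th --> +oo] --> 0.
Proof.
move=> sg1; apply/cvgrPdist_le => /= e e0; near=> th.
have h : e^-1 - eta <= th by near: th; apply: nbhs_pinfty_ge; rewrite num_real.
rewrite sub0r normrN ger0_norm ?invr_ge0 ?cmod_ge0//.
rewrite -[leRHS]invrK lef_pV2 ?posrE ?invr_gt0// ?cmod_gt0 ?contour_dir_neq0//.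
by rewrite (le_trans _ (Im_le_cmod _))//= -normrN (le_trans _ (ler_norm _))//; lra.
Unshelve. all: by end_near. Qed.

(** Cauchy's theorem for the half-planes on both sides of [lam], in the form:
    scaling the contour towards or away from [lam] does not change the
    integral, since the derivative in the scaling factor is the integral of a
    derivative along the contour. *)
Lemma cderiv_contour_int sg rho : sg ^+ 2 = 1 -> 0 < rho ->
  p < complex.Re lam + rho * (sg * m) -> cderiv (contour_int sg) rho 0.
Proof.
move=> sg1 r0 pr.
have sgn : `|sg| = 1.
  by apply/eqP; rewrite -sqr_norm_eq1 sg1.
pose e := Num.min (rho / 2) ((complex.Re lam + rho * (sg * m) - p) / m).
have e0 : 0 < e by rewrite lt_min !divr_gt0// subr_gt0.
have near_rho r : `|r - rho| < e -> rho / 2 <= r /\ p <= complex.Re lam + r * (sg * m).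
  rewrite lt_min => /andP[h1 h2]; split.
    by move: h1; rewrite ltr_distl => /andP[h _]; lra.
  have : `|(r - rho) * (sg * m)| <= complex.Re lam + rho * (sg * m) - p.
    rewrite !normrM sgn mul1r (gtr0_norm m0).
    by move: h2; rewrite ltr_pdivlMr// => /ltW.
  by rewrite ler_norml => /andP[h _]; move: h; rewrite mulrBl; lra.
have ps r th : `|r - rho| < e -> 0 < r /\ p <= complex.Re (contour_pt sg r th).
  by move=> /near_rho[h1 h2]; rewrite Re_contour_pt; split => //; lra.
pose B := C1 * L / (m * (rho / 2) ^+ 2).
have C10 : 0 <= C1.
  rewrite /C1 divr_ge0 ?sqr_ge0// addr_ge0// divr_ge0//; last exact: ltW.
  by rewrite addr_ge0// mulr_ge0 ?cmod_ge0// ltW.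
have hB r th : `|r - rho| < e -> cmod (hquot' (contour_pt sg r th)) <= B * poisson m (th - eta).
  move=> re; have [r'0 psr] := ps r th re; have [r2 _] := near_rho r re.
  rewrite (le_trans (hquot'_contour_le sg1 r'0 psr))// ler_wpM2r ?poisson_ge0//.
  have rho2 : 0 < rho / 2 by rewrite divr_gt0.
  have CL : 0 <= C1 * L := mulr_ge0 C10 (ltW L0).
  rewrite /B; apply: (ler_wpM2l CL).
  rewrite lef_pV2 ?posrE ?(mulr_gt0 m0 (exprn_gt0 _ _))//.
  by apply: (ler_wpM2l (ltW m0)); apply: lerXn2r; rewrite ?nnegrE ?(ltW rho2) ?(ltW r'0).
have dN := @cderiv_cintegral R pos (fun r th => contour_sym sg r th)
  (fun r th => hquot' (contour_pt sg r th) + hquot' (contour_pt sg r (- th))) rho e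
  (fun th => B * poisson_sym th) (@mpos R) e0.
have dr r th : `|r - rho| < e -> cderiv (fun r => contour_ker sg r th) r (hquot' (contour_pt sg r th)).
  move=> re; have [r'0 psr] := ps r th re.
  have ds : cderiv (fun r => contour_pt sg r th) r (contour_dir sg th).
    apply: cderiv_eq (cderivD (cderiv_cst lam r)
      (cderivM (cderiv_id r) (cderiv_cst (contour_dir sg th) r))) _.
    by rewrite mulr0 addr0 mul1r add0r.
  apply: cderiv_eq (cderivM (cderiv_hquot ds psr (contour_pt_neq th sg1 r'0))
    (cderiv_cst (contour_dir sg th)^-1 r)) _.
  by rewrite mulr0 addr0 mulfK// contour_dir_neq0.
have rho_e : `|rho - rho| < e by rewrite subrr normr0.
have intB : mu.-integrable pos (EFin \o (fun th => B * poisson_sym th)).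
  by apply: RintegrableZl; [exact: mpos|exact: integrable_poisson_sym].
apply: cderiv_eq (dN _ _ intB _) _.
- by move=> r th re _; apply: cderivD; exact: dr.
- by move=> r /near_rho[h1 h2]; apply: cintegrable_contour_sym => //; lra.
- move=> r th re _; apply: (poisson_sym_le (f := fun th => hquot' (contour_pt sg r th))) => y.
  exact: hB.
have i0 : rho%:C * (0 +i* 1) != 0 :> R[i].
  have i1 : (0 +i* 1 : R[i]) != 0 by apply/eqP => -[] /eqP; rewrite oner_eq0.
  by rewrite mulf_neq0// real_complex_eq0 gt_eqF.
set w := rho%:C * (0 +i* 1) in i0 *.
have hs th : p <= complex.Re (contour_pt sg rho th) by have [] := ps rho th rho_e.
have dh th : cderiv (fun th => hquot (contour_pt sg rho th)) th
    (hquot' (contour_pt sg rho th) * w).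
  exact: cderiv_hquot (cderiv_contour_pt sg rho th) (hs th) (contour_pt_neq th sg1 r0).
(* The derivative of [hquot] along the contour is [w] times [hquot']; hence
   the derivative in [rho] has this primitive, and it vanishes at both ends. *)
rewrite (@cFTC_pos _ (fun th => w^-1 * (hquot (contour_pt sg rho th)
    - hquot (contour_pt sg rho (- th)))) _ 0 0).
- by rewrite subr0.
- move=> th _; apply: cderiv_eq (cderivZ w^-1 (cderivB (dh th) (cderiv_opp (dh (- th))))) _.
  by rewrite opprK -mulrDl mulrCA mulVf ?mulr1.
- move=> th _.
  have [d1 h1] := cderiv_hquot' (cderiv_contour_pt sg rho th) (hs th) (contour_pt_neq th sg1 r0).
  have [d2 h2] := cderiv_hquot' (cderiv_contour_pt sg rho (- th)) (hs _) (contour_pt_neq _ sg1 r0).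
  by eexists; exact: cderivD h1 (cderiv_opp h2).
- apply: (@cintegrable_le _ _ _ (fun th => B * poisson_sym th)) => //.
  + apply: cmeasurable_cderiv => th _.
    have [d1 h1] := cderiv_hquot' (cderiv_contour_pt sg rho th) (hs th) (contour_pt_neq th sg1 r0).
    have [d2 h2] := cderiv_hquot' (cderiv_contour_pt sg rho (- th)) (hs _) (contour_pt_neq _ sg1 r0).
    by eexists; exact: cderivD h1 (cderiv_opp h2).
  + move=> th _; apply: (poisson_sym_le (f := fun th => hquot' (contour_pt sg rho th))) => y.
    exact: hB.
- have h := cderiv_ccvg_right (cderivZ w^-1 (cderivB (dh 0)
    (cderiv_opp (x := 0) (dh (- 0))))).
  by move: h; rewrite /= oppr0 subrr mulr0.
- have hle th : cmod (hquot (contour_pt sg rho th)) <=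
      (c^-1 * (L / rho)) * (cmod (contour_dir sg th))^-1.
    rewrite (le_trans (hquot_le (hs th) (contour_pt_neq th sg1 r0)))//.
    rewrite invfM -mulrA ler_wpM2l ?invr_ge0//; first exact: ltW.
    by rewrite (le_trans (contour_pt_inv sg1 r0 (hs th)))// invfM mulrA.
  have z : ((c^-1 * (L / rho)) * 0 = 0) by rewrite mulr0.
  rewrite -(mulr0 w^-1); apply: ccvgM; first exact: ccvg_cst.
  rewrite -(subr0 0); apply: ccvgB.
  + apply: (ccvg0_le _ (e := fun th => (c^-1 * (L / rho)) * (cmod (contour_dir sg th))^-1)).
      by apply: nearW => th; exact: hle.
    by rewrite -z; apply: cvgM; [exact: cvg_cst|exact: cvg_inv_contour_dir].
  + apply: (ccvg0_le _ (e := fun th => (c^-1 * (L / rho)) * (cmod (contour_dir sg (- th)))^-1)).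
      by apply: nearW => th; exact: hle.
    by rewrite -z; apply: cvgM; [exact: cvg_cst|exact: cvg_inv_contour_dirN].
Qed.

Let two1 : (1 : R) ^+ 2 = 1. Proof. exact: expr1n. Qed.
Let twoN1 : (-1 : R) ^+ 2 = 1. Proof. by rewrite sqrrN expr1n. Qed.

(** The contour on the right of [lam] can be pushed to infinity, where the
    kernel decays. *)
Lemma contour_int_plus0 rho : 0 < rho -> contour_int 1 rho = 0.
Proof.
move=> r0.
have pr r : 0 < r -> p < complex.Re lam + r * (1 * m).
  move=> r'0; rewrite mul1r (lt_le_trans p1)//.
  by rewrite (le_trans (ltW lam1))// lerDl mulr_ge0// ltW.
have cst n : contour_int 1 rho = contour_int 1 (rho + n%:R).
  apply/esym; apply: cderiv0_eq; first by rewrite lerDl.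
  move=> x /andP[rx _]; have x0 : 0 < x by exact: lt_le_trans rx.
  by apply: cderiv_contour_int => //; exact: pr.
pose I := \int[mu]_(th in pos) poisson_sym th.
have bound r : 0 < r -> cmod (contour_int 1 r) <= 2 * (L / (c * m) * I) / r.
  move=> r'0; have prr := ltW (pr r r'0).
  apply: (le_trans (cmod_cintegral_le (g := fun th => L / (c * m * r) * poisson_sym th)
    (@mpos R) (cintegrable_contour_sym two1 r'0 prr) _ _)).
  - by apply: RintegrableZl; [exact: mpos|exact: integrable_poisson_sym].
  - by move=> th _; exact: contour_sym_le.
  - rewrite RintegralZl//; last exact: integrable_poisson_sym.
    by rewrite -/I le_eqVlt; apply/orP; left; apply/eqP; field; rewrite !gt_eqF.
have h0 : ccvg \oo (fun n : nat => contour_int 1 rho) 0.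
  apply: (ccvg0_le _ (e := fun n : nat => 2 * (L / (c * m) * I) * (rho + n%:R)^-1)).
    by apply: nearW => n; rewrite (cst n) bound// ltr_wpDr.
  rewrite -(mulr0 (2 * (L / (c * m) * I))); apply: cvgM; first exact: cvg_cst.
  apply/gtr0_cvgV0; first by apply: nearW => n; rewrite ltr_wpDr.
  apply/cvgryPge => M; near=> n; rewrite (@le_trans _ _ n%:R)//.
    by near: n; exact: nbhs_infty_ger.
  by rewrite lerDr ltW.
exact: ccvg_unique (ccvg_cst (contour_int 1 rho)) h0.
Unshelve. all: by end_near. Qed.

Let v := vmap lam.

Lemma contour_pt_line1 th : contour_pt (-1) 1 th = line1 th.
Proof.
by apply: complexP; rewrite /contour_pt !ReIm /= /m /eta; ring.
Qed.

Lemma contour_ker_qker th : contour_ker (-1) 1 th = - qker v th.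
Proof.
have ps : p <= complex.Re (line1 th) by exact: ltW.
have sl : line1 th != lam.
  by apply: contraTneq lam1 => <-; rewrite ltxx.
have w0 : contour_dir (-1) th != 0 by exact: contour_dir_neq0.
rewrite /contour_ker contour_pt_line1 /hquot /qker.
have -> : lam - line1 th = - contour_dir (-1) th.
  by apply: complexP; rewrite !ReIm /= /m /eta; ring.
have s0 : line1 th != 0 by rewrite -cmod_gt0 ps_gt0.
have d0 : D (line1 th) != 0 by rewrite -cmod_gt0 D0.
move: d0; rewrite /D -/v; move: (v - _) => d d0.
by field; rewrite s0 d0 w0.
Qed.

(** At scale [1] the contour on the left of [lam] is the line [Re s = 1]. *)
Lemma contour_int_minus rho : 0 < rho <= 1 ->
  contour_int (-1) rho = - cintegral pos (fun th => qker v th + qker v (- th)).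
Proof.
move=> /andP[r0 r1].
have pr r : r <= 1 -> p < complex.Re lam + r * (-1 * m).
  move=> r'1; rewrite (lt_le_trans p1)// mulN1r mulrN lerBrDr.
  have : r * m <= m by rewrite ger_pMl.
  by rewrite /m; lra.
have -> : contour_int (-1) rho = contour_int (-1) 1.
  apply/esym; apply: cderiv0_eq => // x /andP[rx x1].
  by apply: cderiv_contour_int; rewrite ?pr// (lt_le_trans r0).
have i1 := cintegrable_contour_sym twoN1 ltr01 (ltW (pr 1 (lexx 1))).
rewrite /contour_int -[LHS]opprK -(cintegralN (@mpos R) i1); congr (- _).
apply: eq_cintegral => th _.
by rewrite /contour_sym !contour_ker_qker opprD !opprK.
Qed.

(** The difference quotients of [vmap] at [lam] are compared through the Lipschitz
    bound for the logarithm, which costs a factor [|lam - s1|^-1]. *)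
Lemma hquot_diff_le s1 s2 : p <= complex.Re s1 -> p <= complex.Re s2 ->
  s1 != lam -> s2 != lam ->
  cmod (hquot s1 - hquot s2) <=
  cmod (s1 - s2) * (2 / p + K * L) / (c ^+ 2 * p * cmod (lam - s1)).
Proof.
move=> ps1 ps2 n1 n2.
have d1 := D0 ps1 n1; have d2 := D0 ps2 n2.
have z1 := ps_gt0 ps1; have z2 := ps_gt0 ps2.
have b1 : 0 < cmod (lam - s1) by rewrite cmod_gt0 subr_eq0 eq_sym.
have b2 : 0 < cmod (lam - s2) by rewrite cmod_gt0 subr_eq0 eq_sym.
have l1 : lam - s1 != 0 by rewrite -cmod_gt0.
have l2 : lam - s2 != 0 by rewrite -cmod_gt0.
pose k s := D s / (lam - s).
have kc s : p <= complex.Re s -> s != lam -> c <= cmod (k s).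
  move=> ps sl; have b : 0 < cmod (lam - s) by rewrite cmod_gt0 subr_eq0 eq_sym.
  by rewrite /k cmodM cmodV ler_pdivlMr// lower.
have kK s : p <= complex.Re s -> s != lam -> cmod (k s) <= K.
  move=> ps sl; have b : 0 < cmod (lam - s) by rewrite cmod_gt0 subr_eq0 eq_sym.
  by rewrite /k cmodM cmodV ler_pdivrMr// upper.
have k1c := kc _ ps1 n1; have k2c := kc _ ps2 n2.
have k1K := kK _ ps1 n1.
have k10 : 0 < cmod (k s1) by exact: lt_le_trans k1c.
have k20 : 0 < cmod (k s2) by exact: lt_le_trans k2c.
have E : hquot s1 - hquot s2 =
    (s2 * (k s2 - k s1) + (s2 - s1) * k s1) / (s1 * k s1 * (s2 * k s2)).
  have s10 : s1 != 0 by rewrite -cmod_gt0.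
  have s20 : s2 != 0 by rewrite -cmod_gt0.
  have d10 : D s1 != 0 by rewrite -cmod_gt0.
  have d20 : D s2 != 0 by rewrite -cmod_gt0.
  move: d10 d20; rewrite /hquot /k; move: (D s1) (D s2) => e1 e2 e10 e20.
  by field; rewrite s10 s20 e10 e20 l1 l2.
have Ek : k s2 - k s1 = (- (clog s1 - clog s2)) / (lam - s1)
    + (clog lam - clog s2) * (s1 - s2) / ((lam - s1) * (lam - s2)).
  by rewrite /k /D /vmap; field; rewrite l1 l2.
set x := cmod (s1 - s2).
have hk : cmod (k s2 - k s1) <= 2 / p * x / cmod (lam - s1).
  rewrite Ek (le_trans (le_cmodD _ _))// !cmodM !cmodV cmodN cmodM invfM.
  have -> : 2 / p * x / cmod (lam - s1) =
      p^-1 * x / cmod (lam - s1) + p^-1 * x / cmod (lam - s1) by ring.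
  apply: lerD.
    by rewrite ler_wpM2r ?invr_ge0 ?cmod_ge0//; exact: clog_lipschitz.
  rewrite -/x (mulrC (cmod (lam - s1))^-1) mulrA ler_wpM2r ?invr_ge0 ?cmod_ge0//.
  rewrite mulrAC ler_wpM2r ?cmod_ge0// ler_pdivrMr//.
  exact: clog_lipschitz.
have z1p := ps_cmod ps1.
have hL : x <= x * L * cmod s1 / cmod (lam - s1).
  rewrite ler_pdivlMr// -mulrA ler_wpM2l ?cmod_ge0//; exact: dist_le.
have hz : (cmod s1)^-1 <= L / cmod (lam - s1).
  by rewrite ler_pdivlMr// mulrC ler_pdivrMr// dist_le.
rewrite E cmodM cmodV (cmodM (s1 * _)) (cmodM s1) (cmodM s2 (k s2)).
have x0 : 0 <= x by exact: cmod_ge0.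
have num : cmod (s2 * (k s2 - k s1) + (s2 - s1) * k s1) <=
    cmod s2 * (2 / p * x / cmod (lam - s1)) + x * K.
  rewrite (le_trans (le_cmodD _ _))// (cmodM s2) (cmodM (s2 - s1)) (cmodB s2); apply: lerD.
    by rewrite ler_wpM2l ?cmod_ge0.
  by rewrite ler_wpM2l.
rewrite ler_pdivrMr ?mulr_gt0// (le_trans num)//.
have den : c ^+ 2 * (cmod s1 * cmod s2) <=
    cmod s1 * cmod (k s1) * (cmod s2 * cmod (k s2)).
  have -> : cmod s1 * cmod (k s1) * (cmod s2 * cmod (k s2)) =
      (cmod (k s1) * cmod (k s2)) * (cmod s1 * cmod s2) by ring.
  rewrite ler_wpM2r ?mulr_ge0 ?cmod_ge0// expr2.
  by apply: ler_pM => //; exact: ltW.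
set T := x * (2 / p + K * L) / (c ^+ 2 * p * cmod (lam - s1)).
have T0 : 0 <= T.
  apply: divr_ge0.
    apply: mulr_ge0 => //; apply: addr_ge0; first by rewrite divr_ge0// ltW.
    exact: mulr_ge0 (ltW K0) (ltW L0).
  apply: mulr_ge0; last exact: cmod_ge0.
  by apply: mulr_ge0; [exact: sqr_ge0|exact: ltW].
rewrite (le_trans _ (ler_wpM2l T0 den))//.
have -> : T * (c ^+ 2 * (cmod s1 * cmod s2)) =
    (cmod s1 / p) * (cmod s2 * (2 / p * x / cmod (lam - s1)))
    + (cmod s2 / p) * (x * L * cmod s1 / cmod (lam - s1) * K).
  by rewrite /T; field; rewrite !gt_eqF.
have q1 : 1 <= cmod s1 / p by rewrite ler_pdivlMr// mul1r.
have q2 : 1 <= cmod s2 / p by rewrite ler_pdivlMr// mul1r; exact: ps_cmod.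
apply: lerD.
  rewrite ler_peMl// mulr_ge0 ?cmod_ge0// divr_ge0 ?cmod_ge0// mulr_ge0//.
  by rewrite divr_ge0// ltW.
apply: (@le_trans _ _ (x * L * cmod s1 / cmod (lam - s1) * K)).
  by rewrite ler_wpM2r// ltW.
rewrite ler_peMl// mulr_ge0//; last exact: ltW.
by rewrite divr_ge0 ?cmod_ge0// mulr_ge0 ?cmod_ge0// mulr_ge0// ltW.
Qed.

Let inv_contour_dirB th : (contour_dir 1 th)^-1 - (contour_dir (-1) th)^-1 = (2 * poisson m (th - eta))%:C.
Proof.
have w1 : contour_dir 1 th != 0 by exact: contour_dir_neq0.
have w2 : contour_dir (-1) th != 0 by exact: contour_dir_neq0.
have e : contour_dir 1 th * contour_dir (-1) th = - (m ^+ 2 + (th - eta) ^+ 2)%:C.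
  by apply: complexP; rewrite !ReIm /= ?mul1r ?mulN1r; ring.
have d0 : m ^+ 2 + (th - eta) ^+ 2 != 0.
  by rewrite gt_eqF// ltr_pwDl ?sqr_ge0// exprn_gt0.
have -> : (contour_dir 1 th)^-1 - (contour_dir (-1) th)^-1 =
    (contour_dir (-1) th - contour_dir 1 th) / (contour_dir 1 th * contour_dir (-1) th).
  by field; rewrite w1 w2.
have -> : contour_dir (-1) th - contour_dir 1 th = (- (2 * m))%:C.
  by apply: complexP; rewrite !ReIm /=; ring.
rewrite e -rmorphN -real_complexV -real_complexM; congr (_%:C).
by rewrite /poisson invrN mulrNN mulrA.
Qed.

Let B1 := 2 * m / (c * p) + 2 * m * (2 / p + K * L) / (c ^+ 2 * p).

Let ps_plus rho th : 0 < rho -> p <= complex.Re (contour_pt 1 rho th).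
Proof.
by move=> r0; rewrite Re_contour_pt (le_trans plam)// lerDl mul1r mulr_ge0// ltW.
Qed.

Let ps_minus rho th : 0 < rho <= 1 -> p <= complex.Re (contour_pt (-1) rho th).
Proof.
move=> /andP[r0 r1]; rewrite Re_contour_pt (le_trans (ltW p1))// mulN1r mulrN lerBrDr.
have : rho * m <= m by rewrite ger_pMl.
by rewrite /m; lra.
Qed.

(** The difference of the two values of [1 / w] is a Poisson kernel, and the
    difference of the two values of [hquot] has a factor [rho] that compensates
    the pole: hence a bound that is uniform in [rho]. *)
Lemma contour_ker_diff_le rho th : 0 < rho <= 1 ->
  cmod (contour_ker 1 rho th - contour_ker (-1) rho th) <= B1 / m * poisson m (th - eta).
Proof.
move=> r01; have /andP[r0 r1] := r01.
have ps1 := ps_plus th r0; have ps2 := ps_minus th r01.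
have n1 : contour_pt 1 rho th != lam by exact: contour_pt_neq.
have n2 : contour_pt (-1) rho th != lam by exact: contour_pt_neq.
have w1 : 0 < cmod (contour_dir 1 th) by rewrite cmod_gt0 contour_dir_neq0.
have -> : contour_ker 1 rho th - contour_ker (-1) rho th =
    hquot (contour_pt (-1) rho th) * ((contour_dir 1 th)^-1 - (contour_dir (-1) th)^-1)
    + (hquot (contour_pt 1 rho th) - hquot (contour_pt (-1) rho th)) / contour_dir 1 th.
  by rewrite /contour_ker; ring.
have P0 : 0 <= poisson m (th - eta) by exact: poisson_ge0.
have P20 : 0 <= 2 * poisson m (th - eta) by exact: mulr_ge0.
rewrite (le_trans (le_cmodD _ _))// (cmodM (hquot (contour_pt (-1) rho th))).
rewrite (cmodM (hquot (contour_pt 1 rho th) - _)) cmodV inv_contour_dirB cmod_real (ger0_norm P20).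
have hq : cmod (hquot (contour_pt (-1) rho th)) <= (c * p)^-1.
  rewrite (le_trans (hquot_le ps2 n2))// lef_pV2 ?posrE ?mulr_gt0 ?ps_gt0//.
  by rewrite ler_wpM2l ?ps_cmod// ltW.
have ss : cmod (contour_pt 1 rho th - contour_pt (-1) rho th) = 2 * m * rho.
  have -> : contour_pt 1 rho th - contour_pt (-1) rho th = (2 * m * rho)%:C.
    by apply: complexP; rewrite /contour_pt !ReIm /=; ring.
  by rewrite cmod_real ger0_norm// !mulr_ge0// ltW.
have hd := hquot_diff_le ps1 ps2 n1 n2.
rewrite ss cmod_contour_pt// in hd.
have t1 : cmod (hquot (contour_pt (-1) rho th)) * (2 * poisson m (th - eta)) <=
    2 * m / (c * p) / m * poisson m (th - eta).
  rewrite (le_trans (ler_wpM2r P20 hq))//.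
  by rewrite le_eqVlt; apply/orP; left; apply/eqP; field; rewrite !gt_eqF.
have t2 : cmod (hquot (contour_pt 1 rho th) - hquot (contour_pt (-1) rho th))
    / cmod (contour_dir 1 th) <=
    2 * m * (2 / p + K * L) / (c ^+ 2 * p) / m * poisson m (th - eta).
  rewrite (le_trans (ler_wpM2r _ hd)) ?invr_ge0 ?cmod_ge0//.
  have -> : 2 * m * (2 / p + K * L) / (c ^+ 2 * p) / m * poisson m (th - eta) =
    2 * m * (2 / p + K * L) / (c ^+ 2 * p) * (m^-1 * poisson m (th - eta)) by ring.
  rewrite -(contour_dir_poisson th two1) le_eqVlt; apply/orP; left; apply/eqP.
  by field; rewrite !gt_eqF.
by rewrite (le_trans (lerD t1 t2))// -mulrDl -mulrDl.
Qed.

(** At its removable singularity [lam] the kernel [hquot] takes the value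
    [1 / (lam v'(lam)) = 1 / (lam - 1)]. *)
Lemma contour_ker_cvg sg th : sg ^+ 2 = 1 ->
  ccvg \oo (fun n => contour_ker sg (n.+1%:R^-1) th) ((lam - 1)^-1 / contour_dir sg th).
Proof.
move=> sg1; set w := contour_dir sg th; have w0 : w != 0 by exact: contour_dir_neq0.
pose u n : R := n.+1%:R^-1.
have u0 n : u n != 0 by rewrite invr_eq0 pnatr_eq0.
have ucvg : u n @[n --> \oo] --> 0 by exact: cvg_harmonic.
have l0 : lam != 0 by exact: slit_neq0 (ps_slit plam).
have l1 : lam - 1 != 0.
  rewrite subr_eq0; apply: contraTneq lam1 => ->.
  by rewrite ltxx.
pose f r := vmap (lam + r%:C * w).
have ds r : cderiv (fun r => lam + r%:C * w) r w.
  apply: cderiv_eq (cderivD (cderiv_cst lam r)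
    (cderivM (cderiv_id r) (cderiv_cst w r))) _.
  by rewrite mulr0 addr0 mul1r add0r.
have e0 : lam + 0%:C * w = lam by rewrite mul0r addr0.
have df : cderiv f 0 (w - w / lam).
  by have := cderiv_vmap (ds 0); rewrite e0; apply; exact: ps_slit plam.
have q := cderiv_quotient df u0 ucvg.
have q2 : ccvg \oo (fun n => lam + (u n)%:C * w) lam.
  rewrite -[X in ccvg _ _ X]e0; apply: ccvgD; first exact: ccvg_cst.
  by apply: ccvgM; [exact: ccvg_real|exact: ccvg_cst].
have d0 : w - w / lam != 0.
  have -> : w - w / lam = w * (lam - 1) / lam by field.
  by rewrite !mulf_neq0 ?invr_neq0.
have lim := ccvgM (ccvgM (ccvg_cst w) (ccvgV (ccvgM q2 q) (mulf_neq0 l0 d0)))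
  (ccvg_cst w^-1).
have -> : (lam - 1)^-1 / w = w * (lam * (w - w / lam))^-1 / w.
  have -> : lam * (w - w / lam) = w * (lam - 1) by field.
  by rewrite invfM mulVKf.
have E n : contour_ker sg (u n) th = w *
    ((lam + (u n)%:C * w) * ((f (0 + u n) - f 0) * ((u n)^-1)%:C))^-1 / w.
  rewrite /contour_ker -/w; congr (_ / w).
  have un : (u n)%:C != 0 :> R[i] by rewrite real_complex_eq0.
  have up : 0 < u n by rewrite invr_gt0.
  rewrite /hquot /contour_pt -/w add0r.
  have -> : f 0 = vmap lam by rewrite /f e0.
  rewrite -/(f (u n)); set s := lam + _ * w.
  have -> : D s = - (f (u n) - vmap lam) by rewrite /f -/s opprB.
  have -> : lam - s = - ((u n)%:C * w) by rewrite /s opprD addrA subrr add0r.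
  rewrite real_complexV mulrN invrN mulrNN !invfM invrK.
  by ring.
rewrite (funext E); exact: lim.
Qed.

(** The contour on the right contributes [0] and the one on the left the line
    integral.  When both close in on [lam], the difference of their integrals
    tends to [1 / (lam - 1)] times the mass of the Poisson kernels. *)
Lemma line_integral : cintegral pos (fun th => qker v th + qker v (- th)) =
  (2 * pi)%:C / (lam - 1).
Proof.
pose u n : R := n.+1%:R^-1.
have u0 n : 0 < u n by rewrite invr_gt0.
have u01 n : 0 < u n <= 1 by rewrite u0 invf_le1 ?ler1n.
pose F n th := contour_sym 1 (u n) th - contour_sym (-1) (u n) th.
have pr1 n : p <= complex.Re lam + u n * (1 * m).
  by have := @ps_plus (u n) 0 (u0 n); rewrite Re_contour_pt.
have pr2 n : p <= complex.Re lam + u n * (-1 * m).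
  by have := @ps_minus (u n) 0 (u01 n); rewrite Re_contour_pt.
have i1 n := cintegrable_contour_sym two1 (u0 n) (pr1 n).
have i2 n := cintegrable_contour_sym twoN1 (u0 n) (pr2 n).
have FE n : cintegral pos (F n) = cintegral pos (fun th => qker v th + qker v (- th)).
  rewrite /F (cintegralB (@mpos R) (i1 n) (i2 n)) -!/(contour_int _ _) contour_int_plus0//.
  by rewrite contour_int_minus// sub0r opprK.
have mF n : cmeasurable pos (F n).
  exact: cmeasurableB (cintegrable_measurable (i1 n)) (cintegrable_measurable (i2 n)).
have lF th : pos th -> ccvg \oo (F ^~ th) ((lam - 1)^-1 * (2 * poisson_sym th)%:C).
  move=> _.
  have -> : (lam - 1)^-1 * (2 * poisson_sym th)%:C =
    ((lam - 1)^-1 / contour_dir 1 th + (lam - 1)^-1 / contour_dir 1 (- th)) -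
    ((lam - 1)^-1 / contour_dir (-1) th + (lam - 1)^-1 / contour_dir (-1) (- th)).
    rewrite opprD addrACA -!mulrBr !inv_contour_dirB -mulrDr -real_complexD poisson_opp.
    by rewrite -mulrDr.
  by apply: ccvgB; apply: ccvgD; exact: contour_ker_cvg.
have bF n th : pos th -> cmod (F n th) <= B1 / m * poisson_sym th.
  move=> _; have -> : F n th = (contour_ker 1 (u n) th - contour_ker (-1) (u n) th)
      + (contour_ker 1 (u n) (- th) - contour_ker (-1) (u n) (- th)).
    by rewrite /F /contour_sym; ring.
  by apply: (poisson_sym_le (f := fun th => contour_ker 1 (u n) th - contour_ker (-1) (u n) th)) => y;
    exact: contour_ker_diff_le.
have [_ lim] := cdominated_cvg (@mpos R) mF lF
  (RintegrableZl (B1 / m) (@mpos R) integrable_poisson_sym) bF.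
rewrite (funext FE) in lim.
rewrite (ccvg_unique (ccvg_cst _) lim).
have ir : cintegrable pos (fun th => (2 * poisson_sym th)%:C).
  apply: cintegrable_real; first exact: mpos.
  by apply: RintegrableZl; [exact: mpos|exact: integrable_poisson_sym].
rewrite (cintegralZ _ (@mpos R) ir) cintegral_real mulrC; congr (_%:C / _).
rewrite RintegralZl//; last exact: integrable_poisson_sym.
rewrite /poisson_sym RintegralD//; try exact: integrable_poisson.
rewrite !Rintegral_poisson// mulNr atanN; congr (_ * _).
by field.
Qed.

Lemma qker_le : exists C, forall th, cmod (qker v th) <= C * poisson 1 th.
Proof.
exists (c^-1 * (1 + cmod lam / m)) => th.
have ps : p <= complex.Re (line1 th) by exact: ltW.
have sl : line1 th != lam.
  by apply: contraTneq lam1 => <-; rewrite ltxx.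
have b0 : 0 < cmod (lam - line1 th) by rewrite cmod_gt0 subr_eq0 eq_sym.
have s0 := ps_gt0 ps.
have bm : m <= cmod (lam - line1 th).
  by rewrite (le_trans _ (Re_le_cmod _))// (le_trans _ (ler_norm _))// !ReIm /=.
have -> : qker v th = hquot (line1 th) / (lam - line1 th).
  have l0 : lam - line1 th != 0 by rewrite -cmod_gt0.
  by rewrite /qker /hquot mulrAC divff// mul1r.
rewrite cmodM cmodV.
have h1 := hquot_le ps sl.
have h2 : (cmod (lam - line1 th))^-1 <= (1 + cmod lam / m) / cmod (line1 th).
  rewrite ler_pdivlMr// mulrC ler_pdivrMr// mulrDl mul1r.
  have : cmod (line1 th) <= cmod (lam - line1 th) + cmod lam.
    rewrite -cmodN -[X in cmod X](_ : (lam - line1 th) - lam = _); last by ring.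
    by rewrite (le_trans (le_cmodD _ _))// cmodN.
  have : cmod lam <= cmod lam / m * cmod (lam - line1 th).
    by rewrite mulrAC ler_pdivlMr// ler_wpM2l ?cmod_ge0.
  lra.
have -> : poisson 1 th = (cmod (line1 th))^-1 * (cmod (line1 th))^-1.
  by rewrite -invfM -expr2 cmod_sqr /poisson /= mul1r.
rewrite (le_trans (ler_pM (cmod_ge0 _) _ h1 h2)) ?invr_ge0 ?cmod_ge0//.
by rewrite le_eqVlt; apply/orP; left; apply/eqP; field; rewrite !gt_eqF.
Qed.

Lemma laplace_phi_residue : 1 < complex.Re v ->
  cintegral pos (fun t => cexp (- (v * t%:C)) * (phi t)%:C) = (lam - 1)^-1.
Proof.
move=> v1; have [C hC] := qker_le.
have := laplace_phi v1 hC; rewrite line_integral.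
have pi0 : (pi : R)%:C != 0 :> R[i] by rewrite real_complex_eq0 gt_eqF// pi_gt0.
have two0 : (2 : R[i]) != 0 by rewrite pnatr_eq0.
have -> : (2 * pi : R)%:C = 2 * (pi : R)%:C :> R[i].
  by rewrite real_complexM; congr (_ * _); rewrite -(rmorph_nat (real_complex R) 2).
rewrite -(mulrA 2) (mulKf two0).
by move=> /(mulfI pi0).
Qed.

End residue.

(** The Laplace transform of [t^t / Gamma(t + 1)], by [laplace_phi] and
    [line_integral] for the constants of [vmap_lower]. *)
Lemma laplace_phiE (R : realType) (z : R[i]) : 1 < complex.Re z ->
  1 < complex.Re (vmap z) ->
  cintegral (`]0, +oo[%classic : set R)
    (fun t => cexp (- (vmap z * t%:C)) * (phi t)%:C) = (z - 1)^-1.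
Proof.
move=> z1 v1; have [p [c [p0 p1 c0 lower]]] := vmap_lower z1.
exact: laplace_phi_residue z1 p0 p1 c0 lower v1.
Qed.

(** * The incomplete gamma function *)

Section growth.
Variable R : realType.
Implicit Types (a q z A B : R[i]) (r s d e : R).

Lemma cmod_clog_le z : slit z -> cmod (clog z) <= `|ln (cmod z)| + pi.
Proof.
move=> sz; rewrite (le_trans (cmod_le _))//= lerD2l ltW//.
exact: carg_bound.
Qed.

(** The logarithm grows more slowly than any linear function, uniformly on the
    half-lines that start at the points of a line. *)
Lemma clog_growth q A B d e : 0 < d -> 0 < e ->
  exists C, forall r s, 0 <= s -> slit (A + r%:C * B + s%:C) ->
  d <= cmod (A + r%:C * B + s%:C) ->
  complex.Re (q * clog (A + r%:C * B + s%:C)) <= e * (`|r| + s) + C.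
Proof.
move=> d0 e0.
pose Q := cmod q; have Q0 : 0 <= Q by exact: cmod_ge0.
have k0 : 0 < e / (Q + 1) by rewrite divr_gt0// ltr_wpDl.
have [C hC] := ln_le_lin k0.
pose E := cmod A + cmod B + 1.
have E0 : 0 < E by rewrite ltr_wpDl// addr_ge0 ?cmod_ge0.
pose T := `|ln E| + e / (Q + 1) + `|C| + `|ln d| + pi.
exists (Q * T) => r s s0 sl dz; set z := A + _ + _ in sl dz *.
have z0 : 0 < cmod z by exact: lt_le_trans dz.
have zE : cmod z <= E * (1 + (`|r| + s)).
  rewrite (le_trans (le_cmodD _ _))// (le_trans (lerD (le_cmodD _ _) (lexx _)))//.
  rewrite cmodM !cmod_real (ger0_norm s0) /E.
  have a0 := cmod_ge0 A; have b0 := cmod_ge0 B; have r0 := normr_ge0 r.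
  have h1 : 0 <= cmod A * (`|r| + s) by rewrite mulr_ge0 ?addr_ge0.
  have h2 : 0 <= cmod B * s by rewrite mulr_ge0.
  by rewrite mulrDr; lra.
have one0 : 0 < 1 + (`|r| + s) by rewrite ltr_pwDl// addr_ge0.
have up : ln (cmod z) <= ln E + (e / (Q + 1) * (1 + (`|r| + s)) + C).
  rewrite (@le_trans _ _ (ln (E * (1 + (`|r| + s)))))//.
    by rewrite ler_ln ?posrE// mulr_gt0.
  by rewrite lnM ?posrE// lerD2l hC.
have lo : - ln (cmod z) <= - ln d by rewrite lerN2 ler_ln ?posrE.
have nl : `|ln (cmod z)| <= `|ln E| + (e / (Q + 1) * (1 + (`|r| + s)) + `|C|) + `|ln d|.
  have h1 := ler_norm (ln E); have h2 := ler_norm C.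
  have h3 := normr_ge0 (ln d); have h4 := ler_norm (- ln d).
  rewrite normrN in h4; have h5 := normr_ge0 (ln E); have h6 := normr_ge0 C.
  have h7 : 0 <= e / (Q + 1) * (1 + (`|r| + s)) by rewrite mulr_ge0// ltW.
  by rewrite ler_norml; apply/andP; split; lra.
rewrite (le_trans (ler_norm _))// (le_trans (Re_le_cmod _))// cmodM -/Q.
rewrite (le_trans (ler_wpM2l Q0 (cmod_clog_le sl)))//.
have h : Q * (`|ln (cmod z)| + pi) <= Q * (e / (Q + 1) * (`|r| + s) + T).
  by rewrite ler_wpM2l// /T; lra.
rewrite (le_trans h)// mulrDr lerD2r mulrA ler_wpM2r ?addr_ge0//.
by rewrite mulrA ler_pdivrMr ?ltr_wpDl// mulrC ler_wpM2l ?lerDl// ltW.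
Qed.

(** Shifts to the right preserve the imaginary part and increase the real part,
    and one of the two keeps the point away from the cut. *)
Lemma slit_near z : slit z -> exists2 d, 0 < d & forall w s, cmod (w - z) < d ->
  0 <= s -> slit (w + s%:C) /\ d <= cmod (w + s%:C).
Proof.
rewrite /slit => /orP[y0|x0].
- exists (`|complex.Im z| / 2); first by rewrite divr_gt0// normr_gt0.
  move=> w s wz s0.
  have h : `|complex.Im w - complex.Im z| < `|complex.Im z| / 2.
    by rewrite (le_lt_trans _ wz)// (le_trans _ (Im_le_cmod _))// !ReIm.
  have h2 : `|complex.Im z| / 2 <= `|complex.Im w|.
    have := ler_normB (complex.Im w) (complex.Im w - complex.Im z).
    by rewrite opprB addrC subrK; lra.
  have hI : complex.Im (w + s%:C) = complex.Im w by rewrite ImD /= addr0.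
  split; last by rewrite (le_trans h2)// -hI Im_le_cmod.
  by rewrite hI -normr_gt0 (lt_le_trans _ h2)// divr_gt0// normr_gt0.
- exists (complex.Re z / 2); first by rewrite divr_gt0.
  move=> w s wz s0.
  have h : `|complex.Re w - complex.Re z| < complex.Re z / 2.
    by rewrite (le_lt_trans _ wz)// (le_trans _ (Re_le_cmod _))// !ReIm.
  have h2 : complex.Re z / 2 <= complex.Re (w + s%:C).
    by move: h; rewrite ReD /= ltr_norml => /andP[h _]; lra.
  split; last by rewrite (le_trans h2)// (le_trans (ler_norm _))// Re_le_cmod.
  by apply/orP; right; rewrite (lt_le_trans _ h2)// divr_gt0.
Qed.

End growth.

Section incomplete.
Variable R : realType.
Notation mu := (lmeas R).
Notation pos := (`]0%R, +oo[%classic : set R).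
Implicit Types (a z A B : R[i]) (r s : R).

Definition gamma_integrand a z : R[i] := cexp ((a - 1) * clog z - z).

Lemma incomplete_gammaE a z :
  incomplete_gamma a z = cintegral pos (fun s => gamma_integrand a (z + s%:C)).
Proof.
by rewrite /incomplete_gamma; congr cintegral; apply/funext => s; rewrite /cpow -cexpD.
Qed.

Lemma cderiv_gamma_integrand a (f : R -> R[i]) x d : cderiv f x d -> slit (f x) ->
  cderiv (fun r => gamma_integrand a (f r)) x (d * (((a - 1) / f x - 1) * gamma_integrand a (f x))).
Proof.
move=> df sf.
apply: cderiv_eq (cderiv_cexp (cderivB (cderivZ (a - 1) (cderiv_clog df sf)) df)) _.
by rewrite /gamma_integrand; ring.
Qed.

Lemma cderiv_line A B r : cderiv (fun r => A + r%:C * B) r B.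
Proof.
apply: cderiv_eq (cderivD (cderiv_cst A r)
  (cderivM (cderiv_id r) (cderiv_cst B r))) _.
by rewrite mulr0 addr0 mul1r add0r.
Qed.

Lemma cderiv_shift z r : cderiv (fun r => z + r%:C) r 1.
Proof.
apply: cderiv_eq (cderivD (cderiv_cst z r) (cderiv_id r)) _.
by rewrite add0r.
Qed.

Lemma gamma_integrand_le a A B d e : 0 < d -> 0 < e -> exists2 M, 0 < M & forall r s, 0 <= s ->
  slit (A + r%:C * B + s%:C) -> d <= cmod (A + r%:C * B + s%:C) ->
  cmod (gamma_integrand a (A + r%:C * B + s%:C)) <=
  M * expR (e * `|r| - r * complex.Re B) * expR (- (1 - e) * s).
Proof.
move=> d0 e0; have [C hC] := clog_growth (a - 1) A B d0 e0.
exists (expR (C - complex.Re A)); first exact: expR_gt0.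
move=> r s s0 sl dz; rewrite /gamma_integrand cmod_cexp -2!expRD ler_expR.
have := hC r s s0 sl dz; rewrite ReD ReN.
have -> : complex.Re (A + r%:C * B + s%:C) = complex.Re A + r * complex.Re B + s.
  by rewrite !ReD Re_realM.
lra.
Qed.

(** Differentiating the integrand in its starting point is, up to the factor
    [B], differentiating it along the path of integration, so that the integral
    of the derivative is a boundary term. *)
Lemma cderiv_incomplete_gamma a A B r0 : slit (A + r0%:C * B) ->
  cderiv (fun r => incomplete_gamma a (A + r%:C * B)) r0
    (- B * gamma_integrand a (A + r0%:C * B)).
Proof.
move=> sl; have [d d0 hd] := slit_near sl.
have half0 : 0 < 2^-1 :> R by rewrite invr_gt0.
have [M M0 hM] := gamma_integrand_le a A B d0 half0.
pose e := Num.min 1 (d / (cmod B + 1)).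
have B1 : 0 < cmod B + 1 by rewrite ltr_wpDl ?cmod_ge0.
have e0 : 0 < e by rewrite lt_min ltr01 divr_gt0.
have near_r r s : `|r - r0| < e -> 0 <= s ->
    slit (A + r%:C * B + s%:C) /\ d <= cmod (A + r%:C * B + s%:C).
  rewrite lt_min => /andP[_ h]; apply: hd.
  have -> : A + r%:C * B - (A + r0%:C * B) = (r - r0)%:C * B.
    by rewrite rmorphB; ring.
  rewrite cmodM cmod_real; move: h; rewrite ltr_pdivlMr//; apply: le_lt_trans.
  by rewrite ler_wpM2l// lerDl.
pose V := (cmod (a - 1) / d + 1).
pose P := M * expR (2^-1 * (`|r0| + 1) + (`|r0| + 1) * cmod B).
have P0 : 0 <= P by rewrite mulr_ge0 ?expR_ge0// ltW.
have gP r s : `|r - r0| < e -> 0 <= s ->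
    cmod (gamma_integrand a (A + r%:C * B + s%:C)) <= P * expR (- 2^-1 * s).
  move=> re s0; have [sl' dz] := near_r r s re s0.
  have r1 : `|r| <= `|r0| + 1.
    have : `|r - r0| < 1 by move: re; rewrite lt_min => /andP[].
    have := ler_normD (r - r0) r0; rewrite subrK; lra.
  rewrite (le_trans (hM r s s0 sl' dz))//.
  have -> : - (1 - 2^-1) = - 2^-1 :> R by lra.
  rewrite ler_wpM2r ?expR_ge0// /P ler_wpM2l ?(ltW M0)// ler_expR.
  apply: lerD; first by rewrite ler_wpM2l// ltW.
  rewrite (le_trans (ler_norm _))// normrN normrM; apply: ler_pM => //.
  exact: Re_le_cmod.
have V0 : 0 <= V by rewrite addr_ge0// divr_ge0 ?cmod_ge0// ltW.
have g'P r s : `|r - r0| < e -> 0 <= s ->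
    cmod (((a - 1) / (A + r%:C * B + s%:C) - 1) * gamma_integrand a (A + r%:C * B + s%:C))
    <= V * P * expR (- 2^-1 * s).
  move=> re s0; have [sl' dz] := near_r r s re s0.
  rewrite (cmodM (_ - 1)) -mulrA; apply: ler_pM; rewrite ?cmod_ge0//.
    rewrite (le_trans (le_cmodD _ _))// cmodN cmod1 lerD2r cmodM cmodV.
    by rewrite ler_wpM2l ?cmod_ge0// lef_pV2 ?posrE// (lt_le_trans d0).
  exact: gP.
have iE C : mu.-integrable pos (EFin \o (fun s => C * expR (- 2^-1 * s))).
  by apply: RintegrableZl; [exact: mpos|exact: integrable_expRN].
have ds r s : `|r - r0| < e -> 0 < s -> cderiv (fun s => gamma_integrand a (A + r%:C * B + s%:C)) s
    (((a - 1) / (A + r%:C * B + s%:C) - 1) * gamma_integrand a (A + r%:C * B + s%:C)).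
  move=> re s0; have [sl' _] := near_r r s re (ltW s0).
  by apply: cderiv_eq (cderiv_gamma_integrand a (cderiv_shift _ s) sl') _; rewrite mul1r.
have r0e : `|r0 - r0| < e by rewrite subrr normr0.
have h := @cderiv_cintegral R pos
  (fun r s => gamma_integrand a (A + r%:C * B + s%:C))
  (fun r s => B * (((a - 1) / (A + r%:C * B + s%:C) - 1) * gamma_integrand a (A + r%:C * B + s%:C)))
  r0 e (fun s => cmod B * (V * P * expR (- 2^-1 * s))) (@mpos R) e0.
have -> : (fun r => incomplete_gamma a (A + r%:C * B)) =
    (fun r => cintegral pos (fun s => gamma_integrand a (A + r%:C * B + s%:C))).
  by apply/funext => r; exact: incomplete_gammaE.
apply: cderiv_eq (h _ _ _ _) _.
- move=> r s re /posP s0; have [sl' _] := near_r r s re (ltW s0).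
  apply: cderiv_gamma_integrand => //.
  by apply: cderiv_eq (cderivD (cderiv_line A B r) (cderiv_cst _ r)) _; rewrite addr0.
- move=> r re; apply: (@cintegrable_le _ _ _ (fun s => P * expR (- 2^-1 * s))).
  + exact: mpos.
  + by apply: cmeasurable_cderiv => s s0; eexists; exact: ds.
  + exact: iE.
  + by move=> s /posP s0; apply: gP => //; exact: ltW.
- by apply: RintegrableZl; [exact: mpos|exact: iE].
- move=> r s re /posP s0; rewrite (cmodM B) ler_wpM2l ?cmod_ge0//.
  by apply: g'P => //; exact: ltW.
have df s : 0 < s -> exists d, cderiv (fun s =>
    ((a - 1) / (A + r0%:C * B + s%:C) - 1) * gamma_integrand a (A + r0%:C * B + s%:C)) s d.
  move=> s0; have [sl' _] := near_r r0 s r0e (ltW s0).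
  eexists; apply: cderivM; last exact: (cderiv_gamma_integrand a (cderiv_shift _ s) sl').
  apply: cderivB; last exact: cderiv_cst.
  apply: cderivM; first exact: cderiv_cst.
  exact: (cderivV (cderiv_shift _ s) (slit_neq0 sl')).
have if_ : cintegrable pos (fun s =>
    ((a - 1) / (A + r0%:C * B + s%:C) - 1) * gamma_integrand a (A + r0%:C * B + s%:C)).
  apply: (@cintegrable_le _ _ _ (fun s => V * P * expR (- 2^-1 * s))).
  - exact: mpos.
  - exact: cmeasurable_cderiv.
  - exact: iE.
  - by move=> s /posP s0; apply: g'P => //; exact: ltW.
rewrite (cintegralZ _ (@mpos R) if_) mulNr -mulrN; congr (_ * _).
rewrite (@cFTC_pos _ (fun s => gamma_integrand a (A + r0%:C * B + s%:C)) _
  (gamma_integrand a (A + r0%:C * B)) 0) ?sub0r//.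
- by move=> s s0; exact: ds.
- have sl0 : slit (A + r0%:C * B + 0%:C) by rewrite addr0.
  by have := cderiv_ccvg_right (cderiv_gamma_integrand a (cderiv_shift _ 0) sl0); rewrite addr0.
- apply: (ccvg0_le _ (e := fun s => P * expR (- 2^-1 * s))).
    near=> s; apply: (gP r0 s r0e); near: s.
    by apply: nbhs_pinfty_ge; rewrite num_real.
  by rewrite -(mulr0 P); apply: cvgM; [exact: cvg_cst|exact: cvg_expRN].
Unshelve. all: by end_near. Qed.

End incomplete.

(** * The incomplete gamma function as a Stieltjes integral *)

Lemma ln_lt_sub1 (R : realType) (x : R) : 1 < x -> ln x < x - 1.
Proof.
move=> x1; have x0 : 0 < x by exact: lt_trans x1.
have := @expR_gt1Dx R (ln x).
have l0 : ln x != 0 by rewrite gt_eqF// ln_gt0.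
by rewrite lnK ?posrE// => /(_ l0); lra.
Qed.

Section stieltjes.
Variable R : realType.
Notation mu := (lmeas R).
Notation pos := (`]0%R, +oo[%classic : set R).
Variable a : R[i].
Hypothesis sa : slit a.
Implicit Types (om v z : R[i]) (b r t : R).

Lemma slit_dist : exists2 d, 0 < d & forall t, 0 <= t -> d <= cmod (a + t%:C).
Proof.
have [d d0 h] := slit_near sa; exists d => // t t0.
by have [] := h a t _ t0; rewrite ?subrr ?cmod0.
Qed.

Lemma slitD t : 0 <= t -> slit (a + t%:C).
Proof.
move=> t0; have [d d0 h] := slit_near sa.
by have [] := h a t _ t0; rewrite ?subrr ?cmod0.
Qed.

Definition stieltjes_ker v t : R[i] :=
  cexp (- ((a + t%:C) * v)) * ((phi t)%:C * (a + t%:C)^-1).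

Definition stieltjes_int v : R[i] := cintegral pos (stieltjes_ker v).

Lemma cmeasurable_stieltjes_ker v : cmeasurable pos (stieltjes_ker v).
Proof.
apply: cmeasurableM.
  apply: cmeasurable_cderiv => t _; eexists; apply: cderiv_cexp; apply: cderivN.
  exact: cderivM (cderiv_shift a t) (cderiv_cst v t).
apply: cmeasurableM; first by apply: cmeasurable_real; exact: measurable_phi.
apply: cmeasurable_cderiv => t t0; eexists.
by apply: cderivV (cderiv_shift a t) _; apply: slit_neq0; apply: slitD; exact: ltW.
Qed.

Lemma cmod_cexp_av v t : cmod (cexp (- ((a + t%:C) * v))) =
  expR (- complex.Re (a * v)) * expR (- complex.Re v * t).
Proof.
rewrite cmod_cexp -expRD; congr expR.
by rewrite ReN mulrDl ReD Re_realM; ring.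
Qed.

Lemma stieltjes_ker_le d v t : 0 < t -> 0 < d -> d <= cmod (a + t%:C) ->
  cmod (stieltjes_ker v t) <= d^-1 * expR (- complex.Re (a * v)) * expR (- (complex.Re v - 1) * t).
Proof.
move=> t0 d0 dt; have c0 : 0 < cmod (a + t%:C) by exact: lt_le_trans dt.
rewrite /stieltjes_ker (cmodM (cexp _)) cmod_cexp_av (cmodM (_%:C)) cmod_real cmodV.
rewrite (ger0_norm (ltW (phi_gt0 t0))).
have -> : - (complex.Re v - 1) * t = - complex.Re v * t + t by ring.
rewrite expRD.
have -> : d^-1 * expR (- complex.Re (a * v)) * (expR (- complex.Re v * t) * expR t) =
  expR (- complex.Re (a * v)) * expR (- complex.Re v * t) * (expR t * d^-1) by ring.
rewrite ler_wpM2l ?mulr_ge0 ?expR_ge0//; apply: ler_pM.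
- by rewrite ltW// phi_gt0.
- by rewrite invr_ge0 ltW.
- exact: phi_le.
- by rewrite lef_pV2 ?posrE.
Qed.

Lemma cintegrable_stieltjes_ker v : 1 < complex.Re v -> cintegrable pos (stieltjes_ker v).
Proof.
move=> v1; have [d d0 dt] := slit_dist.
apply: (@cintegrable_le _ _ _ (fun t => d^-1 * expR (- complex.Re (a * v)) *
  expR (- (complex.Re v - 1) * t))).
- exact: mpos.
- exact: cmeasurable_stieltjes_ker.
- by apply: RintegrableZl; [exact: mpos|apply: integrable_expRN; rewrite subr_gt0].
- by move=> t /posP t0; apply: stieltjes_ker_le => //; apply: dt; exact: ltW.
Qed.

(** Differentiation in [v] cancels the denominator [a + t]; what remains is the
    Laplace transform of [phi], and [v'(z) / (z - 1) = 1 / z]. *)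
Lemma cderiv_stieltjes_int b om r0 : 1 < complex.Re (b%:C + r0%:C * om) ->
  1 < complex.Re (vmap (b%:C + r0%:C * om)) ->
  cderiv (fun r => stieltjes_int (vmap (b%:C + r%:C * om))) r0
    (- (om / (b%:C + r0%:C * om)) * cexp (- (a * vmap (b%:C + r0%:C * om)))).
Proof.
move=> l1 v1; pose la r : R[i] := b%:C + r%:C * om; pose v r := vmap (la r).
have sla r : 1 < complex.Re (la r) -> slit (la r).
  by move=> h; apply: slit_Re; exact: lt_trans h.
have dla r : cderiv la r om by exact: cderiv_line.
have dv r : 1 < complex.Re (la r) -> cderiv v r (om - om / la r).
  by move=> h; apply: cderiv_vmap (dla r) _; exact: sla.
(* Any value strictly between [1] and [Re v(r0)] leaves an integrable bound on a
   neighbourhood of [r0]. *)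
pose k := (1 + complex.Re (v r0)) / 2.
have v1' : 1 < complex.Re (v r0) by [].
have k1 : 1 < k by rewrite /k; lra.
pose M := expR (- complex.Re (a * v r0)) + 1.
have M0 : 0 < M by rewrite ltr_pwDr// expR_ge0.
have : \forall r \near r0, [/\ 1 < complex.Re (la r), k < complex.Re (v r) &
    expR (- complex.Re (a * v r)) < M].
  have [c1 _] := cderiv_continuous (dla r0).
  have [c2 _] := cderiv_continuous (dv r0 l1).
  have [c3 _] := cderiv_continuous (cderivZ a (dv r0 l1)).
  have c4 : expR (- complex.Re (a * v r)) @[r --> r0] --> expR (- complex.Re (a * v r0)).
    apply: continuous_comp; last exact: continuous_expR.
    exact: cvgN.
  near=> r; split.
  - by near: r; exact: (cvgr_gt _ c1 _ l1).
  - by near: r; apply: (cvgr_gt _ c2); rewrite /k; lra.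
  - by near: r; apply: (cvgr_lt _ c4); rewrite /M ltrDl.
move=> /nbhs_ballP[e /= e0 he].
have near_r r : `|r - r0| < e -> [/\ 1 < complex.Re (la r), k < complex.Re (v r) &
    expR (- complex.Re (a * v r)) < M].
  by move=> re; apply: he; rewrite /ball/= distrC.
have r0e : `|r0 - r0| < e by rewrite subrr normr0.
have k10 : 0 < k - 1 by rewrite subr_gt0.
have ekt r t : `|r - r0| < e -> 0 < t ->
    expR (- complex.Re (a * v r)) * (expR (- complex.Re (v r) * t) * phi t) <=
    M * expR (- (k - 1) * t).
  move=> /near_r[_ h1 h2] t0; apply: ler_pM.
  - exact: expR_ge0.
  - by rewrite mulr_ge0 ?expR_ge0// ltW// phi_gt0.
  - exact: ltW.
  - have -> : - (k - 1) * t = - k * t + t by ring.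
    rewrite expRD; apply: ler_pM; rewrite ?expR_ge0//.
    + by rewrite ltW// phi_gt0.
    + by rewrite ler_expR !mulNr lerN2 ler_wpM2r// ltW.
    + exact: phi_le.
have h := @cderiv_cintegral R pos (fun r t => stieltjes_ker (v r) t)
  (fun r t => - (om - om / la r) * (cexp (- ((a + t%:C) * v r)) * (phi t)%:C)) r0 e
  (fun t => 2 * cmod om * (M * expR (- (k - 1) * t))) (@mpos R) e0.
apply: cderiv_eq (h _ _ _ _) _.
- move=> r t re /posP t0; have [l1r _ _] := near_r r re.
  have at0 : a + t%:C != 0 by apply: slit_neq0; apply: slitD; exact: ltW.
  have d1 := cderivM (cderiv_cexp (cderivN (cderivZ (a + t%:C) (dv r l1r))))
    (cderiv_cst ((phi t)%:C * (a + t%:C)^-1) r).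
  apply: cderiv_eq d1 _; rewrite mulr0 addr0; move: (cexp _) (om / _) => X Y.
  by field.
- move=> r re; apply: cintegrable_stieltjes_ker; have [_ h1 _] := near_r r re.
  exact: lt_trans h1.
- apply: RintegrableZl; first exact: mpos.
  by apply: RintegrableZl; [exact: mpos|exact: integrable_expRN].
- move=> r t re /posP t0; have [l1r _ _] := near_r r re.
  rewrite (cmodM (- _)) cmodN (cmodM (cexp _)) cmod_cexp_av cmod_real.
  rewrite (ger0_norm (ltW (phi_gt0 t0))); apply: ler_pM.
  + exact: cmod_ge0.
  + apply: mulr_ge0; last exact: ltW (phi_gt0 t0).
    by rewrite mulr_ge0 ?expR_ge0.
  + rewrite (le_trans (le_cmodD _ _))// cmodN mulr_natl mulr2n lerD2l cmodM cmodV.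
    rewrite ler_piMr ?cmod_ge0// invf_le1.
      by rewrite (le_trans (ltW l1r))// (le_trans (ler_norm _))// Re_le_cmod.
    by rewrite cmod_gt0 slit_neq0// sla.
  + by rewrite -mulrA; exact: ekt.
have E : (fun t => - (om - om / la r0) * (cexp (- ((a + t%:C) * v r0)) * (phi t)%:C)) =
  (fun t => - (om - om / la r0) * cexp (- (a * v r0)) *
     (cexp (- (v r0 * t%:C)) * (phi t)%:C)).
  apply/funext => t.
  have -> : - ((a + t%:C) * v r0) = - (a * v r0) + - (v r0 * t%:C) by ring.
  by rewrite cexpD; ring.
rewrite E (cintegralZ _ (@mpos R) (cintegrable_phi v1)).
rewrite laplace_phiE// -/(la r0) -/(v r0).
have l0 : la r0 != 0 by apply: slit_neq0; exact: sla.
have l10 : la r0 - 1 != 0.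
  rewrite subr_eq0; apply: contraTneq l1; rewrite -/(la r0) => ->.
  by rewrite ltxx.
move: (cexp _) l0 l10; move: (la r0) => w X l0 l10.
by field; rewrite l0 l10.
Unshelve. all: by end_near. Qed.

(** The difference of the two sides has derivative [0] along the segment, and it
    vanishes at the starting point on the positive real axis. *)
Lemma clogM_path b om T : 0 < b -> 0 <= T ->
  (forall r, 0 <= r <= T -> slit (b%:C + r%:C * om) /\ slit ((b%:C + r%:C * om) * a)) ->
  clog ((b%:C + T%:C * om) * a) = clog (b%:C + T%:C * om) + clog a.
Proof.
move=> b0 T0 h.
pose f r := clog ((b%:C + r%:C * om) * a) - clog (b%:C + r%:C * om) - clog a.
have df r : 0 <= r <= T -> cderiv f r 0.
  move=> /h[s1 s2].
  have dl := cderiv_line b%:C om r.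
  have d1 := cderiv_clog (cderivM dl (cderiv_cst a r)) s2.
  have d2 := cderivB (cderivB d1 (cderiv_clog dl s1)) (cderiv_cst (clog a) r).
  apply: cderiv_eq d2 _; have := slit_neq0 sa; have := slit_neq0 s1.
  move: (b%:C + r%:C * om) => w w0 a0.
  by field; rewrite w0 a0.
have := cderiv0_eq T0 df.
rewrite /f mul0r addr0 clogM_real// clog_real//.
have -> : (ln b)%:C + clog a - (ln b)%:C - clog a = 0 by ring.
move=> /eqP; rewrite subr_eq0 => /eqP e.
by rewrite -e; ring.
Qed.

(** The difference of the two sides of the Stieltjes formula for
    [Gamma(a, z a)], divided by [a^a]. *)
Definition defect z : R[i] :=
  stieltjes_int (vmap z) - cexp (- (a * clog a)) * incomplete_gamma a (z * a).

(** Along a path in [z], both terms have the derivative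
    [- z' / z * exp(- a v(z))]. *)
Lemma defect_path b om T : 0 < b -> 0 <= T ->
  (forall r, 0 <= r <= T -> [/\ 1 < complex.Re (b%:C + r%:C * om),
    1 < complex.Re (vmap (b%:C + r%:C * om)) & slit ((b%:C + r%:C * om) * a)]) ->
  defect (b%:C + T%:C * om) = defect b%:C.
Proof.
move=> b0 T0 h.
have sl r : 0 <= r <= T -> slit (b%:C + r%:C * om).
  by move=> /h[h1 _ _]; apply: slit_Re; exact: lt_trans h1.
have E r : (b%:C + r%:C * om) * a = b%:C * a + r%:C * (om * a) by ring.
have d r : 0 <= r <= T -> cderiv (fun r => defect (b%:C + r%:C * om)) r 0.
  move=> rT; have [h1 h2 h3] := h r rT.
  have lE : clog ((b%:C + r%:C * om) * a) = clog (b%:C + r%:C * om) + clog a.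
    apply: clogM_path => //; first by case/andP: rT.
    move=> x /andP[x0 xr]; have xT : 0 <= x <= T.
      by rewrite x0 (le_trans xr)//; case/andP: rT.
    by split; [exact: sl|have [] := h x xT].
  have s3 : slit (b%:C * a + r%:C * (om * a)) by rewrite -E.
  have d2 := cderivZ (cexp (- (a * clog a))) (cderiv_incomplete_gamma a s3).
  have -> : (fun r => defect (b%:C + r%:C * om)) = (fun r =>
      stieltjes_int (vmap (b%:C + r%:C * om)) -
      cexp (- (a * clog a)) * incomplete_gamma a (b%:C * a + r%:C * (om * a))).
    by apply/funext => x; rewrite /defect E.
  apply: cderiv_eq (cderivB (cderiv_stieltjes_int h1 h2) d2) _.
  rewrite -E /gamma_integrand lE /vmap; set w := b%:C + r%:C * om.
  have w0 : w != 0 by apply: slit_neq0; exact: sl.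
  have a0 := slit_neq0 sa.
  have e1 : cexp (- (a * clog a)) * (- (om * a) *
      cexp ((a - 1) * (clog w + clog a) - w * a)) =
    - (om * a) * (cexp (- (a * clog a)) * cexp ((a - 1) * (clog w + clog a) - w * a)).
    by ring.
  rewrite e1 -cexpD.
  have -> : - (a * clog a) + ((a - 1) * (clog w + clog a) - w * a) =
    - (a * (w - clog w)) + (- clog w + - clog a) by ring.
  rewrite !cexpD (cexpN (clog w)) (cexpN (clog a)) !cexp_clog//; last exact: sl.
  by move: (cexp _) => X; field; rewrite w0 a0.
have := cderiv0_eq T0 d; rewrite mul0r addr0; exact.
Qed.

(** The direction bisecting the angle between [1] and the conjugate of [a]:
    both [om] and [om * a] point into the right half-plane. *)
Let om : R[i] := conjc a + (cmod a)%:C.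

Let Re_om : complex.Re om = cmod a + complex.Re a.
Proof. by rewrite /om; case: (a) => x y /=; rewrite addrC. Qed.

Let om_a : om * a = (cmod a ^+ 2)%:C + (cmod a)%:C * a.
Proof.
rewrite /om mulrDl; congr (_ + _); rewrite cmod_sqr.
by case: (a) => x y; apply: complexP => /=; ring.
Qed.

Let a0 : 0 < cmod a. Proof. by rewrite cmod_gt0 slit_neq0. Qed.

Let c1 := complex.Re om.
Let c10 : 0 < c1. Proof. by rewrite /c1 Re_om slit_cmodDRe. Qed.

Let R2 := complex.Re (om * a).
Let R20 : 0 < R2.
Proof.
rewrite /R2 om_a ReD Re_realM /= expr2 -mulrDr mulr_gt0//.
exact: slit_cmodDRe.
Qed.

Let path_form b r s : (b%:C + r%:C * om) * a + s%:C =
  (b + r * cmod a)%:C * a + (r * cmod a ^+ 2 + s)%:C.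
Proof.
by rewrite mulrDl -mulrA om_a !real_complexD !real_complexM; ring.
Qed.

Let path_slit d b r s : 0 < b -> 0 <= r -> 0 <= s ->
  (forall t, 0 <= t -> d <= cmod (a + t%:C)) -> 0 <= d ->
  slit ((b%:C + r%:C * om) * a + s%:C) /\
  b * d <= cmod ((b%:C + r%:C * om) * a + s%:C).
Proof.
move=> b0 r0 s0 dt d0; rewrite path_form.
set P := b + _; set Q := _ + s.
have P0 : b <= P by rewrite lerDl mulr_ge0// ltW.
have Pp : 0 < P by exact: lt_le_trans P0.
have Q0 : 0 <= Q by rewrite addr_ge0// mulr_ge0 ?sqr_ge0.
have -> : P%:C * a + Q%:C = P%:C * (a + (Q / P)%:C).
  by rewrite mulrDr -real_complexM mulrC; congr (_ + _%:C); field; rewrite gt_eqF.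
have QP : 0 <= Q / P by rewrite divr_ge0// ltW.
split; first by apply: slitM_real => //; exact: slitD.
rewrite cmodM cmod_real gtr0_norm//; apply: ler_pM => //; first exact: ltW.
exact: dt.
Qed.

(** Along the ray [b + r om] both terms decay exponentially in [r], because
    [Re (om a) > 0]; their difference is constant, hence [0].  A large [b] keeps
    [Re v > 1] on the whole ray. *)
Lemma defect_large : exists B, forall b, B <= b -> 1 < b -> defect b%:C = 0.
Proof.
have [d d0 dt] := slit_dist.
have W0 : 0 < cmod om.
  by rewrite (lt_le_trans c10)// (le_trans (ler_norm _))// Re_le_cmod.
(* With this slope the linear bound on [ln |b + r om|] takes at most half of
   [Re (b + r om)]. *)
pose k := c1 / (2 * cmod om).
have k0 : 0 < k by rewrite divr_gt0// mulr_gt0.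
have k12 : k <= 2^-1.
  rewrite /k ler_pdivrMr ?mulr_gt0// mulrA mulVf ?pnatr_eq0// mul1r.
  by rewrite (le_trans (ler_norm _))// Re_le_cmod.
have [C hC] := ln_le_lin k0.
exists (2 * (2 + `|C|)) => b bB b1.
have b0 : 0 < b by exact: lt_trans b1.
pose la r : R[i] := b%:C + r%:C * om.
have Re_la r : complex.Re (la r) = b + r * c1 by rewrite /la ReD Re_realM.
have la1 r : 0 <= r -> 1 < complex.Re (la r).
  by move=> r0; rewrite Re_la (lt_le_trans b1)// lerDl mulr_ge0// ltW.
have vla r : 0 <= r -> 2 <= complex.Re (vmap (la r)).
  move=> r0; rewrite Re_vmap Re_la.
  have l0 : 0 < cmod (la r) by rewrite cmod_gt0 slit_neq0// slit_Re// (lt_trans _ (la1 r r0)).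
  have := hC _ l0.
  have : k * cmod (la r) <= k * (b + r * cmod om).
    rewrite ler_wpM2l ?(ltW k0)// (le_trans (le_cmodD _ _))// cmodM !cmod_real.
    by rewrite !ger0_norm// ltW.
  have -> : k * (b + r * cmod om) = k * b + r * c1 / 2.
    by rewrite /k; field; rewrite gt_eqF.
  have : k * b <= 2^-1 * b by rewrite ler_wpM2r// ltW.
  have := ler_norm C; have : 0 <= r * c1 by rewrite mulr_ge0// ltW.
  lra.
have const r : 0 <= r -> defect b%:C = defect (la r).
  move=> r0; apply/esym; apply: defect_path => // x /andP[x0 xr]; split.
  - exact: la1.
  - by rewrite (lt_le_trans _ (vla x x0))// ltr1n.
  - have [+ _] := path_slit b0 x0 (lexx 0) dt (ltW d0).
    by rewrite addr0.
pose E r := expR (- (R2 / 2) * r).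
have [C2 hC2] := clog_growth a b%:C om ltr01 (divr_gt0 R20 (ltr0n R 2)).
have Xle r : 0 <= r -> cmod (stieltjes_int (vmap (la r))) <=
    2 * (d^-1 * expR (C2 - b * complex.Re a)) * E r.
  move=> r0; have v2 := vla r r0.
  have v1 : 1 < complex.Re (vmap (la r)) by rewrite (lt_le_trans _ v2)// ltr1n.
  have v10 : 0 < complex.Re (vmap (la r)) - 1 by rewrite subr_gt0.
  set q := d^-1 * expR (- complex.Re (a * vmap (la r))).
  have q0 : 0 <= q by rewrite mulr_ge0 ?expR_ge0// invr_ge0 ltW.
  apply: (le_trans (cmod_cintegral_le (g := fun t => q *
     expR (- (complex.Re (vmap (la r)) - 1) * t)) (@mpos R) (cintegrable_stieltjes_ker v1) _ _)).
  - by apply: RintegrableZl; [exact: mpos|exact: integrable_expRN].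
  - by move=> t /posP t0; apply: stieltjes_ker_le => //; apply: dt; exact: ltW.
  rewrite RintegralZl//; last exact: integrable_expRN.
  rewrite Rintegral_expRN// -[leRHS]mulrA ler_wpM2l//.
  have h1 : q <= d^-1 * expR (C2 - b * complex.Re a) * E r.
    rewrite /q /E -mulrA -expRD ler_wpM2l ?invr_ge0 ?(ltW d0)// ler_expR.
    have s2 : slit (la r + 0%:C).
      by rewrite addr0; apply: slit_Re; exact: lt_trans (la1 r r0).
    have s3 : 1 <= cmod (la r + 0%:C).
      by rewrite addr0 (le_trans (ltW (la1 r r0)))// (le_trans (ler_norm _))// Re_le_cmod.
    have := hC2 r 0 (lexx 0) s2 s3; rewrite !addr0 (ger0_norm r0) -/(la r).
    have -> : complex.Re (a * vmap (la r)) =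
        b * complex.Re a + r * R2 - complex.Re (a * clog (la r)).
      rewrite /vmap mulrBr ReD ReN; congr (_ - _).
      have -> : a * la r = b%:C * a + r%:C * (om * a) by rewrite /la; ring.
      by rewrite ReD !Re_realM.
    lra.
  rewrite (le_trans _ h1)// ler_piMr// invf_le1//; lra.
pose e := Num.min (2^-1) (R2 / 2).
have e0 : 0 < e by rewrite lt_min invr_gt0 ltr0n divr_gt0.
have e12 : e <= 2^-1 by rewrite ge_min lexx.
have eR : e <= R2 / 2 by rewrite ge_min lexx orbT.
have bd0 : 0 < b * d by exact: mulr_gt0.
have [M M0 hM] := gamma_integrand_le a (b%:C * a) (om * a) bd0 e0.
have laE r : la r * a = b%:C * a + r%:C * (om * a) by rewrite /la; ring.
have gle r s : 0 <= r -> 0 <= s -> cmod (gamma_integrand a (la r * a + s%:C)) <=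
    M * E r * expR (- 2^-1 * s).
  move=> r0 s0; have [p1 p2] := path_slit b0 r0 s0 dt (ltW d0).
  have := hM r s s0; rewrite -laE => /(_ p1 p2) h; rewrite (le_trans h)//.
  rewrite (ger0_norm r0) -/R2; apply: ler_pM.
  - by rewrite mulr_ge0 ?expR_ge0// ltW.
  - exact: expR_ge0.
  - rewrite ler_wpM2l ?(ltW M0)// ler_expR.
    by have := ler_wpM2r r0 eR; lra.
  - rewrite ler_expR !mulNr lerN2 ler_wpM2r//; lra.
have Yle r : 0 <= r -> cmod (incomplete_gamma a (la r * a)) <= 2 * (M * 2) * E r.
  move=> r0; rewrite incomplete_gammaE.
  have ig : mu.-integrable pos (EFin \o (fun s => M * E r * expR (- 2^-1 * s))).
    by apply: RintegrableZl; [exact: mpos|exact: integrable_expRN].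
  have gl s : pos s -> cmod (gamma_integrand a (la r * a + s%:C)) <= M * E r * expR (- 2^-1 * s).
    by move=> /posP s0; apply: gle => //; exact: ltW.
  have ci : cintegrable pos (fun s => gamma_integrand a (la r * a + s%:C)).
    apply: cintegrable_le ig gl; first exact: mpos.
    apply: cmeasurable_cderiv => s s0; eexists.
    have [p1 _] := path_slit b0 r0 (ltW s0) dt (ltW d0).
    exact: (cderiv_gamma_integrand a (cderiv_shift _ s) p1).
  rewrite (le_trans (cmod_cintegral_le (@mpos R) ci ig gl))//.
  rewrite RintegralZl//; last exact: integrable_expRN.
  rewrite Rintegral_expRN// invrK le_eqVlt; apply/orP; left; apply/eqP.
  by ring.
set X0 := 2 * _ in Xle; set Y0 := 2 * _ in Yle.
pose Z := X0 + cmod (cexp (- (a * clog a))) * Y0.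
have bound n : cmod (defect b%:C) <= Z * E n%:R.
  rewrite (const n%:R)// /defect (le_trans (le_cmodD _ _))// cmodN.
  rewrite (cmodM (cexp _)) /Z (mulrDl X0); apply: lerD; first exact: Xle.
  by rewrite -mulrA; apply: ler_wpM2l; [exact: cmod_ge0|exact: Yle].
have lim : ccvg \oo (fun n : nat => defect b%:C) 0.
  apply: (ccvg0_le _ (e := fun n : nat => Z * E n%:R)).
    by apply: nearW => n; exact: bound.
  rewrite -(mulr0 Z); apply: cvgM; first exact: cvg_cst.
  have h := @cvg_expRN R (R2 / 2) (divr_gt0 R20 (ltr0n R 2)).
  exact: (cvg_comp _ _ (@cvgr_idn R) h).
exact: ccvg_unique (ccvg_cst _) lim.
Qed.

(** The difference is also constant along the real axis, which leads from
    large values of [lam] to all values above [1]. *)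
Lemma defect_real (lam : R) : 1 < lam -> defect lam%:C = 0.
Proof.
move=> lam1; have [B hB] := defect_large.
pose b := Num.max B lam.
have lb : lam <= b by rewrite le_max lexx orbT.
have Bb : B <= b by rewrite le_max lexx.
have e : b%:C = lam%:C + (b - lam)%:C * 1 :> R[i].
  by rewrite mulr1 -real_complexD; congr (_%:C); ring.
have <- : defect (lam%:C + (b - lam)%:C * 1) = defect lam%:C.
  apply: defect_path; rewrite ?subr_ge0//; first exact: lt_trans lam1.
  move=> r /andP[r0 _]; rewrite mulr1 -real_complexD.
  have l1 : 1 < lam + r by rewrite ltr_wpDr.
  have l0 : 0 < lam + r by exact: lt_trans l1.
  split => //.
  - rewrite Re_vmap cmod_real gtr0_norm//=.
    by have := @ln_lt_sub1 R (lam + r) l1; lra.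
  - by apply: slitM_real.
rewrite -e; apply: hB => //; exact: lt_le_trans lb.
Qed.

End stieltjes.

(** * Moments of the Laplace density *)

Section moments.
Variable R : realType.
Notation mu := (lmeas R).
Notation pos := (`]0%R, +oo[%classic : set R).
Implicit Types (t v lam : R) (n : nat).

Definition mom n v t : R := t ^+ n * (expR (- v * t) * phi t).

Lemma mom_ge0 n v t : 0 < t -> 0 <= mom n v t.
Proof.
move=> t0; apply: mulr_ge0; first by rewrite exprn_ge0// ltW.
by apply: mulr_ge0; [exact: expR_ge0|rewrite ltW// phi_gt0].
Qed.

Lemma momS n v t : t * mom n v t = mom n.+1 v t.
Proof. by rewrite /mom exprS; ring. Qed.

Lemma exprn_le_expR n (k : R) : 0 < k ->
  exists2 C, 0 < C & forall t, 0 < t -> t ^+ n <= C * expR (k * t).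
Proof.
move=> k0; have kn : 0 < k / n.+1%:R by rewrite divr_gt0.
have [C hC] := ln_le_lin kn; exists (expR (n%:R * C)); first exact: expR_gt0.
move=> t t0; rewrite -{1}(lnK (x := t)) ?posrE// -expRM_natl -expRD ler_expR.
apply: (le_trans (ler_wpM2l (ler0n R n) (hC t t0))).
rewrite mulrDr addrC lerD2l mulrA ler_wpM2r ?(ltW t0)//.
by rewrite mulrCA ler_piMr ?(ltW k0)// ler_pdivrMr ?mul1r ?ltr0n// ler_nat.
Qed.

(** Uniformity in [v] permits differentiation of the moments in [v]. *)
Lemma mom_le n (v0 : R) : 1 < v0 -> exists2 C, 0 < C & forall v t, v0 <= v -> 0 < t ->
  mom n v t <= C * expR (- ((v0 - 1) / 2) * t).
Proof.
move=> v1; have k0 : 0 < (v0 - 1) / 2 by rewrite divr_gt0 ?subr_gt0.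
have [C C0 hC] := exprn_le_expR n k0; exists C => // v t vv t0.
have e : - ((v0 - 1) / 2) * t = (v0 - 1) / 2 * t + (- v0 * t + t) by field.
rewrite e (expRD _ (- v0 * t + t)) mulrA; apply: ler_pM.
- by rewrite exprn_ge0// ltW.
- by apply: mulr_ge0; [exact: expR_ge0|rewrite ltW// phi_gt0].
- exact: hC.
rewrite expRD; apply: ler_pM; [exact: expR_ge0|by rewrite ltW// phi_gt0| |exact: phi_le].
by rewrite ler_expR ler_wpM2r ?(ltW t0)// lerN2.
Qed.

Lemma measurable_mom n v : measurable_fun pos (mom n v).
Proof.
apply: measurable_funM.
  by apply: measurable_funX; exact: measurable_id.
apply: measurable_funM; last exact: measurable_phi.
apply: measurable_pos => x _; exact: is_derive_continuous (is_derive_expRM _ _).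
Qed.

Lemma integrable_mom n v : 1 < v -> mu.-integrable pos (EFin \o mom n v).
Proof.
move=> v1; have [C C0 hC] := mom_le n v1.
apply: (Rintegrable_le (g := fun t => C * expR (- ((v - 1) / 2) * t)) (@mpos R)).
- exact: measurable_mom.
- apply: RintegrableZl; first exact: mpos.
  by apply: integrable_expRN; rewrite divr_gt0 ?subr_gt0.
- by move=> t /posP t0; rewrite ger0_norm ?mom_ge0//; exact: hC.
Qed.

Definition moment n v : R := \int[mu]_(t in pos) mom n v t.

Lemma moment0 lam : 1 < lam -> moment 0 (lam - ln lam) = (lam - 1)^-1.
Proof.
move=> lam1; have lam0 : 0 < lam by exact: lt_trans lam1.
have vE : vmap lam%:C = (lam - ln lam)%:C.
  by rewrite /vmap clog_real//; apply: complexP; rewrite /= ?subr0.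
have v1 : 1 < complex.Re (vmap lam%:C).
  by rewrite vE /=; have := ln_lt_sub1 lam1; lra.
have := laplace_phiE (z := lam%:C) lam1 v1.
have -> : (lam%:C - 1)^-1 = ((lam - 1)^-1)%:C :> R[i].
  rewrite real_complexV; congr (_^-1); apply: complexP; by rewrite /= ?subr0.
rewrite (eq_cintegral (g := fun t => (mom 0 (lam - ln lam) t)%:C)); last first.
  move=> t _; rewrite /mom expr0 mul1r real_complexM; congr (_ * _).
  by rewrite vE -real_complexM mulNr -cexp_real; congr cexp; apply: complexP; rewrite /= ?oppr0.
by rewrite cintegral_real => /(congr1 (@complex.Re R)).
Qed.

Lemma Gamma_real t : 0 < t -> Gamma t%:C = (gamma1 (t - 1))%:C.
Proof.
move=> t0; rewrite /Gamma /gamma_shift /= t0 big_ord0 divr1 addr0 /euler_gamma.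
rewrite -cintegral_real; apply: eq_cintegral => x /posP x0.
rewrite /cpow clog_real// /gker expRD real_complexM -!cexp_real.
by congr (cexp _ * cexp _); apply: complexP; rewrite ?ReM ?ImM /= ?subr0 ?mul0r ?mulr0 ?addr0 ?subr0 ?oppr0.
Qed.

Lemma scaled_gamma_real t : 0 < t -> scaled_gamma t%:C =
  (expR t / (Num.sqrt (2 * pi) * expR (2^-1 * ln t) * phi t))%:C.
Proof.
move=> t0; rewrite /scaled_gamma Gamma_real// /cpow clog_real//.
have -> : cexp ((t%:C - 2^-1) * (ln t)%:C) = (expR ((t - 2^-1) * ln t))%:C.
  rewrite -cexp_real; congr cexp; rewrite real_complexM; congr (_ * _).
  by rewrite rmorphB /= real_complexV; congr (_ - _^-1); rewrite rmorph_nat.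
have -> : cexp (- t%:C) = (expR (- t))%:C.
  by rewrite -cexp_real; congr cexp; apply: complexP; rewrite /= ?oppr0.
rewrite -!real_complexM -real_complexV -real_complexM; congr (_%:C).
have s0 : Num.sqrt (2 * pi) != 0 :> R.
  by rewrite gt_eqF// sqrtr_gt0 mulr_gt0// pi_gt0.
rewrite /phi (gamma1S t0) mulrBl (expRB (t * ln t)) expRN.
have l0 : t = expR (2^-1 * ln t) * expR (2^-1 * ln t).
  by rewrite -expRD -{1}(lnK (x := t)) ?posrE//; congr expR; field.
have g0 : gamma1 (t - 1) != 0.
  have := gamma1_gt0 t0; rewrite gamma1S//; by apply: contraTneq => ->; rewrite mulr0 ltxx.
have e0 x : expR x != 0 :> R by rewrite gt_eqF ?expR_gt0.
have -> : t * gamma1 (t - 1) = expR (2^-1 * ln t) * expR (2^-1 * ln t) * gamma1 (t - 1).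
  by rewrite -l0.
move: (e0 (t * ln t)) (e0 (2^-1 * ln t)) (e0 t).
set A := expR (t * ln t); set B := expR _; set C := expR t.
move=> hA hB hC.
by field; rewrite s0 hA hB hC g0.
Qed.

End moments.

Section integrands.
Variable R : realType.
Notation mu := (lmeas R).
Notation pos := (`]0%R, +oo[%classic : set R).
Implicit Types (t v lam : R) (n : nat).

(** The power of [t] and the exponential in [Gamma^*] combine with those of the
    integrand: [lam - log lam - 1] becomes [lam - log lam], and the half-integer
    power an integer one. *)
Lemma bintegrandE lam n t : 0 < t -> bintegrand lam n t =
  (Num.sqrt (2 * pi) * mom n (lam - ln lam) t)%:C.
Proof.
move=> t0; rewrite /bintegrand scaled_gamma_real// -real_complexV -real_complexM.
congr (_%:C); rewrite /mom /powR gt_eqF// mulrBl (expRB (n%:R * ln t)) expRM_natl lnK ?posrE//.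
have -> : - t * (lam - ln lam - 1) = - (lam - ln lam) * t + t by ring.
rewrite (expRD _ t).
have s0 : Num.sqrt (2 * pi) != 0 :> R.
  by rewrite gt_eqF// sqrtr_gt0 mulr_gt0// pi_gt0.
have e0 x : expR x != 0 :> R by rewrite gt_eqF ?expR_gt0.
have p0 : phi t != 0 by rewrite gt_eqF// phi_gt0.
move: (e0 (2^-1 * ln t)) (e0 t) p0; move: (phi t) (expR (2^-1 * ln t)) (expR t) (expR _).
by move=> A B C D hA hB hC; field; rewrite hA hB hC s0.
Qed.

Lemma RintegrandE lam (a : R[i]) n t : slit a -> 0 < t -> Rintegrand lam a n t =
  (Num.sqrt (2 * pi))%:C * (a * ((mom n (lam - ln lam) t)%:C / (a + t%:C))).
Proof.
move=> sa t0; have a0 := slit_neq0 sa.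
have at0 : a + t%:C != 0 by apply: slit_neq0; apply: slitD => //; exact: ltW.
have -> : Rintegrand lam a n t = bintegrand lam n t / (1 + t%:C / a).
  by rewrite /Rintegrand /bintegrand mulrAC.
rewrite bintegrandE// (real_complexM (Num.sqrt _)).
have -> : 1 + t%:C / a = (a + t%:C) / a by rewrite mulrDl divff.
by rewrite invf_div; field; exact: at0.
Qed.

Lemma cintegrable_mom_ratio (a : R[i]) n v : slit a -> 1 < v ->
  cintegrable pos (fun t => (mom n v t)%:C / (a + t%:C)).
Proof.
move=> sa v1; have [d d0 dt] := slit_dist sa.
apply: (@cintegrable_le _ _ _ (fun t => d^-1 * mom n v t)).
- exact: mpos.
- apply: cmeasurableM; first by apply: cmeasurable_real; exact: measurable_mom.
  apply: cmeasurable_cderiv => t t0; eexists.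
  by apply: cderivV (cderiv_shift a t) _; apply: slit_neq0; apply: slitD => //; exact: ltW.
- by apply: RintegrableZl; [exact: mpos|exact: integrable_mom].
move=> t /posP t0; rewrite (cmodM (_%:C)) cmod_real cmodV ger0_norm ?mom_ge0//.
rewrite mulrC; apply: ler_wpM2r; first exact: mom_ge0.
by have h := dt t (ltW t0); rewrite lef_pV2 ?posrE// (lt_le_trans d0).
Qed.

Lemma sub_ln_gt1 lam : 1 < lam -> 1 < lam - ln lam.
Proof. by move=> /(@ln_lt_sub1 R); lra. Qed.

Lemma cintegrable_bintegrand lam n : 1 < lam -> cintegrable pos (bintegrand lam n).
Proof.
move=> lam1; apply: (@eq_cintegrable R pos (fun t =>
  (Num.sqrt (2 * pi) * mom n (lam - ln lam) t)%:C)); first exact: mpos.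
  by move=> t /posP t0; rewrite bintegrandE.
apply: cintegrable_real; first exact: mpos.
by apply: RintegrableZl; [exact: mpos|apply: integrable_mom; exact: sub_ln_gt1].
Qed.

Lemma cintegral_bintegrand lam n : 1 < lam ->
  cintegral pos (bintegrand lam n) =
  (Num.sqrt (2 * pi) * moment n (lam - ln lam))%:C.
Proof.
move=> lam1; rewrite /moment -RintegralZl//; last first.
  by apply: integrable_mom; exact: sub_ln_gt1.
by rewrite -cintegral_real; apply: eq_cintegral => t /posP t0; rewrite bintegrandE.
Qed.

Lemma cintegrable_Rintegrand lam (a : R[i]) n : 1 < lam -> slit a ->
  cintegrable pos (Rintegrand lam a n).
Proof.
move=> lam1 sa; apply: (@eq_cintegrable R pos (fun t => (Num.sqrt (2 * pi))%:C *
   (a * ((mom n (lam - ln lam) t)%:C / (a + t%:C))))); first exact: mpos.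
  by move=> t /posP t0; rewrite RintegrandE.
do 2! (apply: cintegrableZ; first exact: mpos).
by apply: cintegrable_mom_ratio => //; exact: sub_ln_gt1.
Qed.

Lemma cintegral_Rintegrand lam (a : R[i]) n : 1 < lam -> slit a ->
  cintegral pos (Rintegrand lam a n) = (Num.sqrt (2 * pi))%:C *
    (a * cintegral pos (fun t => (mom n (lam - ln lam) t)%:C / (a + t%:C))).
Proof.
move=> lam1 sa.
have ci := cintegrable_mom_ratio n sa (sub_ln_gt1 lam1).
rewrite -cintegralZ//.
rewrite -cintegralZ//; last by apply: cintegrableZ; [exact: mpos|].
by apply: eq_cintegral => t /posP t0; rewrite RintegrandE.
Qed.

(** Integration of [a / (a + t) = 1 - t / (a + t)]; iterating this produces the
    terms of the expansion one by one. *)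
Lemma mom_ratioS lam (a : R[i]) n : 1 < lam -> slit a ->
  let S k := cintegral pos (fun t => (mom k (lam - ln lam) t)%:C / (a + t%:C)) in
  a * S n = (moment n (lam - ln lam))%:C - S n.+1.
Proof.
move=> lam1 sa S; have v1 := sub_ln_gt1 lam1.
have ci k := cintegrable_mom_ratio k sa v1.
rewrite /S -cintegralZ//.
rewrite /moment -cintegral_real -cintegralB//; last first.
  by apply: cintegrable_real; [exact: mpos|exact: integrable_mom].
apply: eq_cintegral => t /posP t0.
have at0 : a + t%:C != 0 by apply: slit_neq0; apply: slitD => //; exact: ltW.
by rewrite -momS real_complexM; field.
Qed.

(** The vanishing of [defect], with [a^a exp(-a v(lam)) = z^a exp(-z)] for
    [z = lam * a]. *)
Lemma incomplete_gamma_stieltjes lam (a : R[i]) : 1 < lam -> slit a ->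
  incomplete_gamma a (lam%:C * a) = cpow (lam%:C * a) a * cexp (- (lam%:C * a)) *
    cintegral pos (fun t => (mom 0 (lam - ln lam) t)%:C / (a + t%:C)).
Proof.
move=> lam1 sa; have lam0 : 0 < lam by exact: lt_trans lam1.
have := defect_real sa lam1; rewrite /defect => /eqP; rewrite subr_eq0 => /eqP h.
have e0 : cexp (a * clog a) * cexp (- (a * clog a)) = 1 by rewrite -cexpD addrN cexp0.
rewrite -[LHS]mul1r -e0 -mulrA -h.
have vE : vmap lam%:C = (lam - ln lam)%:C.
  by rewrite /vmap clog_real//; apply: complexP; rewrite /= ?subr0.
rewrite /cpow clogM_real// -(cexpD (a * _)) /stieltjes_int -cintegralZ//; last first.
  by apply: cintegrable_stieltjes_ker => //; rewrite vE; exact: sub_ln_gt1.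
rewrite -cintegralZ//; last first.
  by apply: cintegrable_mom_ratio => //; exact: sub_ln_gt1.
have key t : cexp (a * clog a) * cexp (- ((a + t%:C) * vmap lam%:C)) =
    cexp (a * ((ln lam)%:C + clog a) + - (lam%:C * a)) *
    (expR (- (lam - ln lam) * t))%:C.
  rewrite -cexp_real -(cexpD (a * clog a)) -(cexpD (_ + _)); congr cexp.
  by rewrite vE !(rmorphB, rmorphM, rmorphN) /=; ring.
apply: eq_cintegral => t _; rewrite /stieltjes_ker /mom expr0 mul1r real_complexM.
rewrite (mulrA (cexp (a * clog a))) key.
set A := cexp _; set B := (expR _)%:C; set D := (_ + _)^-1.
by ring.
Qed.

End integrands.

(** * Iterated derivatives on an open set *)

Section smooth.
Variables (R : realType) (O : set R).
Hypothesis oO : open O.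
Implicit Types (f g : R -> R) (n : nat) (x c : R).

(** Functions of class C^n on [O], with derivatives as witnesses: stability
    under the algebraic operations is then proved by induction on [n]. *)
Fixpoint Cn n f : Prop := if n is m.+1
  then exists2 f', (forall x, O x -> is_derive x 1 f (f' x)) & Cn m f'
  else True.

Lemma Cn_pred n f : Cn n.+1 f -> Cn n f.
Proof.
elim: n f => [//|n ih] f [f' df cf]; exists f' => //; exact: ih.
Qed.

Lemma CnD n f g : Cn n f -> Cn n g -> Cn n (fun x => f x + g x).
Proof.
elim: n f g => [//|n ih] f g [f' df cf] [g' dg cg].
exists (fun x => f' x + g' x); last exact: ih.
by move=> x Ox; exact: (is_deriveD (df x Ox) (dg x Ox)).
Qed.

Lemma is_deriveMR f g x (a b : R) : is_derive x 1 f a -> is_derive x 1 g b ->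
  is_derive x 1 (fun y => f y * g y) (a * g x + f x * b).
Proof.
move=> df dg; apply: (is_derive_eq (is_deriveM df dg)).
by rewrite /GRing.scale/=; ring.
Qed.

Lemma CnM n f g : Cn n f -> Cn n g -> Cn n (fun x => f x * g x).
Proof.
elim: n f g => [//|n ih] f g cf cg.
have cf1 := Cn_pred cf; have cg1 := Cn_pred cg.
have [f' df df'] := cf; have [g' dg dg'] := cg.
exists (fun x => f' x * g x + f x * g' x).
  by move=> x Ox; exact: is_deriveMR (df x Ox) (dg x Ox).
by apply: CnD; exact: ih.
Qed.

Lemma Cn_cst n c : Cn n (fun=> c).
Proof.
elim: n c => [//|n ih] c; exists (fun=> 0); last exact: ih.
by move=> x _; exact: is_derive_cst.
Qed.

Lemma Cn_id n : Cn n id.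
Proof.
case: n => [//|n]; exists (fun=> 1); last exact: Cn_cst.
by move=> x _; exact: is_derive_id.
Qed.

Lemma CnX n f k : Cn n f -> Cn n (fun x => f x ^+ k).
Proof.
move=> cf; elim: k => [|k ih]; first exact: Cn_cst.
have := CnM cf ih; congr (Cn n _); apply/funext => x; by rewrite exprS.
Qed.

Lemma CnV n f : (forall x, O x -> f x != 0) -> Cn n f -> Cn n (fun x => (f x)^-1).
Proof.
move=> f0; elim: n => [//|n ih] cf; have cf1 := Cn_pred cf; have [f' df cf'] := cf.
exists (fun x => -1 * (f' x * (f x)^-1 ^+ 2)).
  move=> x Ox; apply: (is_derive_eq (is_deriveV (f0 x Ox) (df x Ox))).
  by rewrite /GRing.scale/= -exprVn; ring.
apply: CnM; first exact: Cn_cst.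
by apply: CnM => //; apply: CnX; exact: ih.
Qed.

Lemma near_open x : O x -> \forall y \near x, O y.
Proof. by move=> Ox; apply: open_nbhs_nbhs; split. Qed.

Lemma derive1n_ext n f g x : (forall y, O y -> f y = g y) -> O x ->
  derive1n n f x = derive1n n g x.
Proof.
elim: n f g => [|n ih] f g fg Ox; first exact: fg.
rewrite !derive1Sn; apply: ih => // y Oy; rewrite !derive1E.
apply: near_eq_derive.
by near=> z; apply: fg; near: z; exact: near_open.
Unshelve. all: by end_near. Qed.

Lemma derive1n_succ n f f' x : (forall y, O y -> is_derive y 1 f (f' y)) -> O x ->
  derive1n n.+1 f x = derive1n n f' x.
Proof.
move=> df Ox; rewrite derive1Sn; apply: derive1n_ext => // y Oy.
by rewrite derive1E; have [_ ->] := df y Oy.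
Qed.

Lemma derive1nD n f g x : Cn n f -> Cn n g -> O x ->
  derive1n n (fun y => f y + g y) x = derive1n n f x + derive1n n g x.
Proof.
elim: n f g => [//|n ih] f g [f' df cf] [g' dg cg] Ox.
rewrite (derive1n_succ n df Ox) (derive1n_succ n dg Ox) -ih//.
by apply: derive1n_succ => // y Oy; exact: (is_deriveD (df y Oy) (dg y Oy)).
Qed.

Lemma derive1nZ n f c x : Cn n f -> O x ->
  derive1n n (fun y => c * f y) x = c * derive1n n f x.
Proof.
elim: n f => [//|n ih] f [f' df cf] Ox.
rewrite (derive1n_succ n df Ox) -ih//; apply: derive1n_succ => // y Oy.
exact: (is_deriveZ c (df y Oy)).
Qed.

(** Leibniz' rule for the factor [y]; at [y = 0] only the term of order
    [n - 1] remains. *)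
Lemma derive1n_idM n f x : Cn n f -> O x ->
  derive1n n (fun y => y * f y) x =
  x * derive1n n f x + n%:R * derive1n n.-1 f x.
Proof.
elim: n f => [|n ih] f cf Ox; first by rewrite mul0r addr0.
have cf1 := Cn_pred cf; have [f' df cf'] := cf.
have dM y : O y -> is_derive y 1 (fun y => y * f y) (f y + y * f' y).
  by move=> Oy; apply: (is_derive_eq (is_deriveMR (is_derive_id y 1) (df y Oy))); rewrite mul1r.
rewrite (derive1n_succ n dM Ox) derive1nD//; last by apply: CnM => //; exact: Cn_id.
rewrite ih// (derive1n_succ n df Ox).
case: n {ih cf dM} cf1 cf' => [|n] cf1 cf'; first by rewrite !mul0r; ring.
rewrite ![_.+1.-1]succnK -(derive1n_succ n df Ox) [n.+2%:R]mulrSr mulrDl mul1r.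
by rewrite addrC addrA.
Qed.

End smooth.

(** * Lagrange inversion for the coefficients b_n *)

Section expdiff.
Variable R : realType.
Notation mu := (lmeas R).
Implicit Types (u s lam : R) (k n : nat).
Let D : set R := `[1%R, 2%R]%classic.

(** The [k]-th derivative of [(exp u - 1) / u], extended to [u = 0], as an
    integral that makes its smoothness at [0] evident.  The interval [[1, 2]]
    stands for [[0, 1]], so that it lies in the open half-line. *)
Definition expdiff k u : R := \int[mu]_(s in D) ((s - 1) ^+ k * expR ((s - 1) * u)).

Let is_derive_shift u s : is_derive s 1 (fun s => expR ((s - 1) * u))
  (u * expR ((s - 1) * u)).
Proof.
have h : is_derive s 1 (fun s => expR (u * s)) _ := is_derive_expRM u s.
have -> : (fun s => expR ((s - 1) * u)) = (fun s => expR (- u) * expR (u * s)).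
  by apply/funext => y; rewrite -expRD; congr expR; ring.
apply: (is_derive_eq (is_deriveZ (expR (- u)) h)).
rewrite /GRing.scale/= mulrCA -expRD; congr (_ * expR _); ring.
Qed.

Let continuous_expdiff k u s :
  {for s, continuous (fun s => (s - 1) ^+ k * expR ((s - 1) * u))}.
Proof.
apply: cvgM; last exact: is_derive_continuous (is_derive_shift u s).
have c1 : {for s, continuous (fun s : R => s - 1)} by apply: cvgB; [exact: cvg_id|exact: cvg_cst].
exact: (continuous_comp c1 (@exprn_continuous R k _)).
Qed.

Let integrable_D (f : R -> R) : (forall s, {for s, continuous f}) ->
  mu.-integrable D (EFin \o f).
Proof.
move=> cf; apply: continuous_compact_integrable; first exact: segment_compact.
by apply: continuous_subspaceT => x; exact: cf.
Qed.

Lemma is_derive_expdiff k u : is_derive u 1 (expdiff k) (expdiff k.+1 u).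
Proof.
apply: (@is_derive_Rintegral R D (fun u s => (s - 1) ^+ k * expR ((s - 1) * u))
  (fun u s => (s - 1) ^+ k.+1 * expR ((s - 1) * u)) u 1
  (fun=> expR (`|u| + 1))) => //.
- exact: measurable_itv.
- move=> x s _ _; apply: (is_derive_eq (is_deriveZ ((s - 1) ^+ k) (is_derive_expRM (s - 1) x))).
  by rewrite /GRing.scale/= exprSr mulrA.
- by move=> x _; apply: integrable_D; exact: continuous_expdiff.
- by apply: integrable_D => s; exact: cst_continuous.
move=> x s xu; rewrite /D /= in_itv/= => /andP[s1 s2].
have s10 : 0 <= s - 1 by lra.
have s11 : s - 1 <= 1 by lra.
rewrite ger0_norm ?mulr_ge0 ?exprn_ge0 ?expR_ge0//.
rewrite -[leRHS]mul1r; apply: ler_pM; rewrite ?exprn_ge0 ?expR_ge0 ?exprn_ile1//.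
rewrite ler_expR (le_trans (ler_norm _))// normrM (ger0_norm s10).
have h : `|x| <= `|u| + 1.
  have -> : x = u + (x - u) by ring.
  by rewrite (le_trans (ler_normD _ _))// lerD2l ltW.
by rewrite (le_trans _ h)// ler_piMl.
Qed.

Lemma expdiffE u : u * expdiff 0 u = expR u - 1.
Proof.
have i0 : mu.-integrable D (EFin \o (fun s => expR ((s - 1) * u))).
  by apply: integrable_D => s; exact: is_derive_continuous (is_derive_shift u s).
rewrite /expdiff; under eq_Rintegral do rewrite expr0 mul1r.
rewrite -RintegralZl//; last exact: measurable_itv.
have c0 x : 0 < x -> {for x, continuous (fun s => u * expR ((s - 1) * u))}.
  move=> _; apply: cvgM; first exact: cvg_cst.
  exact: is_derive_continuous (is_derive_shift u x).
have := @FTC_segment R _ _ (fun x _ => is_derive_shift u x) c0 1 2 ltr01.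
rewrite /Rintegral ltr1n => -> //=.
have -> : 2 - 1 = 1 :> R by ring.
by rewrite subrr mul1r mul0r expR0.
Qed.

Lemma expdiff00 : expdiff 0 0 = 1.
Proof.
rewrite /expdiff; under eq_Rintegral do rewrite expr0 mul1r mulr0 expR0.
have c0 (x : R) : 0 < x -> {for x, continuous (fun=> 1 : R)}.
  by move=> _; exact: cst_continuous.
have := @FTC_segment R id (fun=> 1) (fun x _ => is_derive_id x 1) c0 1 2 ltr01.
by rewrite /Rintegral ltr1n => -> //=; ring.
Qed.

Lemma Cn_expdiff (O : set R) n k : Cn O n (expdiff k).
Proof.
elim: n k => [//|n ih] k; exists (expdiff k.+1); last exact: ih.
by move=> x _; exact: is_derive_expdiff.
Qed.

End expdiff.

Lemma is_deriveXR (R : realType) (f : R -> R) (x d : R) n : is_derive x 1 f d ->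
  is_derive x 1 (fun y => f y ^+ n.+1) (n.+1%:R * (d * f x ^+ n)).
Proof.
move=> df; elim: n => [|n ih].
  by have -> : (fun y => f y ^+ 1) = f by []; rewrite expr0 mulr1 mul1r.
have -> : (fun y => f y ^+ n.+2) = (fun y => f y * f y ^+ n.+1).
  by apply/funext => y; rewrite exprS.
apply: (is_derive_eq (is_deriveMR df ih)).
by rewrite [n.+2%:R]mulrSr [f x ^+ n.+1]exprS; ring.
Qed.

Section lagrange.
Variables (R : realType) (lam : R).
Hypothesis lam1 : 1 < lam.
Notation mu := (lmeas R).
Notation pos := (`]0%R, +oo[%classic : set R).
Implicit Types (u t x : R) (n k : nat).

Let lam0 : 0 < lam. Proof. exact: lt_trans lam1. Qed.

(** The shifts [u] of [log lam] that keep [lam * exp u] above [1]. *)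
Definition udom : set R := [set u | - ln lam < u].

Lemma open_udom : open udom. Proof. exact: open_gt. Qed.

Lemma udom0 : udom 0.
Proof. by rewrite /udom /= oppr_lt0 ln_gt0. Qed.

Lemma udom_gt1 u : udom u -> 1 < lam * expR u.
Proof.
rewrite /udom /= -ltr_expR expRN lnK ?posrE// -ltr_pdivrMl// mulr1.
by [].
Qed.

(** [W(u) / u] for [W(u) = lam * exp u - u - lam], extended to [u = 0]. *)
Definition quot u : R := lam * expdiff 0 u - 1.
Definition quot' u : R := lam * expdiff 1 u.

Lemma quotE u : u * quot u = lam * expR u - u - lam.
Proof. by rewrite /quot mulrBr mulrCA expdiffE; ring. Qed.

Lemma is_derive_quot u : is_derive u 1 quot (quot' u).
Proof.
apply: (is_derive_eq (is_deriveB (is_deriveZ lam (is_derive_expdiff 0 u)) (is_derive_cst (1 : R) u 1))).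
by rewrite subr0.
Qed.

Lemma quot0 : quot 0 = lam - 1.
Proof. by rewrite /quot expdiff00 mulr1. Qed.

Lemma quot_neq0 u : udom u -> quot u != 0.
Proof.
move=> /udom_gt1 ou; have [->|u0] := eqVneq u 0.
  by rewrite quot0 gt_eqF// subr_gt0.
suff : u * quot u != 0 by rewrite mulf_eq0 negb_or => /andP[].
rewrite quotE; have [u_gt|u_le] := ltP 0 u.
  have h : 0 <= lam * (expR u - (1 + u)).
    by rewrite mulr_ge0 ?(ltW lam0)// subr_ge0 expR_ge1Dx.
  have l1 : 0 < lam - 1 by rewrite subr_gt0.
  have p := mulr_gt0 l1 u_gt.
  by rewrite gt_eqF//; nra.
have u_lt : u < 0 by rewrite lt_neqAle u0.
have h : 0 <= lam * expR u * (expR (- u) - (1 - u)).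
  rewrite mulr_ge0 ?mulr_ge0 ?(ltW lam0) ?expR_ge0// subr_ge0.
  exact: expR_ge1Dx.
have e : lam * expR u * expR (- u) = lam by rewrite -mulrA -expRD addrN expR0 mulr1.
move: ou h e; set y := lam * expR u; set z := expR (- u) => ou h e.
by rewrite lt_eqF//; nra.
Qed.

Lemma quot_rec u : quot u + u * quot' u = lam * expR u - 1.
Proof.
have d1 : is_derive u 1 (fun y => y * quot y) (1 * quot u + u * quot' u).
  exact: is_deriveMR (is_derive_id u 1) (is_derive_quot u).
have d2 : is_derive u 1 (fun y => y * quot y) (lam * expR u - 1).
  have -> : (fun y => y * quot y) = (fun y => lam * expR y + (-1 * y - lam)).
    by apply/funext => y; rewrite quotE; ring.
  apply: (is_derive_eq (is_deriveD (is_deriveZ lam (is_derive_expR u))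
    (is_deriveB (is_deriveZ (-1) (is_derive_id u 1)) (is_derive_cst lam u 1)))).
  by rewrite /GRing.scale/= mulr1 subr0.
have [_ <-] := d2; have [_ ->] := d1; by rewrite mul1r.
Qed.

Definition psi u : R := (quot u)^-1.
Definition psi' u : R := - (quot' u * psi u ^+ 2).

Lemma bgenE : bgen lam = (fun u => (lam - 1) * psi u).
Proof.
apply/funext => u; rewrite /bgen; case: eqVneq => [->|u0].
  by rewrite /psi quot0 divff// gt_eqF// subr_gt0.
by rewrite -quotE invfM /psi; move: (quot u)^-1 => q; field.
Qed.

Lemma is_derive_psi u : udom u -> is_derive u 1 psi (psi' u).
Proof.
move=> ou; apply: (is_derive_eq (is_deriveV (quot_neq0 ou) (is_derive_quot u))).
by rewrite /GRing.scale/= /psi' /psi -exprVn; ring.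
Qed.

Lemma Cn_quot n : Cn udom n quot.
Proof.
apply: CnD; last exact: Cn_cst.
by apply: CnM; [exact: Cn_cst|exact: Cn_expdiff].
Qed.

Lemma Cn_psi n : Cn udom n psi.
Proof. by apply: CnV; [exact: quot_neq0|exact: Cn_quot]. Qed.

Lemma Cn_psi' n : Cn udom n psi'.
Proof.
have -> : psi' = (fun u => -1 * (lam * expdiff 1 u * psi u ^+ 2)).
  by apply/funext => u; rewrite mulN1r.
apply: CnM; first exact: Cn_cst.
apply: CnM; last exact/CnX/Cn_psi.
by apply: CnM; [exact: Cn_cst|exact: Cn_expdiff].
Qed.

Definition exponent u : R := lam * expR u - ln (lam * expR u).
Definition exponent' u : R := lam * expR u - 1.

Lemma exponentE u : exponent u = lam * expR u - (ln lam + u).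
Proof. by rewrite /exponent lnM ?posrE ?expR_gt0// expRK. Qed.

Lemma exponent_gt1 u : udom u -> 1 < exponent u.
Proof. by move=> /udom_gt1/(@sub_ln_gt1 R). Qed.

Lemma is_derive_exponent u : is_derive u 1 exponent (exponent' u).
Proof.
have -> : exponent = (fun y => lam * expR y + (-1 * y - ln lam)).
  by apply/funext => y; rewrite exponentE; ring.
apply: (is_derive_eq (is_deriveD (is_deriveZ lam (is_derive_expR u))
    (is_deriveB (is_deriveZ (-1) (is_derive_id u 1)) (is_derive_cst (ln lam) u 1)))).
by rewrite /GRing.scale/= mulr1 subr0.
Qed.

Lemma exponent_le u x : udom u -> u <= x -> exponent u <= exponent x.
Proof.
move=> /udom_gt1 ou ux; rewrite !exponentE.
have h : 0 <= lam * expR u * (expR (x - u) - (1 + (x - u))).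
  by rewrite mulr_ge0 ?mulr_ge0 ?(ltW lam0) ?expR_ge0// subr_ge0 expR_ge1Dx.
have e : lam * expR u * expR (x - u) = lam * expR x.
  by rewrite -mulrA -expRD; congr (_ * expR _); ring.
move: ou h e; set y := lam * expR u; set w := expR (x - u) => ou h e.
by rewrite -e; nra.
Qed.

(** The [k]-th moment at the parameter [lam * exp u] in place of [lam].  As a
    function of [u], the exponent [exponent] differs from [W] by a constant. *)
Definition moment_shift k u : R := moment k (exponent u).

Lemma moment_shift0 u : udom u -> moment_shift 0 u = (exponent' u)^-1.
Proof. by move=> /udom_gt1 ou; exact: moment0. Qed.

Lemma is_derive_mom k t u : is_derive u 1 (fun y => mom k (exponent y) t)
  (- exponent' u * mom k.+1 (exponent u) t).
Proof.
have d1 : is_derive u 1 (fun y => - t * exponent y) (- t * exponent' u).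
  exact: (is_deriveZ (- t) (is_derive_exponent u)).
have d2 := @is_derive1_comp R expR (fun y => - t * exponent y) u _ _ (is_derive_expR _) d1.
have -> : (fun y => mom k (exponent y) t) =
   (fun y => t ^+ k * phi t * (expR \o (fun y => - t * exponent y)) y).
  apply/funext => y; rewrite /mom /=.
  have -> : - exponent y * t = - t * exponent y by ring.
  by ring.
apply: (is_derive_eq (is_deriveZ (t ^+ k * phi t) d2)).
rewrite /GRing.scale/= /mom exprS.
have -> : - exponent u * t = - t * exponent u by ring.
by ring.
Qed.

Lemma is_derive_moment_shift k u : udom u ->
  is_derive u 1 (moment_shift k) (- exponent' u * moment_shift k.+1 u).
Proof.
move=> ou; pose e := (u + ln lam) / 2.
have e0 : 0 < e by rewrite divr_gt0// -ltrBlDr sub0r.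
pose u0 := u - e.
have ou0 : udom u0 by move: ou; rewrite /udom/= /u0 /e; lra.
have nbr x : `|x - u| < e -> u0 <= x /\ x <= u + e.
  by rewrite ltr_distl /u0 => /andP[h1 h2]; rewrite !ltW.
have sub x : u0 <= x -> udom x by move=> h; exact: lt_le_trans ou0 h.
have [C C0 hC] := mom_le k.+1 (exponent_gt1 ou0).
have v0 : 0 < (exponent u0 - 1) / 2 by rewrite divr_gt0// subr_gt0 exponent_gt1.
have -> : - exponent' u * moment_shift k.+1 u =
    \int[mu]_(t in pos) (- exponent' u * mom k.+1 (exponent u) t).
  by rewrite RintegralZl//; apply: integrable_mom; exact: exponent_gt1.
apply: (@is_derive_Rintegral R pos (fun x t => mom k (exponent x) t)
  (fun x t => - exponent' x * mom k.+1 (exponent x) t) u e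
  (fun t => lam * expR (u + e) * C * expR (- ((exponent u0 - 1) / 2) * t))).
- exact: mpos.
- exact: e0.
- by move=> x t _ _; exact: is_derive_mom.
- by move=> x /nbr[h _]; apply: integrable_mom; apply: exponent_gt1; exact: sub.
- by apply: RintegrableZl; [exact: mpos|exact: integrable_expRN].
move=> x t /nbr[h1 h2] /posP t0; rewrite normrM normrN -mulrA.
have ox := sub x h1; have ox1 := udom_gt1 ox.
apply: ler_pM => //.
  rewrite gtr0_norm ?subr_gt0// /exponent' (@le_trans _ _ (lam * expR x))//.
    by rewrite gerBl.
  by rewrite ler_wpM2l ?(ltW lam0)// ler_expR.
rewrite ger0_norm ?mom_ge0//; apply: hC => //; exact: exponent_le.
Qed.

Lemma Cn_exponent' n : Cn udom n exponent'.
Proof.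
apply: CnD; last exact: Cn_cst.
apply: CnM; first exact: Cn_cst.
elim: n => [//|n ih]; exists expR => // x _; exact: is_derive_expR.
Qed.

Lemma Cn_moment_shift n k : Cn udom n (moment_shift k).
Proof.
elim: n k => [//|n ih] k; exists (fun u => -1 * (exponent' u * moment_shift k.+1 u)).
  move=> u /(is_derive_moment_shift k) h; apply: (is_derive_eq h); by rewrite mulN1r mulNr.
apply: CnM; first exact: Cn_cst.
by apply: CnM; [exact: Cn_exponent'|exact: ih].
Qed.

(** Since [psi] is [u / W], differentiating [W * psi = u] gives
    [W' * psi = 1 - W * psi'], and [W * psi] is [u]. *)
Lemma psi_exponent' n u : udom u ->
  exponent' u * psi u ^+ n.+2 = psi u ^+ n.+1 - u * (psi' u * psi u ^+ n).
Proof.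
move=> ou; have q1 : quot u * psi u = 1 by rewrite /psi divff// quot_neq0.
rewrite /exponent' -quot_rec mulrDl exprS (mulrA (quot u)) q1 /psi' !exprS; ring.
Qed.

(** Lagrange's inversion formula. Since [moment_shift k.+1] is [- d/dW] of
    [moment_shift k], the right-hand side is the [n]-th derivative of
    [moment_shift k] with respect to [W], and the formula turns it into
    derivatives with respect to [u]. In the inductive step [psi_exponent']
    splits the function into a term [Y], whose derivative contains [n + 1]
    times [X], and the term [u * X], whose derivative at [u = 0] is the same
    multiple of a derivative of [X]: the two contributions of [X] cancel. *)
Lemma derive1n_lagrange n k :
  derive1n n (fun u => moment_shift k u * (exponent' u * psi u ^+ n.+1)) 0 =
  (-1) ^+ n * moment_shift (k + n) 0.
Proof.
have oO := open_udom; have o0 := udom0.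
elim: n k => [|n ih] k.
  rewrite /= addn0 expr1 mul1r /exponent' expR0 mulr1 /psi quot0 divff ?mulr1//.
  by rewrite gt_eqF// subr_gt0.
pose X u := moment_shift k u * (psi' u * psi u ^+ n).
pose Y u := moment_shift k u * psi u ^+ n.+1.
have cX : forall m, Cn udom m X.
  move=> m; apply: CnM; first exact: Cn_moment_shift.
  by apply: CnM; [exact: Cn_psi'|exact/CnX/Cn_psi].
have cY : forall m, Cn udom m Y.
  by move=> m; apply: CnM; [exact: Cn_moment_shift|exact/CnX/Cn_psi].
pose Z u := moment_shift k.+1 u * (exponent' u * psi u ^+ n.+1).
have cZ : forall m, Cn udom m Z.
  move=> m; apply: CnM; first exact: Cn_moment_shift.
  by apply: CnM; [exact: Cn_exponent'|exact/CnX/Cn_psi].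
have dY u : udom u -> is_derive u 1 Y (-1 * Z u + n.+1%:R * X u).
  move=> ou; apply: (is_derive_eq (is_deriveMR (is_derive_moment_shift k ou)
    (is_deriveXR n (is_derive_psi ou)))).
  by rewrite /Z /X; ring.
rewrite (@derive1n_ext R udom oO n.+1 _ (fun u => Y u + -1 * (u * X u)))//; last first.
  by move=> u ou; rewrite psi_exponent'// /Y /X; ring.
have cuX m : Cn udom m (fun u => u * X u) by apply: CnM; [exact: Cn_id|exact: cX].
rewrite (derive1nD oO)//; last by apply: CnM; [exact: Cn_cst|exact: cuX].
rewrite (derive1nZ oO)// (derive1n_idM oO)// mul0r add0r succnK.
rewrite (derive1n_succ oO n dY)// (derive1nD oO); last exact: o0.
- rewrite !(derive1nZ oO)//; have := ih k.+1; rewrite -/Z => ->.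
  by rewrite addSnnS exprS; ring.
- by apply: CnM; [exact: Cn_cst|exact: cZ].
- by apply: CnM; [exact: Cn_cst|exact: cX].
Qed.

(** For [k = 0] the factor [moment_shift 0 = 1 / W'] cancels [W'] in Lagrange's
    formula. *)
Lemma bcoefE n : bcoef lam n = (lam - 1) ^+ (2 * n + 1) * moment n (lam - ln lam).
Proof.
have oO := open_udom; have o0 := udom0.
have v0 : exponent 0 = lam - ln lam by rewrite /exponent expR0 mulr1.
rewrite /bcoef.
have -> : (fun t => bgen lam t ^+ n.+1) = (fun t => (lam - 1) ^+ n.+1 * psi t ^+ n.+1).
  by apply/funext => t; rewrite bgenE exprMn.
rewrite (derive1nZ oO)//; last by apply/CnX/Cn_psi.
have := derive1n_lagrange n 0; rewrite add0n /moment_shift v0 => h.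
rewrite (@derive1n_ext R udom oO n _ (fun u => moment_shift 0 u * (exponent' u * psi u ^+ n.+1)))//.
  have sg : (-1) ^+ n * (-1) ^+ n = 1 :> R by rewrite -exprMn mulrNN mulr1 expr1n.
  have pw : (lam - 1) ^+ (2 * n + 1) = (lam - 1) ^+ n * (lam - 1) ^+ n.+1.
    by rewrite -exprD; congr (_ ^+ _); rewrite addn1 addnS mul2n addnn.
  rewrite h pw; move: sg.
  set s := (-1) ^+ n; set A := _ ^+ n; set B := _ ^+ n.+1 => sg.
  transitivity (s * s * (A * B * moment n (lam - ln lam))); first by ring.
  by rewrite sg mul1r.
move=> u ou; rewrite moment_shift0// mulrA mulVf ?mul1r//.
by rewrite gt_eqF// subr_gt0 udom_gt1.
Qed.

End lagrange.

(** * The expansion and its remainder *)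

Section expansion.
Variables (R : realType) (lam : R) (a : R[i]).
Hypotheses (lam1 : 1 < lam) (sa : slit a).
Notation pos := (`]0%R, +oo[%classic : set R).
Let m n := (moment n (lam - ln lam))%:C.
Let S n := cintegral pos (fun t => (mom n (lam - ln lam) t)%:C / (a + t%:C)).

Let a0 : a != 0. Proof. exact: slit_neq0. Qed.

Lemma expansion_term (x c y : R[i]) n : x != 0 -> c != 0 ->
  (- x) ^+ n * (c ^+ (2 * n + 1) * y) / (c * x) ^+ (2 * n + 1) =
  (-1) ^+ n * y / x ^+ n.+1.
Proof.
move=> x0 c0; have xn := expf_neq0 n x0; have cn := expf_neq0 (2 * n + 1) c0.
rewrite exprMn [x ^+ (2 * n + 1)](_ : _ = x ^+ n * x ^+ n.+1); last first.
  by rewrite -exprD; congr (_ ^+ _); rewrite addn1 addnS mul2n addnn.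
have xn1 := expf_neq0 n.+1 x0; rewrite (exprNn x).
move: (_ ^+ n) xn (c ^+ _) cn (x ^+ n.+1) xn1 ((-1) ^+ n) => A hA B hB C hC E.
by field; rewrite hA hB hC.
Qed.

(** Iteration of [mom_ratioS]. *)
Lemma moment_expansion N :
  S 0 = \sum_(n < N) (-1) ^+ n * m n / a ^+ n.+1 + (-1) ^+ N * S N / a ^+ N.
Proof.
elim: N => [|N ->]; first by rewrite big_ord0 add0r !expr0 mul1r divr1.
rewrite big_ord_recr /= -addrA; congr (_ + _).
have h : S N = (m N - S N.+1) / a.
  by rewrite -(mom_ratioS N lam1 sa) -/(S N) mulrC mulKf.
rewrite h; have aN := expf_neq0 N a0; rewrite (exprS a) (exprS (-1)).
by field; rewrite a0 aN.
Qed.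

Let subE : lam%:C * a - a = (lam - 1)%:C * a.
Proof. by rewrite rmorphB /= mulrBl mul1r. Qed.

Let c0 : (lam - 1)%:C != 0 :> R[i].
Proof. by rewrite real_complex_eq0 gt_eqF// subr_gt0. Qed.

Lemma bcoef_term n :
  (- a) ^+ n * (bcoef lam n)%:C / (lam%:C * a - a) ^+ (2 * n + 1) =
  (-1) ^+ n * m n / a ^+ n.+1.
Proof. by rewrite bcoefE// real_complexM rmorphXn /= subE expansion_term. Qed.

Lemma remainderE N : remainder N a lam = (-1) ^+ N * S N / a ^+ N.
Proof.
rewrite /remainder cintegral_Rintegrand// subE -/(S N).
have s0 : Num.sqrt (2 * pi) != 0 :> R.
  by rewrite gt_eqF// sqrtr_gt0 mulr_gt0// pi_gt0.
have s1 : (Num.sqrt (2 * pi))%:C != 0 :> R[i] by rewrite real_complex_eq0.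
have := expansion_term (a * S N) N a0 c0.
rewrite real_complexM real_complexV rmorphXn /=.
set P := (- a) ^+ N; set Q := _ ^+ _ => h.
transitivity (P * (Q * (a * S N)) / ((lam - 1)%:C * a) ^+ (2 * N + 1)).
  have cn := expf_neq0 (2 * N + 1) (mulf_neq0 c0 a0).
  by field; rewrite s1 cn.
have aN := expf_neq0 N a0; rewrite h exprS.
by field; rewrite a0 aN.
Qed.

End expansion.

Theorem theorem1p1 (R : realType) (lambda : R) (hlambda : 1 < lambda) :
  (forall (N : nat) (a z : R[i]), z = lambda%:C * a -> cut_plane a ->
     cintegrable `]0, +oo[ (Rintegrand lambda a N) /\
     incomplete_gamma a z =
       cpow z a * cexp (- z)
       * (\sum_(n < N) (- a) ^+ n * (bcoef lambda n)%:C
                        / (z - a) ^+ (2 * n + 1)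
          + remainder N a lambda)) /\
  (forall n : nat,
     cintegrable `]0, +oo[ (bintegrand lambda n) /\
     (bcoef lambda n)%:C =
       ((lambda - 1) ^+ (2 * n + 1) / Num.sqrt (2 * pi))%:C
       * cintegral `]0, +oo[ (bintegrand lambda n)).
Proof.
split=> [N a z -> /slit_cut_plane sa|n]; split.
- exact: cintegrable_Rintegrand.
- rewrite incomplete_gamma_stieltjes// (moment_expansion hlambda sa N).
  rewrite remainderE//; congr (_ * (_ + _)); apply: eq_bigr => n _.
  by rewrite bcoef_term.
- exact: cintegrable_bintegrand.
rewrite bcoefE// cintegral_bintegrand// -real_complexM; congr (_%:C).
have s0 : Num.sqrt (2 * pi) != 0 :> R.
  by rewrite gt_eqF// sqrtr_gt0 mulr_gt0// pi_gt0.
by rewrite mulrA divfK.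
Qed.
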